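(* Let $a=(a_j)_{j\in\mathbb{Z}}\in\ell^1(\mathbb{Z})$ be a complex valued sequence satisfying (A1) and (A2bis) of the context, with associated data $K$, $\underline{\kappa}_k,\underline{z}_k,\alpha_k,\mu_k,\beta_k$ ($1\le k\le K$). Suppose there exists some integer $J\in\mathbb{Z}$ such that the shifted sequence $(a_{j+J})_{j\in\mathbb{Z}}$ satisfies (A2) and (A3) of the context. Then for all $s_1,\dots,s_K\in\mathbb{N}$ there exist, for each $k\in\{1,\dots,K\}$, a family of polynomials $(\mathscr{P}^k_\sigma)_{\sigma\in\{1,\dots,s_k\}}$ in $\mathbb{C}[X,Y]$, and two positive constants $C,c$, such that for all $n\in\mathbb{N}^*$ and $j\in\mathbb{Z}$, $$\left|\mathscr{G}_j^n-\sum_{k=1}^K\sum_{\sigma=1}^{s_k}\frac{\underline{z}_k^n\underline{\kappa}_k^j}{n^{\frac{\sigma}{2\mu_k}}}\left(\mathscr{P}^k_\sigma\left(X_{n,j,k},\frac{d}{dx}\right)H_{2\mu_k}^{\beta_k}\right)(X_{n,j,k})\right|\le\sum_{k=1}^K\frac{C}{n^{\frac{s_k+1}{2\mu_k}}}\exp\left(-c|X_{n,j,k}|^{\frac{2\mu_k}{2\mu_k-1}}\right),$$ where $X_{n,j,k}=\dfrac{n\alpha_k-j}{n^{\frac{1}{2\mu_k}}}$ (all data $\underline{\kappa}_k,\underline{z}_k,\alpha_k,\mu_k,\beta_k$ being those of the sequence $a$).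
   Context: Notation: $\mathbb{N}=\{0,1,2,\dots\}$, $\mathbb{N}^*=\mathbb{N}\setminus\{0\}$, $\mathbb{S}^1=\{z\in\mathbb{C}:|z|=1\}$. For a sequence $a$, its symbol is $F(\kappa)=\sum_{j\in\mathbb{Z}}a_j\kappa^j$, $\kappa\in\mathbb{S}^1$. Conditions on a sequence $a$ with symbol $F$: (A1) $a$ is finitely supported and has at least two nonzero coefficients. (A2) There is a finite set of distinct points $\{\underline{\kappa}_1,\dots,\underline{\kappa}_K\}\subset\mathbb{S}^1$, $K\ge1$, such that $\underline{z}_k:=F(\underline{\kappa}_k)\in\mathbb{S}^1$ for all $k$ and $|F(\kappa)|<1$ for all $\kappa\in\mathbb{S}^1\setminus\{\underline{\kappa}_1,\dots,\underline{\kappa}_K\}$. Moreover for each $k$ there exist a nonzero real number $\alpha_k$, an integer $\mu_k\ge1$ and a complex number $\beta_k$ with positive real part such that, as $\xi\to0$, $F(\underline{\kappa}_ke^{i\xi})=\underline{z}_k\exp(-i\alpha_k\xi-\beta_k\xi^{2\mu_k}+O(|\xi|^{2\mu_k+1}))$. (A2bis) The same as (A2), except that the real numbers $\alpha_k$ are allowed to be equal to $0$. (A3) (for a sequence satisfying (A2)) For all $k\in\{1,\dots,K\}$, the set $\mathcal{I}_k=\{\nu\in\{1,\dots,K\}:\underline{z}_\nu=\underline{z}_k\}$ has one or two elements; if it has two distinct elements $\nu_1,\nu_2$, then $\alpha_{\nu_1}\alpha_{\nu_2}<0$. When (A2) and (A3) are required of the shifted sequence $b=(a_{j+J})_{j}$,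 they refer to the symbol $\widetilde F(\kappa)=\kappa^{-J}F(\kappa)$ of $b$ and to the corresponding data of $b$. The operator $\mathscr{L}_a$ is $(\mathscr{L}_au)_j=\sum_{l\in\mathbb{Z}}a_lu_{j+l}$, and $\mathscr{G}_j^n:=(\mathscr{L}_a^n\delta)_j$ with $\delta=(\delta_{j,0})_{j\in\mathbb{Z}}$. For $\mu\in\mathbb{N}^*$ and $\beta\in\mathbb{C}$ with positive real part, $H_{2\mu}^\beta(x)=\frac{1}{2\pi}\int_{\mathbb{R}}e^{ixu}e^{-\beta u^{2\mu}}du$, $x\in\mathbb{R}$. For $P=\sum_{p,q}c_{p,q}X^pY^q\in\mathbb{C}[X,Y]$, $\left(P(x,\frac{d}{dx})H_{2\mu}^\beta\right)(x)=\sum_{p,q}c_{p,q}x^p(H_{2\mu}^\beta)^{(q)}(x)$. Empty sums are zero. *)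

(* Defs.v *)
From HB Require Import structures.
From mathcomp Require Import all_boot all_order all_algebra.
From mathcomp Require Import complex.
From mathcomp Require Import all_classical all_reals all_analysis.

Set Implicit Arguments.
Unset Strict Implicit.
Unset Printing Implicit Defensive.

Import Order.TTheory GRing.Theory Num.Theory.
Import numFieldNormedType.Exports.

Local Open Scope classical_set_scope.
Local Open Scope complex_scope.
Local Open Scope ring_scope.

Definition expC (R : realType) (z : R[i]) : R[i] :=
  (expR (complex.Re z))%:C * (cos (complex.Im z) +i* sin (complex.Im z)).

Definition ell1 (R : realType) (a : int -> R[i]) : Prop :=
  summable [set: int] (fun j => (ComplexField.Normc.normc (a j))%:E).

Definition condA1 (R : realType) (a : int -> R[i]) : Prop :=
  finite_set [set j | a j != 0] /\
  exists j1 j2 : int, [/\ j1 != j2, a j1 != 0 & a j2 != 0].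

(* The sums over int in [symbol] and [convL] are finitely supported sums, with
   value 0 by convention when the support is infinite. They are the intended
   series for finitely supported [a], i.e. under [condA1]. *)
Definition symbol (R : realType) (a : int -> R[i]) (kappa : R[i]) : R[i] :=
  \sum_(j \in [set: int]) a j * kappa ^ j.

Definition convL (R : realType) (a u : int -> R[i]) (j : int) : R[i] :=
  \sum_(l \in [set: int]) a l * u (j + l).

Definition delta0 (R : realType) (j : int) : R[i] := (j == 0)%:R.

Definition green (R : realType) (a : int -> R[i]) (n : nat) : int -> R[i] :=
  iter n (convL a) (@delta0 R).

Definition condA2bis (R : realType) (a : int -> R[i]) (K : nat)
    (kappa z : 'I_K -> R[i]) (alpha : 'I_K -> R) (mu : 'I_K -> nat)
    (beta : 'I_K -> R[i]) : Prop :=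
  [/\ (1 <= K)%N,
      injective kappa,
      forall k, [/\ `|kappa k| = 1, symbol a (kappa k) = z k & `|z k| = 1],
      forall x : R[i], `|x| = 1 -> (forall k, x != kappa k) ->
        `|symbol a x| < 1 &
      forall k, [/\ (1 <= mu k)%N, 0 < complex.Re (beta k) &
        exists M : R, \forall xi \near (0 : R), exists2 r : R[i],
          `|r| <= (M * `|xi| ^+ (2 * mu k).+1)%:C &
          symbol a (kappa k * expC ('i * xi%:C)) =
            z k * expC (- 'i * (alpha k * xi)%:C
                        - beta k * (xi ^+ (2 * mu k))%:C + r)]].

Definition condA2 (R : realType) (a : int -> R[i]) (K : nat)
    (kappa z : 'I_K -> R[i]) (alpha : 'I_K -> R) (mu : 'I_K -> nat)
    (beta : 'I_K -> R[i]) : Prop :=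
  condA2bis a kappa z alpha mu beta /\ (forall k, alpha k != 0).

Definition condA3 (R : realType) (K : nat)
    (z : 'I_K -> R[i]) (alpha : 'I_K -> R) : Prop :=
  forall k, let I := [set nu : 'I_K | z nu == z k]%SET in
    (#|I| = 1%N \/ #|I| = 2%N) /\
    (forall nu1 nu2, nu1 \in I -> nu2 \in I -> nu1 != nu2 ->
       alpha nu1 * alpha nu2 < 0).

Definition shiftseq (R : realType) (a : int -> R[i]) (J : int) : int -> R[i] :=
  fun j => a (j + J).

Definition condA23 (R : realType) (a : int -> R[i]) : Prop :=
  exists (K : nat) (kappa z : 'I_K -> R[i]) (alpha : 'I_K -> R)
    (mu : 'I_K -> nat) (beta : 'I_K -> R[i]),
    condA2 a kappa z alpha mu beta /\ condA3 z alpha.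

Definition integralC (R : realType) (f : R -> R[i]) : R[i] :=
  (\int[lebesgue_measure]_u complex.Re (f u)) +i*
  (\int[lebesgue_measure]_u complex.Im (f u)).

(* The library has no real normed module structure on R[i], hence derivatives
   of complex-valued functions of a real variable are taken componentwise. *)
Definition derivCn (R : realType) (q : nat) (f : R -> R[i]) (x : R) : R[i] :=
  derive1n q (fun t => complex.Re (f t) : R) x +i*
  derive1n q (fun t => complex.Im (f t) : R) x.

Definition Hgauss (R : realType) (mu : nat) (beta : R[i]) (x : R) : R[i] :=
  ((2 * pi)^-1)%:C *
  integralC (fun u : R =>
    expC ('i * (x * u)%:C) * expC (- beta * (u ^+ (2 * mu))%:C)).

(* [P : {poly {poly R[i]}}] encodes sum_(p, q) c_(p,q) X^p Y^q with Y the outer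
   variable: c_(p,q) = P`_q`_p. *)
Definition polyop (R : realType) (P : {poly {poly R[i]}}) (f : R -> R[i])
    (x : R) : R[i] :=
  \sum_(q < size P) (P`_q).[x%:C] * derivCn q f x.

Definition Xvar (R : realType) (n : nat) (j : int) (alpha : R) (mu : nat) : R :=
  (n%:R * alpha - j%:~R) / n%:R `^ (2 * mu)%:R^-1.

(* Main.v *)
(** By induction on n, the Green function is a Fourier coefficient of F^n:
    G_j^n = 1/(2 pi) int F(e^(-it))^n e^(-ijt) dt. Away from the points kappa_k,
    |F| is at most some q < 1 on the circle and contributes O(q^n). Near kappa_k,
    F(kappa_k e^(-iz)) = z_k e^(i alpha z - beta z^(2 mu)) g(z) with g entire and
    g = 1 + O(z^(2 mu + 1)); after the rescaling z = h v, h = n^(-1/(2 mu)), the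
    power g^n is expanded by Newton's formula into powers of h, whose coefficients
    are polynomials in v and give derivatives of H. The remainder is O(h^s) with
    an arbitrarily small Gaussian loss, and the segment of integration is moved to
    height +-e |X|^(1/(2 mu - 1)) in the complex plane, which yields the factor
    exp(-c |X|^(2 mu/(2 mu - 1))). When |j| is large compared with n, G_j^n
    vanishes and every term of the expansion is exponentially small. *)
Require Import Defs.
From HB Require Import structures.
From mathcomp Require Import all_boot all_order all_algebra.
From mathcomp Require Import complex.
From mathcomp Require Import all_classical all_reals all_analysis.
From mathcomp Require Import measurable_realfun ring lra zify.

Set Implicit Arguments.
Unset Strict Implicit.
Unset Printing Implicit Defensive.

Import Order.TTheory GRing.Theory Num.Theory.
Import numFieldNormedType.Exports.

Local Open Scope classical_set_scope.
Local Open Scope complex_scope.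
Local Open Scope ring_scope.

(** The order in which constants are chosen shapes the statements. The kernel tolerates a loss
    exp(eps |v|^(2 mu)) only for an [eps] dictated by [beta] and [mu]; this [eps] fixes the radius
    on which the expansion of g^n holds, hence the admissible half-widths rho of the arcs. Only then
    comes the bound on y relative to the half-length of the rescaled segment, which determines the
    height of the shifted segment. The condition on the symbol concerns real xi only, while the
    shift needs g off the axis. The passage is algebraic: a polynomial that is O(|x|^k) on the real
    axis is divisible by X^k. With y = |X|^(1/(2 mu - 1)) and h^(2 mu) n = 1 one has (h y)^(2 mu -
    1) = |alpha - j/n|. If h y is bounded, y^(2 mu) is at most a constant times n, so every
    exp(-lambda n) is an admissible error. If h y >= 1, then y^(2 mu) >= n and the decay of the
    expansion itself supplies all powers of h. One integer L separates these regimes and also bounds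
    the reach of the Green function. *)

Local Notation N := ComplexField.Normc.normc.
Local Notation Re := complex.Re.
Local Notation Im := complex.Im.
Local Notation leb := lebesgue_measure.

(** * Complex-valued functions of a real variable *)

Section ComplexNorm.
Context {R : realType}.
Implicit Types (x y : R) (z w : R[i]).

Lemma normcE z : `|z| = (N z)%:C. Proof. by case: z. Qed.

Lemma normc_ge0 z : 0 <= N z.
Proof. by case: z => a b; rewrite /= sqrtr_ge0. Qed.

Lemma normcD z w : N (z + w) <= N z + N w.
Proof. exact: le_normcD. Qed.

Lemma normcN z : N (- z) = N z. Proof. exact: (complex.normcN z). Qed.

Lemma normcM z w : N (z * w) = N z * N w.
Proof. exact: ComplexField.Normc.normcM. Qed.

Lemma normcV z : N z^-1 = (N z)^-1.
Proof. exact: ComplexField.Normc.normcV. Qed.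

Lemma normc0 : N (0 : R[i]) = 0. Proof. exact: ComplexField.Normc.normc0. Qed.
Lemma normc1 : N (1 : R[i]) = 1. Proof. exact: ComplexField.Normc.normc1. Qed.

Lemma normcX z n : N (z ^+ n) = N z ^+ n.
Proof. by elim: n => [|n ih]; rewrite ?expr0 ?normc1// !exprS normcM ih. Qed.

Lemma normcB z w : N (z - w) = N (w - z).
Proof. by rewrite -normcN opprB. Qed.

Lemma ler_normcB z w : N (z - w) <= N z + N w.
Proof. by rewrite (le_trans (normcD _ _))// normcN. Qed.

Lemma normc_real x : N x%:C = `|x|.
Proof. by rewrite /= expr0n/= addr0 sqrtr_sqr. Qed.

Lemma normc_i : N ('i : R[i]) = 1.
Proof. by rewrite /= expr0n/= add0r expr1n sqrtr1. Qed.

Lemma normc_Re z : `|Re z| <= N z.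
Proof.
by case: z => a b /=; rewrite -sqrtr_sqr ler_wsqrtr// lerDl sqr_ge0.
Qed.

Lemma normc_Im z : `|Im z| <= N z.
Proof.
by case: z => a b /=; rewrite -sqrtr_sqr ler_wsqrtr// lerDr sqr_ge0.
Qed.

Lemma normc_leReIm z : N z <= `|Re z| + `|Im z|.
Proof.
rewrite {1}(complexE z) (le_trans (normcD _ _))// normcM normc_i mul1r.
by rewrite !normc_real.
Qed.

Lemma normc_sum (I : Type) (r : seq I) (P : pred I) (F : I -> R[i]) :
  N (\sum_(i <- r | P i) F i) <= \sum_(i <- r | P i) N (F i).
Proof.
elim/big_rec2: _ => [|i x z _ h]; first by rewrite normc0.
by rewrite (le_trans (normcD _ _))// lerD2l.
Qed.

Lemma normc_nat (n : nat) : N (n%:R : R[i]) = n%:R.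
Proof.
have -> : (n%:R : R[i]) = (n%:R : R)%:C by rewrite rmorph_nat.
by rewrite normc_real ger0_norm.
Qed.

Lemma normc_horner (p : {poly R[i]}) z :
  N p.[z] <= \sum_(i < size p) N p`_i * N z ^+ i.
Proof.
rewrite horner_coef (le_trans (normc_sum _ _ _))//.
by apply: ler_sum => i _; rewrite normcM normcX.
Qed.

Lemma normc_bounded (p : {poly R[i]}) (B : R) :
  exists2 M, 0 <= M & forall z, N z <= B -> N p.[z] <= M.
Proof.
exists (\sum_(i < size p) N p`_i * `|B| ^+ i).
  by apply: sumr_ge0 => i _; rewrite mulr_ge0 ?normc_ge0// exprn_ge0.
move=> z zB; apply: (le_trans (normc_horner _ _)).
apply: ler_sum => i _; rewrite ler_wpM2l ?normc_ge0// lerXn2r ?nnegrE ?normc_ge0//.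
by rewrite (le_trans zB)// ler_norm.
Qed.

Lemma expCD z w : expC (z + w) = expC z * expC w.
Proof.
case: z => a b; case: w => c d; rewrite /expC /= expRD cosD sinD.
by apply/eqP; rewrite eq_complex /=; apply/andP; split; apply/eqP; ring.
Qed.

Lemma expC0 : expC 0 = 1 :> R[i].
Proof. by rewrite /expC /= expR0 cos0 sin0 mul1r. Qed.

Lemma expCN z : expC (- z) = (expC z)^-1.
Proof.
apply: (@mulIf _ (expC z)).
  apply/negP => /eqP h; have := expCD (- z) z.
  by rewrite h mulr0 addNr expC0; move/eqP; rewrite oner_eq0.
rewrite -expCD addNr expC0 mulVf//.
apply/negP => /eqP h; have := expCD (- z) z.
by rewrite h mulr0 addNr expC0; move/eqP; rewrite oner_eq0.
Qed.

Lemma normc_expC z : N (expC z) = expR (Re z).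
Proof.
rewrite /expC normcM normc_real ger0_norm ?expR_ge0//=.
by rewrite cos2Dsin2 sqrtr1 mulr1.
Qed.

Lemma expC_neq0 z : expC z != 0.
Proof.
apply/negP => /eqP h; have := normc_expC z; rewrite h normc0.
by move/eqP; rewrite lt_eqF ?expR_gt0.
Qed.

Lemma expCXn z n : expC (z *+ n) = expC z ^+ n.
Proof. by elim: n => [|n ih]; rewrite ?mulr0n ?expC0// mulrS exprS expCD ih. Qed.

Lemma expCXz z (j : int) : expC (z *~ j) = expC z ^ j.
Proof.
case: j => n; first by rewrite -pmulrn expCXn.
by rewrite NegzE mulrNz -pmulrn expCN expCXn.
Qed.

Lemma ReM z w : Re (z * w) = Re z * Re w - Im z * Im w.
Proof. by case: z; case: w. Qed.

Lemma ImM z w : Im (z * w) = Re z * Im w + Im z * Re w.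
Proof. by case: z; case: w. Qed.

Lemma ReD z w : Re (z + w) = Re z + Re w.
Proof. by case: z; case: w. Qed.

Lemma ImD z w : Im (z + w) = Im z + Im w.
Proof. by case: z; case: w. Qed.

Lemma ReN z : Re (- z) = - Re z. Proof. by case: z. Qed.
Lemma ImN z : Im (- z) = - Im z. Proof. by case: z. Qed.

Lemma complex_eq z w : Re z = Re w -> Im z = Im w -> z = w.
Proof. by case: z => a b; case: w => c d /= -> ->. Qed.

End ComplexNorm.

Section ContinuousComplex.
Context {R : realType}.
Implicit Types (f g : R -> R[i]).

Definition contC f :=
  continuous (fun t => Re (f t) : R) /\ continuous (fun t => Im (f t) : R).

Lemma contC_eq f g : f =1 g -> contC f -> contC g.
Proof. by move=> /funext ->. Qed.

Lemma contC_cst z : contC (fun=> z).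
Proof. by split => t; exact: cst_continuous. Qed.

Lemma contC_real (h : R -> R) : continuous h -> contC (fun t => (h t)%:C).
Proof. by move=> ch; split => //= t; exact: cst_continuous. Qed.

Lemma contC_id : contC (fun t : R => t%:C).
Proof. by apply: contC_real => t; exact: id. Qed.

Lemma contCD f g : contC f -> contC g -> contC (fun t => f t + g t).
Proof.
move=> [f1 f2] [g1 g2]; split => t.
  under eq_fun do rewrite ReD; apply: (@continuousD _ _ _ (fun t => Re (f t)) (fun t
    => Re (g t))); [exact: f1|exact: g1].
under eq_fun do rewrite ImD; apply: (@continuousD _ _ _ (fun t => Im (f t)) (fun t =>
  Im (g t))); [exact: f2|exact: g2].
Qed.

Lemma contCM f g : contC f -> contC g -> contC (fun t => f t * g t).
Proof.
move=> [f1 f2] [g1 g2]; split => t.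
  under eq_fun do rewrite ReM; apply: (@continuousB _ _ _ (fun t => Re (f t) * Re (g
    t)) (fun t => Im (f t) * Im (g t))).
    by apply: (@continuousM _ _ (fun t => Re (f t)) (fun t => Re (g t))); [exact:
      f1|exact: g1].
  by apply: (@continuousM _ _ (fun t => Im (f t)) (fun t => Im (g t))); [exact:
    f2|exact: g2].
under eq_fun do rewrite ImM; apply: (@continuousD _ _ _ (fun t => Re (f t) * Im (g
  t)) (fun t => Im (f t) * Re (g t))).
  by apply: (@continuousM _ _ (fun t => Re (f t)) (fun t => Im (g t))); [exact:
    f1|exact: g2].
by apply: (@continuousM _ _ (fun t => Im (f t)) (fun t => Re (g t))); [exact:
  f2|exact: g1].
Qed.

Lemma contCN f : contC f -> contC (fun t => - f t).
Proof.
move=> cf; apply: (@contC_eq (fun t => (-1) * f t)) => [t|]; first by rewrite mulN1r.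
by apply: contCM => //; exact: contC_cst.
Qed.

Lemma contCB f g : contC f -> contC g -> contC (fun t => f t - g t).
Proof. by move=> cf cg; apply: contCD => //; exact: contCN. Qed.

Lemma contCX f n : contC f -> contC (fun t => f t ^+ n).
Proof.
move=> cf; elim: n => [|n ih].
  by apply: (@contC_eq (fun=> 1)) => //; exact: contC_cst.
apply: (@contC_eq (fun t => f t * f t ^+ n)); first by move=> t; rewrite exprS.
exact: contCM.
Qed.

Lemma contC_sum (I : Type) (r : seq I) (F : I -> R -> R[i]) :
  (forall i, contC (F i)) -> contC (fun t => \sum_(i <- r) F i t).
Proof.
move=> cF; elim: r => [|i r ih].
  by apply: (@contC_eq (fun=> 0)) => [t|]; [rewrite big_nil|exact: contC_cst].
apply: (@contC_eq (fun t => F i t + \sum_(j <- r) F j t)).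
  by move=> t; rewrite big_cons.
exact: contCD.
Qed.

Lemma contC_exp f : contC f -> contC (fun t => expC (f t)).
Proof.
move=> [f1 f2]; apply: contCM; first apply: contC_real.
  move=> t; apply: (@continuous_comp _ _ _ (fun t => Re (f t)) expR).
    exact: f1.
  exact: continuous_expR.
split => t /=.
  apply: (@continuous_comp _ _ _ (fun t => Im (f t)) cos); first exact: f2.
  exact: continuous_cos.
apply: (@continuous_comp _ _ _ (fun t => Im (f t)) sin); first exact: f2.
exact: continuous_sin.
Qed.

Lemma contC_horner (p : {poly R[i]}) f : contC f -> contC (fun t => p.[f t]).
Proof.
move=> cf; elim/poly_ind: p => [|p c ih].
  by apply: (@contC_eq (fun=> 0)) => [t|]; [rewrite horner0|exact: contC_cst].
apply: (@contC_eq (fun t => p.[f t] * f t + c)).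
  by move=> t; rewrite hornerMXaddC.
by apply: contCD; [exact: contCM|exact: contC_cst].
Qed.

Lemma contC_normc f : contC f -> continuous (fun t => N (f t)).
Proof.
move=> [f1 f2] t.
have -> : (fun t => N (f t)) =
    (Num.sqrt \o (fun t => Re (f t) ^+ 2 + Im (f t) ^+ 2)).
  by apply/funext => u /=; case: (f u).
apply: continuous_comp; last exact: sqrt_continuous.
have -> : (fun t => Re (f t) ^+ 2 + Im (f t) ^+ 2) =
  (fun t => Re (f t) * Re (f t) + Im (f t) * Im (f t)).
  by apply/funext => u; rewrite !expr2.
apply: (@continuousD _ _ _ (fun t => Re (f t) * Re (f t)) (fun t => Im (f t) * Im (f
  t))).
  by apply: (@continuousM _ _ (fun t => Re (f t)) (fun t => Re (f t))); exact: f1.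
by apply: (@continuousM _ _ (fun t => Im (f t)) (fun t => Im (f t))); exact: f2.
Qed.

End ContinuousComplex.

(** * Derivatives of complex-valued functions and the Taylor remainder of [expC] *)

Section DerivComplex.
Context {R : realType}.
Implicit Types (f g : R -> R[i]).

Definition derC f f' := forall t : R,
  is_derive t 1 (fun t => Re (f t) : R) (Re (f' t)) /\
  is_derive t 1 (fun t => Im (f t) : R) (Im (f' t)).

Lemma derC_eq f g f' g' : f =1 g -> f' =1 g' -> derC f f' -> derC g g'.
Proof. by move=> /funext -> /funext ->. Qed.

Lemma is_derive_val (h : R -> R) (t d d' : R) :
  is_derive t 1 h d -> d = d' -> is_derive t 1 h d'.
Proof. by move=> ? <-. Qed.

Lemma is_derive_add (h k : R -> R) (t a b : R) :
  is_derive t 1 h a -> is_derive t 1 k b ->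
  is_derive t 1 (fun x => h x + k x) (a + b).
Proof. exact: is_deriveD. Qed.

Lemma is_derive_sub (h k : R -> R) (t a b : R) :
  is_derive t 1 h a -> is_derive t 1 k b ->
  is_derive t 1 (fun x => h x - k x) (a - b).
Proof. exact: is_deriveB. Qed.

Lemma is_derive_mul (h k : R -> R) (t a b : R) :
  is_derive t 1 h a -> is_derive t 1 k b ->
  is_derive t 1 (fun x => h x * k x) (h t * b + k t * a).
Proof. exact: is_deriveM. Qed.

Lemma is_derive_exprn (n : nat) (t : R) :
  is_derive t 1 (fun x => x ^+ n) (n%:R * t ^+ n.-1).
Proof.
have := is_deriveX n (is_derive_id t (1 : R)).
rewrite /GRing.scale /= mulr1.
by have -> : (id ^+ n : R -> R) = (fun x => x ^+ n) by rewrite exprfctE.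
Qed.

Lemma derC_cst z : derC (fun=> z) (fun=> 0).
Proof. by move=> t; split; exact: is_derive_cst. Qed.

Lemma derC_id : derC (fun t => t%:C) (fun=> 1).
Proof. by move=> t; split; [exact: is_derive_id|exact: is_derive_cst]. Qed.

Lemma derCD f g f' g' : derC f f' -> derC g g' ->
  derC (fun t => f t + g t) (fun t => f' t + g' t).
Proof.
move=> df dg t; have [[a b] [c d]] := (df t, dg t).
by split; rewrite ?ReD ?ImD; [under eq_fun do rewrite ReD|under eq_fun do rewrite ImD];
  exact: is_deriveD.
Qed.

Lemma derCM f g f' g' : derC f f' -> derC g g' ->
  derC (fun t => f t * g t) (fun t => f' t * g t + f t * g' t).
Proof.
move=> df dg t; have [[a b] [c d]] := (df t, dg t); split.
  have -> : (fun t => Re (f t * g t)) =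
    (fun t => Re (f t) * Re (g t) - Im (f t) * Im (g t)).
    by apply/funext => u; rewrite ReM.
  apply: (is_derive_val (is_derive_sub (is_derive_mul a c) (is_derive_mul b d))).
  by rewrite ReD !ReM /GRing.scale /=; ring.
have -> : (fun t => Im (f t * g t)) =
  (fun t => Re (f t) * Im (g t) + Im (f t) * Re (g t)).
  by apply/funext => u; rewrite ImM.
apply: (is_derive_val (is_derive_add (is_derive_mul a d) (is_derive_mul b c))).
by rewrite ImD !ImM /GRing.scale /=; ring.
Qed.

Lemma derC_exp f f' : derC f f' ->
  derC (fun t => expC (f t)) (fun t => f' t * expC (f t)).
Proof.
move=> df t; have [a b] := df t; split.
  have -> : (fun t => Re (expC (f t))) =
    (fun t => (expR \o (fun t => Re (f t))) t * (cos \o (fun t => Im (f t))) t).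
    by apply/funext => u; rewrite /expC ReM /= mul0r subr0.
  apply: (is_derive_val (is_derive_mul (is_derive1_comp (is_derive_expR _) a)
      (is_derive1_comp (is_derive_cos _) b))).
  by rewrite /expC !(ReM, ImM) /GRing.scale /=; ring.
have -> : (fun t => Im (expC (f t))) =
  (fun t => (expR \o (fun t => Re (f t))) t * (sin \o (fun t => Im (f t))) t).
  by apply/funext => u; rewrite /expC ImM /= mul0r addr0.
apply: (is_derive_val (is_derive_mul (is_derive1_comp (is_derive_expR _) a)
    (is_derive1_comp (is_derive_sin _) b))).
by rewrite /expC !(ReM, ImM) /GRing.scale /=; ring.
Qed.

Lemma derC_horner (p : {poly R[i]}) f f' : derC f f' ->
  derC (fun t => p.[f t]) (fun t => f' t * p^`().[f t]).
Proof.
move=> df; elim/poly_ind: p => [|p c ih].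
  apply: (@derC_eq (fun=> 0) _ (fun=> 0)); last exact: derC_cst.
    by move=> t; rewrite horner0.
  by move=> t; rewrite deriv0 horner0 mulr0.
apply: derC_eq (derCD (derCM ih df) (derC_cst c)) => t.
  by rewrite hornerMXaddC.
by rewrite derivD derivM derivX derivC !hornerE /=; ring.
Qed.

Lemma derC_cont f f' : derC f f' -> contC f.
Proof.
move=> df; split => t.
  by apply/differentiable_continuous/derivable1_diffP; case: (df t) => -[].
by apply/differentiable_continuous/derivable1_diffP; case: (df t) => _ [].
Qed.

(** The mean value theorem gives different intermediate points for the real and the imaginary part,
    hence the factor 2. *)
Lemma derC_lip f f' (a b M : R) : derC f f' -> a <= b ->
  (forall t, a <= t <= b -> N (f' t) <= M) ->
  N (f b - f a) <= 2 * M * (b - a).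
Proof.
move=> df ab fM; rewrite (le_trans (normc_leReIm _))//.
have [c1 c2] := derC_cont df.
have ba0 : 0 <= b - a by rewrite subr_ge0.
have [c cab e1] := @MVT_segment R (fun t => Re (f t)) (fun t => Re (f' t)) a b ab
  (fun t _ => (df t).1) (continuous_subspaceT c1).
have [d dab e2] := @MVT_segment R (fun t => Im (f t)) (fun t => Im (f' t)) a b ab
  (fun t _ => (df t).2) (continuous_subspaceT c2).
have -> : 2 * M * (b - a) = M * (b - a) + M * (b - a) by ring.
rewrite !ReD !ImD !ReN !ImN e1 e2 !normrM (ger0_norm ba0).
apply: lerD; apply: ler_wpM2r => //.
  by rewrite (le_trans (normc_Re _))// fM//; move: cab; rewrite in_itv.
by rewrite (le_trans (normc_Im _))// fM//; move: dab; rewrite in_itv.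
Qed.

(** One integration of a power bound; iterated, it builds up the factorial of the Taylor
    remainder. *)
Lemma real_antiderivative_bound (h h' : R -> R) (C b : R) n : 0 <= b ->
  (forall t : R, is_derive t 1 h (h' t)) -> h 0 = 0 ->
  (forall t, 0 <= t <= b -> `|h' t| <= C * t ^+ n) ->
  `|h b| <= C * b ^+ n.+1 / n.+1%:R.
Proof.
move=> b0 dh h0 hC.
have aux (k k' : R -> R) : (forall t : R, is_derive t 1 k (k' t)) -> k 0 = 0 ->
  (forall t, 0 <= t <= b -> k' t <= C * t ^+ n) -> k b <= C * b ^+ n.+1 / n.+1%:R.
  move=> dk k0 kC.
  (* [G] vanishes at 0 and is nondecreasing; the two-sided bound comes from applying this to h and
     to -h. *)
  pose G (t : R) := C * t ^+ n.+1 / n.+1%:R - k t.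
  have dG (t : R) : is_derive t 1 G (C * t ^+ n - k' t).
    have e1 := is_derive_mul (is_derive_cst C t (1 : R)) (is_derive_exprn n.+1 t).
    have e2 := is_derive_mul e1 (is_derive_cst (n.+1%:R^-1 : R) t (1 : R)).
    have e3 := is_derive_sub e2 (dk t).
    apply: (is_derive_val e3).
    rewrite /cst /= !mulr0 add0r addr0; congr (_ - _).
    by field; rewrite -[1 + _]/(1%:R + n%:R) -natrD pnatr_eq0.
  have -> : k b = C * b ^+ n.+1 / n.+1%:R - G b by rewrite /G; ring.
  rewrite lerBlDr lerDl.
  have <- : G 0 = 0 by rewrite /G exprS mul0r mulr0 mul0r k0 subr0.
  apply: (@ger0_derive1_le_cc R G 0 b); rewrite ?in_itv/= ?lexx ?b0//.
  - move=> x; rewrite in_itv/= => /andP[x0 xb].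
    by rewrite derive1E; case: (dG x) => _ ->; rewrite subr_ge0 kC// !ltW.
  - apply: continuous_subspaceT => x.
    by apply/differentiable_continuous/derivable1_diffP; case: (dG x).
rewrite ler_norml lerNl; apply/andP; split.
  apply: (aux (fun t => - h t) (fun t => - h' t)).
  - by rewrite h0 oppr0.
  - by move=> t tb; rewrite (le_trans (ler_norm _))// normrN hC.
by apply: (aux h h') => // t tb; rewrite (le_trans (ler_norm _))// hC.
Qed.

(** The index counts terms: it is the order of the remainder and drops by one under
    differentiation. *)
Definition expC_taylor n : {poly R[i]} := \poly_(i < n) (i`!%:R)^-1.

Lemma deriv_expC_taylor n : (expC_taylor n.+1)^`() = expC_taylor n.
Proof.
apply/polyP => i; rewrite coef_deriv !coef_poly ltnS.
case: ifP => // _; last by rewrite mul0rn.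
by rewrite -[LHS]mulr_natl factS natrM invfM mulrA divff ?mul1r// pnatr_eq0.
Qed.

(** Along the segment from 0 to z, the derivative of the remainder of order n + 1 is z times the
    remainder of order n. The factor 2^n arises because real and imaginary parts are integrated
    separately at each step. *)
Lemma expC_taylorP (z : R[i]) n (t : R) : 0 <= t <= 1 ->
  N (expC (t%:C * z) - (expC_taylor n).[t%:C * z]) <=
    expR (N z) * (2 * N z) ^+ n / n`!%:R * t ^+ n.
Proof.
elim: n t => [|n ih] t /andP[t0 t1].
  rewrite /expC_taylor poly_def big_ord0 horner0 subr0 normc_expC !expr0.
  rewrite fact0 divr1 !mulr1 ler_expR (le_trans (ler_norm _))//.
  rewrite (le_trans (normc_Re _))// normcM normc_real ger0_norm//.
  by rewrite ler_piMl// normc_ge0.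
pose f (t : R) := expC (t%:C * z) - (expC_taylor n.+1).[t%:C * z].
pose f' (t : R) := z * (expC (t%:C * z) - (expC_taylor n).[t%:C * z]).
have dtz : derC (fun t => t%:C * z) (fun=> z).
  apply: derC_eq (derCM derC_id (derC_cst z)) => // u.
  by rewrite mul1r mulr0 addr0.
have df : derC f f'.
  apply: derC_eq (derCD (derC_exp dtz)
    (derCM (derC_cst (-1)) (derC_horner (expC_taylor n.+1) dtz))) => u.
    by rewrite mulN1r.
  by rewrite deriv_expC_taylor /f'; ring.
have f0 : f 0 = 0.
  rewrite /f mul0r expC0 horner_coef0 coef_poly /= invr1; exact: subrr.
set C := expR (N z) * (2 * N z) ^+ n / n`!%:R * N z.
have bd u : 0 <= u <= t -> N (f' u) <= C * u ^+ n.
  move=> /andP[u0 ut]; rewrite /f' normcM /C [leRHS]mulrAC mulrC.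
  by rewrite ler_wpM2r ?normc_ge0// ih// u0 (le_trans ut).
rewrite -/(f t) (le_trans (normc_leReIm _))//.
have h1 := @real_antiderivative_bound _ _ C t n t0 (fun t => (df t).1) (congr1
  (@complex.Re R) f0)
  (fun u hu => le_trans (normc_Re _) (bd u hu)).
have h2 := @real_antiderivative_bound _ _ C t n t0 (fun t => (df t).2) (congr1
  (@complex.Im R) f0)
  (fun u hu => le_trans (normc_Im _) (bd u hu)).
apply: (le_trans (lerD h1 h2)).
have -> : n.+1`!%:R = n.+1%:R * n`!%:R :> R by rewrite factS natrM.
rewrite /C (exprS (2 * N z)) invfM le_eqVlt; apply/orP; left; apply/eqP.
move: (n.+1%:R^-1) (n`!%:R^-1) => u v; ring.
Qed.

End DerivComplex.

(** * Componentwise integrals of complex-valued functions *)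

Section IntegralComplex.
Context {R : realType}.
Implicit Types (f g : R -> R[i]) (D : set R).

(** Over [setT] this is convertible to [integralC], which connects the results below to [Hgauss]. *)
Definition intC D f : R[i] :=
  (\int[leb]_(t in D) Re (f t)) +i* (\int[leb]_(t in D) Im (f t)).

Definition intgC D f :=
  leb.-integrable D (EFin \o (fun t => Re (f t))) /\
  leb.-integrable D (EFin \o (fun t => Im (f t))).

Lemma eq_intC D f g : (forall t, D t -> f t = g t) -> intC D f = intC D g.
Proof.
move=> fg; congr (_ +i* _); apply: eq_Rintegral => t; rewrite inE => Dt.
  by rewrite fg.
by rewrite fg.
Qed.

Lemma eq_intgC D f g : measurable D -> (forall t, D t -> f t = g t) ->
  intgC D f -> intgC D g.
Proof.
move=> mD fg [i1 i2]; split; [apply: eq_integrable i1|apply: eq_integrable i2] => //;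
  by move=> t; rewrite inE => Dt /=; rewrite fg.
Qed.

Lemma contC_intgC f (a b : R) : contC f -> intgC `[a, b] f.
Proof.
move=> [c1 c2]; split; apply: continuous_compact_integrable;
  by [exact: segment_compact|exact: continuous_subspaceT].
Qed.

Lemma intgC_dom D f (g : R -> R) : measurable D -> contC f ->
  leb.-integrable D (EFin \o g) -> (forall t, D t -> N (f t) <= g t) ->
  intgC D f.
Proof.
move=> mD [c1 c2] ig fg; split; apply: le_integrable ig => //.
- apply/measurable_EFinP; apply: measurable_funTS; exact: continuous_measurable_fun.
- move=> t Dt /=; rewrite lee_fin (le_trans (normc_Re _))// (le_trans _ (ler_norm _))//.
  exact: fg.
- apply/measurable_EFinP; apply: measurable_funTS; exact: continuous_measurable_fun.
- move=> t Dt /=; rewrite lee_fin (le_trans (normc_Im _))// (le_trans _ (ler_norm _))//.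
  exact: fg.
Qed.

Lemma intgCD D f g : measurable D -> intgC D f -> intgC D g ->
  intgC D (fun t => f t + g t).
Proof.
move=> mD [f1 f2] [g1 g2]; split.
  have := @integrableD _ _ _ leb D mD _ _ f1 g1; apply: eq_integrable => // t _ /=.
  by rewrite ReD EFinD.
have := @integrableD _ _ _ leb D mD _ _ f2 g2; apply: eq_integrable => // t _ /=.
by rewrite ImD EFinD.
Qed.

Lemma intCD D f g : measurable D -> intgC D f -> intgC D g ->
  intC D (fun t => f t + g t) = intC D f + intC D g.
Proof.
move=> mD [f1 f2] [g1 g2]; apply: complex_eq; rewrite ?ReD ?ImD /=.
  by rewrite -RintegralD//; apply: eq_Rintegral => t _; rewrite ReD.
by rewrite -RintegralD//; apply: eq_Rintegral => t _; rewrite ImD.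
Qed.

Lemma intgCZ D f z : measurable D -> intgC D f -> intgC D (fun t => z * f t).
Proof.
move=> mD [f1 f2]; split.
  have := @integrableB _ _ _ leb D mD _ _ (@integrableZl _ _ _ leb D mD (Re z) _ f1)
    (@integrableZl _ _ _ leb D mD (Im z) _ f2).
  by apply: eq_integrable => // t _ /=; rewrite ReM.
have := @integrableD _ _ _ leb D mD _ _ (@integrableZl _ _ _ leb D mD (Re z) _ f2)
  (@integrableZl _ _ _ leb D mD (Im z) _ f1).
by apply: eq_integrable => // t _ /=; rewrite ImM.
Qed.

Lemma intCZ D f z : measurable D -> intgC D f ->
  intC D (fun t => z * f t) = z * intC D f.
Proof.
move=> mD [f1 f2].
have i1 (r : R) : leb.-integrable D (EFin \o (fun t => r * Re (f t))).
  exact: (@integrableZl _ _ _ leb D mD r _ f1).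
have i2 (r : R) : leb.-integrable D (EFin \o (fun t => r * Im (f t))).
  exact: (@integrableZl _ _ _ leb D mD r _ f2).
apply: complex_eq; rewrite ?ReM ?ImM /=.
  rewrite -!RintegralZl// -RintegralB//.
  by apply: eq_Rintegral => t _; rewrite ReM.
rewrite -!RintegralZl// -RintegralD//.
by apply: eq_Rintegral => t _; rewrite ImM.
Qed.

Lemma intCB D f g : measurable D -> intgC D f -> intgC D g ->
  intC D (fun t => f t - g t) = intC D f - intC D g.
Proof.
move=> mD hf hg; rewrite -mulN1r -intCZ// -intCD//; last exact: intgCZ.
by apply: eq_intC => t _; rewrite mulN1r.
Qed.

Lemma intgC0 D : measurable D -> intgC D (fun=> 0).
Proof. by move=> mD; split; exact: integrable0. Qed.

Lemma intC0 D : measurable D -> intC D (fun=> 0) = 0.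
Proof. by move=> mD; rewrite /intC !Rintegral_cst// mul0r. Qed.

Lemma intgC_sum D (I : Type) (r : seq I) (F : I -> R -> R[i]) : measurable D ->
  (forall i, intgC D (F i)) -> intgC D (fun t => \sum_(i <- r) F i t).
Proof.
move=> mD iF; elim: r => [|i r ih].
  by apply: eq_intgC (intgC0 mD) => // t _; rewrite big_nil.
by apply: eq_intgC (intgCD mD (iF i) ih) => // t _; rewrite big_cons.
Qed.

Lemma intC_sum D (I : Type) (r : seq I) (F : I -> R -> R[i]) : measurable D ->
  (forall i, intgC D (F i)) ->
  intC D (fun t => \sum_(i <- r) F i t) = \sum_(i <- r) intC D (F i).
Proof.
move=> mD iF; elim: r => [|i r ih].
  by rewrite [RHS]big_nil -[RHS](intC0 mD); apply: eq_intC => t _; rewrite big_nil.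
rewrite big_cons -ih -intCD//; last exact: intgC_sum.
by apply: eq_intC => t _; rewrite big_cons.
Qed.

(** Each component is at most the integral of g; summing the two costs a factor 2, which only
    affects constants. *)
Lemma normc_intC D f (g : R -> R) : measurable D -> intgC D f ->
  leb.-integrable D (EFin \o g) -> (forall t, D t -> N (f t) <= g t) ->
  N (intC D f) <= 2 * \int[leb]_(t in D) g t.
Proof.
move=> mD [f1 f2] ig fg; rewrite (le_trans (normc_leReIm _))//= mulr_natl mulr2n.
apply: lerD; rewrite (le_trans (@le_normr_Rintegral _ _ _ leb D _ mD _))//;
  apply: le_Rintegral => //; try exact: integrable_norm.
  by move=> t Dt; rewrite (le_trans (normc_Re _))// fg.
by move=> t Dt; rewrite (le_trans (normc_Im _))// fg.
Qed.

Lemma normc_intC_cst f (a b M : R) : a <= b -> intgC `[a, b] f ->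
  (forall t, a <= t <= b -> N (f t) <= M) ->
  N (intC `[a, b] f) <= 2 * M * (b - a).
Proof.
move=> ab fi fM.
have iM : leb.-integrable `[a, b] (EFin \o (cst M : R -> R)).
  apply: continuous_compact_integrable; first exact: segment_compact.
  by apply: continuous_subspaceT => t; exact: cst_continuous.
have fM' t : `[a, b]%classic t -> N (f t) <= cst M t.
  by move=> /=; rewrite in_itv /= => /fM.
apply: (le_trans (@normc_intC _ f (cst M) _ fi iM fM')) => //.
rewrite Rintegral_cst//= lebesgue_measure_itv /= lte_fin.
case: ifPn => [|]; first by rewrite -EFinB /= mulrA.
rewrite -leNgt => ba; have -> : a = b by apply: le_anti; rewrite ab ba.
by rewrite subrr !mulr0.
Qed.

Lemma intC_FTC f f' (a b : R) : a < b -> derC f f' -> contC f' ->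
  intC `[a, b] f' = f b - f a.
Proof.
move=> ab df [c1 c2]; have [cf1 cf2] := derC_cont df.
have aux (h h' : R -> R) : continuous h -> continuous h' ->
  (forall t : R, is_derive t 1 h (h' t)) -> \int[leb]_(t in `[a, b]) h' t = h b - h a.
  move=> ch ch' dh; rewrite /Rintegral (@continuous_FTC2 _ h' h a b)//=.
  - exact: continuous_subspaceT.
  - split=> [t _||]; first by case: (dh t).
      apply: cvg_at_right_filter; exact: ch.
    apply: cvg_at_left_filter; exact: ch.
  - by move=> t _; rewrite derive1E; case: (dh t).
apply: complex_eq; rewrite ?ReD ?ImD ?ReN ?ImN /=.
  exact: (aux _ _ cf1 c1 (fun t => (df t).1)).
exact: (aux _ _ cf2 c2 (fun t => (df t).2)).
Qed.

End IntegralComplex.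

(** * Entire functions and contour shifts *)

Section Entire.
Context {R : realType}.
Implicit Types (f g : R[i] -> R[i]).

Lemma expr_fact_small (x e : R) : 0 < e -> exists n, `|x ^+ n / n`!%:R| <= e.
Proof.
move=> e0; have := cvg_series_cvg_0 (is_cvg_series_exp_coeff x).
move/cvgrPdist_le => /(_ e e0)[n _ /(_ n (leqnn n))] h; exists n.
by move: h; rewrite sub0r normrN.
Qed.

(* A substitute for holomorphy that is stable under the operations needed here:
   Cauchy's theorem on a rectangle reduces, by uniform approximation, to
   polynomials, which have explicit primitives. *)
Definition entire f :=
  [/\ forall eta, contC (fun t : R => f (t +i* eta)),
      forall B e : R, 0 < e -> exists p : {poly R[i]},
        forall z, N z <= B -> N (f z - p.[z]) <= e &
      forall n (B : R), exists p : {poly R[i]}, exists2 C : R, 0 <= C &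
        forall z, N z <= B -> N (f z - p.[z]) <= C * N z ^+ n].

Lemma entire_eq f g : f =1 g -> entire f -> entire g.
Proof. by move=> /funext ->. Qed.

Lemma contC_horizontal (eta : R) : contC (fun t => t +i* eta).
Proof.
by split => [t|t]; [exact: id|exact: cst_continuous].
Qed.

Lemma entire_horner (p : {poly R[i]}) : entire (fun z => p.[z]).
Proof.
split=> [eta|B e e0|n B].
- by apply: contC_horner; exact: contC_horizontal.
- by exists p => z _; rewrite subrr normc0 ltW.
- by exists p, 0 => // z _; rewrite subrr normc0 mul0r.
Qed.

Lemma entire_cst c : entire (fun=> c).
Proof. by apply: entire_eq (entire_horner c%:P) => z; rewrite hornerC. Qed.

(** At order 0 the last clause of [entire] says that f differs from a polynomial by a bounded
    function on the disc. *)
Lemma entire_bounded f (B : R) : entire f ->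
  exists2 M, 0 <= M & forall z, N z <= B -> N (f z) <= M.
Proof.
case=> _ _ /(_ 0%N B)[p [C C0 h]]; have [M M0 hM] := normc_bounded p B.
exists (C + M); first exact: addr_ge0.
move=> z zB; rewrite -[f z](subrK p.[z]) (le_trans (normcD _ _))//.
by apply: lerD; [rewrite (le_trans (h z zB))// expr0 mulr1|exact: hM].
Qed.

Lemma entireD f g : entire f -> entire g -> entire (fun z => f z + g z).
Proof.
move=> [cf af tf] [cg ag tg]; split=> [eta|B e e0|n B].
- exact: contCD.
- have e20 : 0 < e / 2 by rewrite divr_gt0.
  have [[p hp] [q hq]] := (af B _ e20, ag B _ e20).
  exists (p + q) => z zB; rewrite hornerD opprD addrACA (le_trans (normcD _ _))//.
  by rewrite (splitr e) lerD// ?hp ?hq.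
- have [[p [C C0 hp]] [q [D D0 hq]]] := (tf n B, tg n B).
  exists (p + q), (C + D); first exact: addr_ge0.
  move=> z zB; rewrite hornerD opprD addrACA (le_trans (normcD _ _))//.
  by rewrite mulrDl lerD// ?hp ?hq.
Qed.

Lemma normc_mulB (a b c d : R[i]) :
  N (a * b - c * d) <= N a * N (b - d) + N (a - c) * N d.
Proof.
have -> : a * b - c * d = a * (b - d) + (a - c) * d by ring.
by rewrite (le_trans (normcD _ _))// !normcM.
Qed.

Lemma entireM f g : entire f -> entire g -> entire (fun z => f z * g z).
Proof.
move=> hf hg; have [[cf af tf] [cg ag tg]] := (hf, hg).
split=> [eta|B e e0|n B].
- exact: contCM.
- have [Mf Mf0 bf] := entire_bounded B hf.
  have [Mg Mg0 bg] := entire_bounded B hg.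
  (* The cap 1 bounds q by Mg + 1 on the disc, so that the tolerance for p can be fixed
     independently of q. *)
  pose e2 := Num.min 1 (e / (2 * (Mf + 1))).
  have e20 : 0 < e2 by rewrite lt_min ltr01 divr_gt0// mulr_gt0// ltr_wpDl.
  have e10 : 0 < e / (2 * (Mg + 1)) by rewrite divr_gt0// mulr_gt0// ltr_wpDl.
  have [[p hp] [q hq]] := (af B _ e10, ag B _ e20).
  exists (p * q) => z zB; rewrite hornerM (le_trans (normc_mulB _ _ _ _))//.
  have hqz := hq z zB.
  have q1 : N q.[z] <= Mg + 1.
    have -> : q.[z] = g z - (g z - q.[z]) by ring.
    rewrite (le_trans (ler_normcB _ _))// lerD ?bg//.
    by rewrite (le_trans hqz)// ge_min lexx.
  have q2 : N (g z - q.[z]) <= e / (2 * (Mf + 1)).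
    by rewrite (le_trans hqz)// ge_min lexx orbT.
  have h1 : N (f z) * N (g z - q.[z]) <= e / 2.
    rewrite (@le_trans _ _ ((Mf + 1) * (e / (2 * (Mf + 1)))))//.
      apply: ler_pM; rewrite ?normc_ge0// (le_trans (bf z zB))//.
      by rewrite lerDl.
    rewrite le_eqVlt; apply/orP; left; apply/eqP; field.
    by rewrite gt_eqF// ltr_wpDl.
  have h2 : N (f z - p.[z]) * N q.[z] <= e / 2.
    rewrite (@le_trans _ _ (e / (2 * (Mg + 1)) * (Mg + 1)))//.
      by apply: ler_pM; rewrite ?normc_ge0// hp.
    rewrite le_eqVlt; apply/orP; left; apply/eqP; field.
    by rewrite gt_eqF// ltr_wpDl.
  by rewrite (splitr e) lerD.
- have [Mf Mf0 bf] := entire_bounded B hf.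
  have [[p [C C0 hp]] [q [D D0 hq]]] := (tf n B, tg n B).
  have [Mq Mq0 bq] := normc_bounded q B.
  exists (p * q), (Mf * D + C * Mq); first by rewrite addr_ge0 ?mulr_ge0.
  move=> z zB; rewrite hornerM (le_trans (normc_mulB _ _ _ _))//.
  rewrite mulrDl -(mulrA Mf) (mulrAC C); apply: lerD; apply: ler_pM; rewrite
    ?normc_ge0//.
  + exact: bf.
  + exact: hq.
  + exact: hp.
  + exact: bq.
Qed.

Lemma entireB f g : entire f -> entire g -> entire (fun z => f z - g z).
Proof.
move=> hf hg; apply: (@entire_eq (fun z => f z + (-1) * g z)).
  by move=> z; rewrite mulN1r.
by apply: entireD => //; apply: entireM => //; exact: entire_cst.
Qed.

Lemma entireX f n : entire f -> entire (fun z => f z ^+ n).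
Proof.
move=> hf; elim: n => [|n ih]; first exact: entire_cst.
apply: (@entire_eq (fun z => f z * f z ^+ n)); last exact: entireM.
by move=> z; rewrite exprS.
Qed.

Lemma entire_sum (I : Type) (r : seq I) (F : I -> R[i] -> R[i]) :
  (forall i, entire (F i)) -> entire (fun z => \sum_(i <- r) F i z).
Proof.
move=> hF; elim: r => [|i r ih].
  by apply: entire_eq (entire_cst 0) => z; rewrite big_nil.
by apply: entire_eq (entireD (hF i) ih) => z; rewrite big_cons.
Qed.

(** A real factor maps horizontal lines to horizontal lines, as the continuity clause of [entire]
    demands. *)
Lemma entire_scale f (h : R) : entire f -> entire (fun z => f (h%:C * z)).
Proof.
move=> [cf af tf].
have Nh z B : N z <= B -> N (h%:C * z) <= `|h| * B.
  by move=> zB; rewrite normcM normc_real ler_wpM2l.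
split=> [eta|B e e0|n B].
- have [c1 c2] := cf (h * eta).
  have e1 t : h%:C * (t +i* eta) = (h * t) +i* (h * eta).
    by apply: complex_eq; rewrite ?ReM ?ImM /=; ring.
  have ch : continuous (fun t : R => h * t).
    move=> t; apply: (@continuousM _ _ (fun=> h) id); first exact: cst_continuous.
    exact: id.
  split=> t.
    rewrite (_ : (fun t => Re (f (h%:C * (t +i* eta)))) =
      (fun t => Re (f (t +i* (h * eta)))) \o (fun t => h * t)).
      by apply: continuous_comp; [exact: ch|exact: c1].
    by apply/funext => u; rewrite /= e1.
  rewrite (_ : (fun t => Im (f (h%:C * (t +i* eta)))) =
    (fun t => Im (f (t +i* (h * eta)))) \o (fun t => h * t)).
    by apply: continuous_comp; [exact: ch|exact: c2].
  by apply/funext => u; rewrite /= e1.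
- have [p hp] := af (`|h| * B) e e0.
  exists (p \Po (h%:C *: 'X)) => z zB.
  rewrite horner_comp hornerZ hornerX; apply: hp; exact: Nh.
- have [p [C C0 hp]] := tf n (`|h| * B).
  exists (p \Po (h%:C *: 'X)), (C * `|h| ^+ n).
    by rewrite mulr_ge0// exprn_ge0.
  move=> z zB; rewrite horner_comp hornerZ hornerX.
  by rewrite (le_trans (hp _ (Nh _ _ zB)))// normcM normc_real exprMn mulrA.
Qed.

(** The truncated exponential series in c z^(m+1) serves both approximation clauses: on a disc its
    remainder tends to 0, and after n terms it is of order at least n in z because the inner
    exponent is positive. *)
Lemma entire_exp (c : R[i]) m : entire (fun z => expC (c * z ^+ m.+1)).
Proof.
pose T n : {poly R[i]} := expC_taylor n \Po (c *: 'X^(m.+1)).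
have TE n z : (T n).[z] = (expC_taylor n).[c * z ^+ m.+1].
  by rewrite horner_comp hornerZ hornerXn.
have hT n z : N (expC (c * z ^+ m.+1) - (T n).[z]) <=
    expR (N c * N z ^+ m.+1) * (2 * (N c * N z ^+ m.+1)) ^+ n / n`!%:R.
  rewrite TE; have := @expC_taylorP R (c * z ^+ m.+1) n 1.
  by rewrite ler01 lexx rmorph1 mul1r normcM normcX expr1n mulr1 => /(_ isT).
have mono B z : N z <= B -> N c * N z ^+ m.+1 <= N c * `|B| ^+ m.+1.
  move=> zB; rewrite ler_wpM2l ?normc_ge0// lerXn2r ?nnegrE ?normc_ge0//.
  by rewrite (le_trans zB)// ler_norm.
split=> [eta|B e e0|n B].
- apply: contC_exp; apply: contCM; first exact: contC_cst.
  by apply: contCX; exact: contC_horizontal.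
- set W := N c * `|B| ^+ m.+1.
  have W0 : 0 <= W by rewrite mulr_ge0 ?normc_ge0// exprn_ge0.
  have [n hn] := @expr_fact_small (2 * W) (e / expR W) (divr_gt0 e0 (expR_gt0 _)).
  exists (T n) => z zB; rewrite (le_trans (hT _ _))//.
  have zW := mono _ _ zB.
  have z0 : 0 <= N c * N z ^+ m.+1 by rewrite mulr_ge0 ?exprn_ge0 ?normc_ge0.
  rewrite (@le_trans _ _ (expR W * ((2 * W) ^+ n / n`!%:R)))//.
    rewrite -mulrA; apply: ler_pM; rewrite ?expR_ge0// ?ler_expR//.
      by rewrite divr_ge0// exprn_ge0// mulr_ge0.
    rewrite ler_pM2r ?invr_gt0 ?ltr0n ?fact_gt0//.
    apply: lerXn2r; rewrite ?nnegrE; [exact: mulr_ge0|exact: mulr_ge0|].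
    exact: ler_wpM2l.
  rewrite -ler_pdivlMl ?expR_gt0// [leRHS]mulrC.
  exact: (le_trans (ler_norm _) hn).
- set W := N c * `|B| ^+ m.+1.
  have W0 : 0 <= W by rewrite mulr_ge0 ?normc_ge0// exprn_ge0.
  (* Of the m + 1 powers of |z| in each factor one is kept and m are bounded through B. *)
  exists (T n), (expR W * (2 * (N c * `|B| ^+ m)) ^+ n / n`!%:R).
    by rewrite divr_ge0// mulr_ge0 ?expR_ge0// exprn_ge0// !mulr_ge0 ?normc_ge0//
      exprn_ge0.
  move=> z zB; rewrite (le_trans (hT _ _))//.
  have zW := mono _ _ zB.
  rewrite [leRHS]mulrAC ler_pM2r ?invr_gt0 ?ltr0n ?fact_gt0// -[leRHS]mulrA.
  apply: ler_pM; rewrite ?expR_ge0// ?ler_expR//.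
    by rewrite exprn_ge0// !mulr_ge0 ?exprn_ge0 ?normc_ge0.
  rewrite -exprMn lerXn2r ?nnegrE ?mulr_ge0 ?exprn_ge0 ?normc_ge0//.
  rewrite exprSr !mulrA ler_wpM2r ?normc_ge0// ler_wpM2l ?mulr_ge0 ?normc_ge0//.
  rewrite lerXn2r ?nnegrE ?normc_ge0//.
  by rewrite (le_trans zB)// ler_norm.
Qed.

Lemma poly_primitive (p : {poly R[i]}) : exists q, q^`() = p.
Proof.
exists (\poly_(i < (size p).+1) (p`_i.-1 / i%:R)).
apply/polyP => i; rewrite coef_deriv coef_poly ltnS.
case: ifPn => [_|]; last by rewrite -leqNgt mul0rn => /leq_sizeP ->.
by rewrite -[LHS]mulr_natr mulfVK// pnatr_eq0.
Qed.

Lemma derC_horizontal (eta : R) : derC (fun t => t +i* eta) (fun=> 1).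
Proof. by move=> t; split; [exact: is_derive_id|exact: is_derive_cst]. Qed.

Lemma derC_vertical (x eta : R) :
  derC (fun s => x +i* (s * eta)) (fun=> 'i * eta%:C).
Proof.
apply: derC_eq (derCD (derC_cst x%:C) (derCM derC_id (derC_cst ('i * eta%:C)))).
  by move=> s; apply: complex_eq; rewrite ?ReD ?ImD ?ReM ?ImM /=; ring.
by move=> s /=; ring.
Qed.

(* Cauchy's theorem on the rectangle of vertices -A, A, A + i eta, -A + i eta; M
   bounds the contribution of the vertical sides. *)
Lemma contour_shift f (A eta M : R) : entire f -> 0 < A ->
  (forall s : R, 0 <= s <= 1 ->
    N (f (A +i* (s * eta))) <= M /\ N (f ((- A) +i* (s * eta))) <= M) ->
  N (intC `[- A, A] (fun t => f t%:C) - intC `[- A, A] (fun t => f (t +i* eta)))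
    <= 4 * M * `|eta|.
Proof.
move=> hf A0 hM; have [cf af _] := hf.
have AA : - A < A by rewrite (lt_trans _ A0)// oppr_lt0.
apply/ler_addgt0Pr => e e0.
(* Replacing f by p costs 4 A e1 on each horizontal side and 2 |eta| e1 on each vertical side. *)
pose e1 := e / (4 * `|eta| + 8 * A + 1).
have d0 : 0 < 4 * `|eta| + 8 * A + 1.
  by rewrite ltr_wpDl// addr_ge0// mulr_ge0// ltW.
have e10 : 0 < e1 by rewrite divr_gt0.
have [p hp] := af (A + `|eta|) e1 e10.
have [q dq] := poly_primitive p.
have inR (x y : R) : `|x| <= A -> `|y| <= `|eta| -> N (x +i* y) <= A + `|eta|.
  by move=> xA yA; rewrite (le_trans (normc_leReIm _))//= lerD.
have cp c : contC (fun t => p.[t +i* c]).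
  by apply: contC_horner; exact: contC_horizontal.
have hor c : `|c| <= `|eta| ->
    N (intC `[- A, A] (fun t => f (t +i* c)) - (q.[A +i* c] - q.[(- A) +i* c]))
      <= 4 * A * e1.
  move=> cA; rewrite -(@intC_FTC _ (fun t => q.[t +i* c]) (fun t => p.[t +i* c]))//.
    rewrite -intCB//; try exact: contC_intgC.
    rewrite (le_trans (@normc_intC_cst _ _ _ _ e1 (ltW AA) _ _))//.
    - by apply: contC_intgC; exact: contCB.
    - by move=> t tA; apply/hp/inR => //; rewrite ler_norml.
    - by rewrite le_eqVlt; apply/orP; left; apply/eqP; ring.
  apply: derC_eq (derC_horner q (derC_horizontal c)) => // t.
  by rewrite dq mul1r.
have ver (x : R) : `|x| = A ->
    (forall s : R, 0 <= s <= 1 -> N (f (x +i* (s * eta))) <= M) ->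
    N (q.[x +i* eta] - q.[x%:C]) <= 2 * (`|eta| * (M + e1)).
  move=> xA fM.
  have := @derC_lip _ _ _ 0 1 (`|eta| * (M + e1)) (derC_horner q (derC_vertical x
    eta)) ler01.
  rewrite mul0r mul1r subr0 mulr1; apply => s /andP[s0 s1].
  rewrite dq !normcM normc_i mul1r normc_real ler_wpM2l//.
  set w := x +i* _; have -> : p.[w] = f w - (f w - p.[w]) by ring.
  rewrite (le_trans (ler_normcB _ _))// lerD// ?fM ?s0//.
  by apply/hp/inR; rewrite ?xA// normrM ger0_norm// ler_piMl.
have h0 := hor 0 _; rewrite normr0 in h0; have {}h0 := h0 (normr_ge0 _).
have h1 := hor eta (lexx _).
have v1 := ver A (gtr0_norm A0) (fun s hs => (hM s hs).1).
have v2 := ver (- A) _ (fun s hs => (hM s hs).2).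
rewrite normrN gtr0_norm// in v2; have {}v2 := v2 erefl.
move: h0 h1 v1 v2.
set I0 := intC _ _; set I1 := intC _ _.
rewrite -/(A%:C) -/((- A)%:C).
set a := q.[A%:C]; set b := q.[(- A)%:C].
set c := q.[A +i* eta]; set d := q.[_ +i* eta] => h0 h1 v1 v2.
(* The corner values of the primitive cancel; what remains are two approximation errors and the
   increments along the vertical sides. *)
have -> : I0 - I1 = (I0 - (a - b)) - (I1 - (c - d)) - (c - a) + (d - b) by ring.
apply: (@le_trans _ _ (4 * A * e1 + 4 * A * e1 + 2 * (`|eta| * (M + e1)) + 2 *
  (`|eta| * (M + e1)))).
  rewrite (le_trans (normcD _ _))// lerD// (le_trans (ler_normcB _ _))// lerD//.
  by rewrite (le_trans (ler_normcB _ _))// lerD.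
have -> : 4 * A * e1 + 4 * A * e1 + 2 * (`|eta| * (M + e1)) + 2 * (`|eta| * (M + e1))
  = 4 * M * `|eta| + e1 * (4 * `|eta| + 8 * A) by ring.
rewrite lerD2l /e1 mulrAC ler_pdivrMr// ler_wpM2l ?(ltW e0)//.
by rewrite lerDl.
Qed.

End Entire.

(** * Gaussian integrals *)

Section GaussianContour.
Context {R : realType}.
Implicit Types (beta : R[i]) (mu : nat).

Lemma evenX_ge0 (u : R) mu : 0 <= u ^+ (2 * mu).
Proof. by rewrite exprM exprn_ge0// sqr_ge0. Qed.

Lemma normX_even (u : R) mu : `|u| ^+ (2 * mu) = u ^+ (2 * mu).
Proof. by rewrite -normrX ger0_norm// evenX_ge0. Qed.

Lemma ler_1DX (x : R) n : 0 <= x -> (0 < n)%N -> x <= 1 + x ^+ n.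
Proof.
move=> x0 n0; have [x1|x1] := leP x 1.
  by rewrite (le_trans x1)// lerDl exprn_ge0.
by rewrite (@le_trans _ _ (x ^+ n)) ?lerDr// ler_eXnr// ltW.
Qed.

(** Since c u^2 <= c + c u^(2 mu), the integrand is at most e^c times exp(-c u^2), a multiple of the
    normal density with 2 s^2 = 1/c. *)
Lemma gauss_integrable (c : R) mu : 0 < c -> (0 < mu)%N ->
  leb.-integrable setT (EFin \o (fun u : R => expR (- c * u ^+ (2 * mu)))).
Proof.
move=> c0 mu0; pose s := Num.sqrt (c *+ 2)^-1.
have s2 : s ^+ 2 *+ 2 = c^-1.
  rewrite sqr_sqrtr ?invr_ge0 ?mulrn_wge0 ?ltW//.
  by field; rewrite gt_eqF.
have s0 : s != 0.
  by rewrite gt_eqF// sqrtr_gt0 invr_gt0 mulrn_wgt0.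
have cf : continuous (fun u : R => expR (- c * u ^+ (2 * mu))).
  move=> u; apply: (@continuous_comp _ _ _ (fun u : R => - c * u ^+ (2 * mu) : R) expR).
    apply: (@continuousM _ R (fun=> - c) (fun u : R => u ^+ (2 * mu))).
      exact: cst_continuous.
    exact: exprn_continuous.
  exact: continuous_expR.
have ip := @integrableZl _ _ _ leb setT measurableT
  (expR c / normal_peak s) _ (integrable_normal_pdf 0 s).
apply: le_integrable ip => //.
  by apply/measurable_EFinP; exact: continuous_measurable_fun.
move=> u _ /=; rewrite lee_fin ger0_norm ?expR_ge0//.
rewrite (le_trans _ (ler_norm _))//.
have -> : expR c / normal_peak s * normal_pdf 0 s u = expR c * normal_fun 0 s u.
  by rewrite normal_pdfE//= mulrA divfK// gt_eqF// normal_peak_gt0.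
rewrite /normal_fun s2 invrK subr0 -expRD ler_expR.
have := ler_1DX (sqr_ge0 u) mu0; rewrite -exprM => /(ler_wpM2l (ltW c0)).
lra.
Qed.

(** Near the real axis the power is a small perturbation of u^(2 mu) and Re beta > 0 decides;
    elsewhere |u| is controlled by |eta| and the crude bound through |beta| suffices. *)
Lemma Re_pow_lower beta mu : (0 < mu)%N -> 0 < Re beta ->
  exists c0 C0 : R, [/\ 0 < c0, 0 <= C0 & forall u eta : R,
    c0 * u ^+ (2 * mu) - C0 * eta ^+ (2 * mu) <=
      Re (beta * (u +i* eta) ^+ (2 * mu))].
Proof.
move=> mu0 b0; set d := (2 * mu)%N; set b := Re beta; set Bn := N beta.
have d0 : (0 < d)%N by rewrite muln_gt0.
have bB : b <= Bn by rewrite (le_trans (ler_norm _))// normc_Re.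
have Bn0 : 0 < Bn by rewrite (lt_le_trans b0).
(* If |eta| <= tau |u|, the perturbation |beta| |eta| d (2|u|)^(d-1) is at most (b/2) |u|^d. *)
pose tau := b / (d%:R * 2 ^+ d * Bn).
have dd0 : 0 < d%:R * 2 ^+ d :> R by rewrite mulr_gt0 ?ltr0n ?exprn_gt0.
have tau0 : 0 < tau by rewrite divr_gt0// mulr_gt0.
have tau1 : tau <= 1.
  rewrite ler_pdivrMr; last exact: mulr_gt0.
  rewrite mul1r (le_trans bB)// ler_peMl ?(ltW Bn0)//.
  rewrite (@le_trans _ _ d%:R) ?ler1n// ler_peMr ?exprn_ege1 ?ler1n//.
have Re_lower (z : R[i]) : - N z <= Re z.
  by have := normc_Re z; rewrite ler_norml => /andP[].
have tV0 : 0 <= tau^-1 by rewrite invr_ge0 ltW.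
have C00 : 0 <= b / 2 * tau^-1 ^+ d + Bn * (tau^-1 + 1) ^+ d.
  apply: addr_ge0; apply: mulr_ge0; rewrite ?(ltW Bn0)//.
  - by rewrite divr_ge0// ltW.
  - exact: exprn_ge0.
  - by apply: exprn_ge0; exact: addr_ge0.
(* Where |u| <= |eta| / tau, the first summand compensates (b/2) u^d and the second is the crude
   bound. *)
exists (b / 2), (b / 2 * tau^-1 ^+ d + Bn * (tau^-1 + 1) ^+ d); split => //.
  by rewrite divr_gt0.
move=> u eta; have u0 := evenX_ge0 u mu; have eta0 := evenX_ge0 eta mu.
have Nv : N (u +i* eta) <= `|u| + `|eta| by exact: normc_leReIm.
have [small|large] := leP `|eta| (tau * `|u|).
  have eu : `|eta| <= `|u| by rewrite (le_trans small)// ler_piMl.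
  have diff : N ((u +i* eta) ^+ d - u%:C ^+ d) <= `|eta| * (d%:R * (2 * `|u|) ^+ d.-1).
    rewrite subrXX normcM.
    have -> : (u +i* eta) - u%:C = 'i * eta%:C.
      by apply: complex_eq; rewrite ?ReD ?ImD ?ReN ?ImN ?ReM ?ImM /=; ring.
    rewrite normcM normc_i mul1r normc_real ler_wpM2l//.
    rewrite (le_trans (normc_sum _ _ _))//.
    have -> : d%:R * (2 * `|u|) ^+ d.-1 = \sum_(i < d) (2 * `|u|) ^+ d.-1.
      by rewrite sumr_const card_ord mulr_natl.
    apply: ler_sum => i _.
    rewrite normcM !normcX normc_real.
    have -> : d.-1 = (d.-1 - i + i)%N by rewrite subnK// -ltnS prednK// ltn_ord.
    rewrite exprD addnK; apply: ler_pM; rewrite ?exprn_ge0 ?normc_ge0//.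
      rewrite lerXn2r ?nnegrE ?normc_ge0 ?mulr_ge0// (le_trans Nv)//.
      by rewrite mulr_natl mulr2n lerD2l.
    by rewrite lerXn2r ?nnegrE ?mulr_ge0// ler_peMl// ler1n.
  have e1 : Re (beta * (u +i* eta) ^+ d) =
      b * u ^+ d + Re (beta * ((u +i* eta) ^+ d - u%:C ^+ d)).
    rewrite mulrBr ReD ReN addrC -rmorphXn /= (ReM beta (_%:C)) /= mulr0 subr0.
    by rewrite -/b subrK.
  have e2 : N (beta * ((u +i* eta) ^+ d - u%:C ^+ d)) <= b / 2 * u ^+ d.
    rewrite normcM -/Bn.
    rewrite (@le_trans _ _ (Bn * (tau * `|u| * (d%:R * (2 * `|u|) ^+ d.-1))))//.
      rewrite ler_pM2l// (le_trans diff)// ler_wpM2r// mulr_ge0// exprn_ge0//.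
    rewrite le_eqVlt; apply/orP; left; apply/eqP.
    rewrite -(normX_even u) -/d -(prednK d0) /= !exprS exprMn /tau.
    rewrite -[in 2 ^+ d](prednK d0) exprS prednK//.
    field; rewrite (gt_eqF Bn0) expf_neq0 ?pnatr_eq0//=.
    by rewrite -lt0n.
  rewrite e1 (@le_trans _ _ (b * u ^+ d - b / 2 * u ^+ d))//.
    have -> : b * u ^+ d - b / 2 * u ^+ d = b / 2 * u ^+ d by field.
    by rewrite gerBl; exact: mulr_ge0.
  by rewrite lerD2l (le_trans _ (Re_lower _))// lerN2.
have uE : `|u| <= tau^-1 * `|eta|.
  by rewrite -ler_pdivrMl ?invr_gt0// invrK ltW.
apply: (@le_trans _ _ (- (Bn * (tau^-1 + 1) ^+ d * eta ^+ d))).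
  rewrite mulrDl opprD addrA gerDr subr_le0 -(mulrA (b / 2)) ler_pM2l ?divr_gt0//.
  rewrite -(normX_even u) -(normX_even eta) -/d -exprMn lerXn2r ?nnegrE ?mulr_ge0
    ?invr_ge0//.
  exact: ltW.
rewrite (le_trans _ (Re_lower _))// lerN2 normcM normcX -/Bn -(mulrA Bn) ler_pM2l//.
rewrite -(normX_even eta) -exprMn lerXn2r ?nnegrE ?normc_ge0//.
  by rewrite mulr_ge0// addr_ge0// invr_ge0 ltW.
by rewrite (le_trans Nv)// mulrDl mul1r lerD2r.
Qed.

Lemma ler_normcX_even (u eta : R) mu :
  N (u +i* eta) ^+ (2 * mu) <= 2 ^+ (2 * mu) * (u ^+ (2 * mu) + eta ^+ (2 * mu)).
Proof.
have Nv : N (u +i* eta) <= `|u| + `|eta| by exact: normc_leReIm.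
rewrite -(normX_even u) -(normX_even eta).
apply: (@le_trans _ _ ((2 * Num.max `|u| `|eta|) ^+ (2 * mu))).
  rewrite lerXn2r ?nnegrE ?normc_ge0 ?mulr_ge0 ?le_max ?normr_ge0//.
  by rewrite (le_trans Nv)// mulr_natl mulr2n lerD// le_max lexx ?orbT.
rewrite exprMn ler_pM2l ?exprn_gt0//.
by case: (leP `|u| `|eta|) => _; rewrite ?(lerDl, lerDr) exprn_ge0.
Qed.

(** Half of the rate pays for the factor y, which will be the length of the vertical sides up to a
    constant. *)
Lemma mul_expRN_bound (k y : R) n : 0 < k -> 0 <= y -> (0 < n)%N ->
  y * expR (- k * y ^+ n) <= (1 + 2 / k) * expR (- (k / 2) * y ^+ n).
Proof.
move=> k0 y0 n0; have yn0 : 0 <= y ^+ n by exact: exprn_ge0.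
have -> : - k * y ^+ n = - (k / 2) * y ^+ n + - (k / 2) * y ^+ n by field.
rewrite expRD mulrA ler_wpM2r ?expR_ge0//.
rewrite mulNr expRN ler_pdivrMr ?expR_gt0//.
apply: (le_trans (ler_1DX y0 n0)).
have e1 : 1 + k / 2 * y ^+ n <= expR (k / 2 * y ^+ n).
  exact: expR_ge1Dx.
have k20 : 0 < k / 2 by rewrite divr_gt0.
apply: (@le_trans _ _ ((1 + 2 / k) * (1 + k / 2 * y ^+ n))); last first.
  by rewrite ler_wpM2l// addr_ge0// divr_ge0// ltW.
have -> : (1 + 2 / k) * (1 + k / 2 * y ^+ n) =
  1 + y ^+ n + (2 / k + k / 2 * y ^+ n) by field; rewrite gt_eqF.
by rewrite lerDl addr_ge0// ?divr_ge0 ?mulr_ge0// ltW.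
Qed.

Definition gauss_int (c : R) mu := \int[leb]_u expR (- c * u ^+ (2 * mu)).

Lemma gauss_int_ge0 c mu : 0 <= gauss_int c mu.
Proof. by apply: Rintegral_ge0 => u _; exact: expR_ge0. Qed.

Lemma gauss_int_segment (c A : R) mu : 0 < c -> (0 < mu)%N ->
  \int[leb]_(u in `[- A, A]) expR (- c * u ^+ (2 * mu)) <= gauss_int c mu.
Proof.
move=> c0 mu0; rewrite Rintegral_mkcond; apply: le_Rintegral => //.
- rewrite -restrict_EFin; apply/integrable_restrict => //; rewrite setTI.
  exact: integrableS (gauss_integrable c0 mu0).
- exact: gauss_integrable.
- by move=> u _; rewrite /patch; case: ifP => // _; exact: expR_ge0.
Qed.

End GaussianContour.

Section GaussianContourBound.
Context {R : realType}.
Implicit Types (beta : R[i]) (mu : nat) (X : R) (f : R[i] -> R[i]).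

(** The integrand of [Hgauss] at X, extended to complex v so that the contour can move. *)
Definition gkern X mu beta (v : R[i]) : R[i] :=
  expC ('i * X%:C * v) * expC (- beta * v ^+ (2 * mu)).

Lemma gkern_real X mu beta (u : R) :
  gkern X mu beta u%:C = expC ('i * (X * u)%:C) * expC (- beta * (u ^+ (2 * mu))%:C).
Proof. by rewrite /gkern -mulrA -rmorphM -rmorphXn. Qed.

Lemma entire_gkern X mu beta : (0 < mu)%N -> entire (gkern X mu beta).
Proof.
move=> mu0; apply: entireM.
  by apply: entire_eq (entire_exp ('i * X%:C) 0) => v; rewrite expr1.
apply: entire_eq (entire_exp (- beta) (2 * mu).-1) => v; rewrite prednK//.
by rewrite muln_gt0.
Qed.

Lemma normc_gkern X mu beta (v : R[i]) :
  N (gkern X mu beta v) = expR (- (X * Im v) - Re (beta * v ^+ (2 * mu))).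
Proof.
rewrite normcM !normc_expC -expRD; congr expR; congr (_ + _).
  by rewrite !ReM !ImM /=; ring.
by rewrite mulNr ReN.
Qed.

(* The line of integration is moved to height eta = +- e y, with the sign of X:
   the linear term -X eta of the exponent then wins over the loss O(eta^(2 mu)). *)
Lemma gauss_contour beta mu : (0 < mu)%N -> 0 < Re beta ->
  exists2 eps : R, 0 < eps & forall B : R, 0 < B -> exists c C : R,
    [/\ 0 < c, 0 <= C & forall (A y X D : R) f,
      0 < A -> 0 <= y -> `|X| = y ^+ (2 * mu).-1 -> y <= B * A -> 0 <= D ->
      entire f ->
      (forall u eta : R, `|u| <= A -> `|eta| <= A ->
        N (f (u +i* eta)) <= D * expR (eps * N (u +i* eta) ^+ (2 * mu))) ->
      N (intC `[- A, A] (fun u => gkern X mu beta u%:C * f u%:C)) <=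
        C * D * expR (- c * y ^+ (2 * mu))].
Proof.
move=> mu0 b0; have [c0 [C0 [c0_gt0 C0_ge0 hRe]]] := Re_pow_lower mu0 b0.
set d := (2 * mu)%N in hRe *.
have d0 : (0 < d)%N by rewrite muln_gt0.
have two_d : 0 < 2 ^+ d :> R by rewrite exprn_gt0.
(* Half of c0 pays for the growth of f: as |u + i eta|^d <= 2^d (u^d + eta^d), the rate c1 / 2^d is
   tolerable, and its share in eta goes into C1. *)
pose c1 := c0 / 2; pose C1 := C0 + c0 / 2.
have c1_gt0 : 0 < c1 by rewrite divr_gt0.
have C1_ge0 : 0 <= C1 by rewrite addr_ge0// ltW.
exists (c1 / 2 ^+ d); first by rewrite divr_gt0.
(* This choice gives e <= 1, then e B <= 1, which keeps the height e y below A, and C1 e <= 1/2,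
   which preserves half of the gain e y^d. *)
move=> B B0; pose e := (1 + B + 2 * C1)^-1.
have den_gt0 : 0 < 1 + B + 2 * C1 by rewrite ltr_wpDr ?mulr_ge0// addr_gt0.
have e0 : 0 < e by rewrite invr_gt0.
have eE : e * (1 + B + 2 * C1) = 1 by rewrite mulVf// gt_eqF.
have e1 : e <= 1.
  have : 0 <= e * B by rewrite mulr_ge0 ?(ltW e0) ?(ltW B0).
  have : 0 <= e * C1 by rewrite mulr_ge0 ?(ltW e0) ?(ltW B0).
  move: eE; lra.
have eB : e * B <= 1.
  have : 0 <= e * C1 by rewrite mulr_ge0 ?(ltW e0) ?(ltW B0).
  move: eE e0; lra.
have eC : C1 * e <= 1 / 2.
  have : 0 <= e * B by rewrite mulr_ge0 ?(ltW e0) ?(ltW B0).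
  move: eE e0; lra.
have e20 : 0 <= e / 2 by rewrite divr_ge0// ltW.
(* On the vertical sides exp(-c1 A^d) <= exp(-k y^d), because y <= B A. *)
pose k := c1 / B ^+ d.
have k0 : 0 < k by rewrite divr_gt0// exprn_gt0.
pose c := Num.min (e / 2) (k / 2).
exists c, (2 * gauss_int c1 mu + 4 * e * (1 + 2 / k)); split.
- by rewrite lt_min; apply/andP; split; exact: divr_gt0.
- rewrite addr_ge0//; first by rewrite mulr_ge0// gauss_int_ge0.
  by rewrite mulr_ge0 ?(mulr_ge0 _ (ltW e0))// addr_ge0// divr_ge0// ltW.
move=> A y X D f A0 y0 XE yA D0 hf fD.
have yd0 : 0 <= y ^+ d by exact: exprn_ge0.
pose sg : R := if 0 <= X then 1 else -1.
have sgX : X * sg = `|X|.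
  rewrite /sg; case: leP => hX; first by rewrite mulr1 ger0_norm.
  by rewrite mulrN1 ltr0_norm.
have sgn : `|sg| = 1 by rewrite /sg; case: ifP; rewrite ?normrN normr1.
pose eta := sg * (e * y).
have etaE : `|eta| = e * y by rewrite normrM sgn mul1r ger0_norm// mulr_ge0// ltW.
have eyA : e * y <= A.
  rewrite (@le_trans _ _ (e * (B * A)))//; first by rewrite ler_pM2l.
  by rewrite mulrA ler_piMl// ltW.
pose g v := gkern X mu beta v * f v.
have hg : entire g by apply: entireM => //; exact: entire_gkern.
have gE (u h : R) : `|u| <= A -> `|h| <= A ->
    N (g (u +i* h)) <= D * expR (- (X * h) + C1 * h ^+ d - c1 * u ^+ d).
  move=> uA hA; rewrite normcM normc_gkern /=.
  rewrite (@le_trans _ _ (expR (- (X * h) - Re (beta * (u +i* h) ^+ d)) *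
     (D * expR (c1 / 2 ^+ d * N (u +i* h) ^+ d))))//.
    by rewrite ler_pM2l ?expR_gt0// fD.
  rewrite mulrCA ler_wpM2l// -expRD ler_expR.
  have h1 := hRe u h.
  have h2 : c1 / 2 ^+ d * N (u +i* h) ^+ d <= c1 * (u ^+ d + h ^+ d).
    rewrite -mulrA ler_pM2l// ler_pdivrMl//; exact: ler_normcX_even.
  move: h1 h2; rewrite /C1 /c1; lra.
(* By the choice of sign X eta = e |X| y = e y^d, while d >= 2 gives (s e)^d <= s e e. The value s =
   1 serves the shifted segment, all s serve the vertical sides. *)
have phase (s : R) : 0 <= s <= 1 ->
    - (X * (s * eta)) + C1 * (s * eta) ^+ d <= - (s * (e / 2 * y ^+ d)).
  move=> /andP[s0 s1].
  have -> : X * (s * eta) = s * e * y ^+ d.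
    have -> : X * (s * eta) = s * e * (X * sg * y) by rewrite /eta; ring.
    by rewrite sgX XE -exprSr prednK.
  have -> : (s * eta) ^+ d = (s * e) ^+ d * y ^+ d.
    rewrite -normX_even normrM etaE (ger0_norm s0).
    by rewrite mulrA exprMn.
  have se0 : 0 <= s * e by rewrite mulr_ge0// ltW.
  have h1 : (s * e) ^+ d <= s * e * e.
    have -> : d = d.-2.+2 by rewrite /d; case: (mu) mu0 => // m _; rewrite mulnS.
    rewrite 2!exprS ler_wpM2l// (@le_trans _ _ (s * e))//.
      by rewrite ler_piMr// exprn_ile1// (le_trans _ e1)// ler_piMl// ltW.
    by rewrite ler_piMl// ltW.
  have h2 : C1 * (s * e) ^+ d <= s * e / 2.
    rewrite (le_trans (ler_wpM2l C1_ge0 h1))// mulrCA.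
    by rewrite ler_wpM2l// (le_trans eC)// mul1r.
  have := ler_wpM2r yd0 h2; lra.
have etaA : `|eta| <= A by rewrite etaE.
have nA : `|A| = A by rewrite gtr0_norm.
pose M := D * expR (- c1 * A ^+ d).
have vert (x s : R) : `|x| = A -> 0 <= s <= 1 -> N (g (x +i* (s * eta))) <= M.
  move=> xA /andP[s0 s1]; rewrite (le_trans (gE _ _ _ _))//.
  - by rewrite xA.
  - by rewrite normrM ger0_norm// (le_trans _ etaA)// ler_piMl.
  rewrite ler_wpM2l// ler_expR -(normX_even x) xA.
  have := phase s; rewrite s0 s1 => /(_ isT).
  have : 0 <= s * (e / 2 * y ^+ d) by rewrite mulr_ge0// mulr_ge0.
  rewrite mulNr; lra.
have hv s : 0 <= s <= 1 ->
    N (g (A +i* (s * eta))) <= M /\ N (g ((- A) +i* (s * eta))) <= M.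
  by move=> hs; split; apply: vert; rewrite ?normrN.
pose I0 := intC `[- A, A] (fun t => g t%:C).
pose I1 := intC `[- A, A] (fun t => g (t +i* eta)).
have shift : N (I0 - I1) <= 4 * M * `|eta| := contour_shift hg A0 hv.
have y_le : k * y ^+ d <= c1 * A ^+ d.
  rewrite /k -mulrA ler_pM2l// ler_pdivrMl ?exprn_gt0// -exprMn.
  have BA0 : 0 <= B * A by rewrite mulr_ge0// ltW.
  by rewrite lerXn2r ?nnegrE.
have expc (r : R) : c <= r -> expR (- r * y ^+ d) <= expR (- c * y ^+ d).
  by move=> cr; rewrite ler_expR !mulNr lerN2 ler_wpM2r.
have bound0 : N (I0 - I1) <= 4 * e * (1 + 2 / k) * D * expR (- c * y ^+ d).
  rewrite (le_trans shift)// /M etaE.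
  rewrite (@le_trans _ _ (4 * e * D * (y * expR (- k * y ^+ d))))//.
    have -> : 4 * (D * expR (- c1 * A ^+ d)) * (e * y) =
      4 * e * D * (y * expR (- c1 * A ^+ d)) by ring.
    rewrite ler_wpM2l//; first by rewrite !mulr_ge0// ltW.
    by rewrite ler_wpM2l// ler_expR !mulNr lerN2.
  have -> : 4 * e * (1 + 2 / k) * D * expR (- c * y ^+ d) =
    4 * e * D * ((1 + 2 / k) * expR (- c * y ^+ d)) by ring.
  rewrite ler_wpM2l//; first by rewrite !mulr_ge0// ltW.
  rewrite (le_trans (mul_expRN_bound k0 y0 d0))// ler_wpM2l//.
    by rewrite addr_ge0// divr_ge0// ltW.
  by apply: expc; rewrite ge_min lexx orbT.
pose K := D * expR (- c * y ^+ d).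
have intg : leb.-integrable `[- A, A]
    (EFin \o (fun u : R => expR (- c1 * u ^+ d))).
  exact: integrableS (gauss_integrable c1_gt0 mu0).
have bound1 : N I1 <= 2 * gauss_int c1 mu * D * expR (- c * y ^+ d).
  have iK : leb.-integrable `[- A, A]
      (EFin \o (fun u : R => K * expR (- c1 * u ^+ d))).
    exact: (@integrableZl _ _ _ leb _ _ K _ intg).
  have hI1 : intgC `[- A, A] (fun t => g (t +i* eta)).
    by apply: contC_intgC; case: hg.
  rewrite (le_trans (normc_intC _ hI1 iK _))//.
    move=> t /=; rewrite in_itv /= => tA.
    rewrite (le_trans (gE _ _ _ _))// ?ler_norml// /K -mulrA ler_wpM2l//.
    rewrite -expRD ler_expR.
    have := phase 1; rewrite ler01 lexx mul1r mul1r => /(_ isT).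
    have : c * y ^+ d <= e / 2 * y ^+ d by rewrite ler_wpM2r// ge_min lexx.
    rewrite !mulNr; lra.
  rewrite RintegralZl//.
  have -> : 2 * gauss_int c1 mu * D * expR (- c * y ^+ d) =
    2 * (K * gauss_int c1 mu) by rewrite /K; ring.
  rewrite ler_pM2l// ler_wpM2l ?mulr_ge0 ?expR_ge0//.
  exact: gauss_int_segment.
have -> : intC `[- A, A] (fun u => gkern X mu beta u%:C * f u%:C) = I1 + (I0 - I1).
  by rewrite addrC subrK.
rewrite (le_trans (normcD _ _))// mulrDl mulrDl.
exact: lerD.
Qed.

End GaussianContourBound.

(** * Polynomial moments of the kernel and the derivatives of [Hgauss] *)

Section HermiteGauss.
Context {R : realType}.
Implicit Types (beta : R[i]) (mu : nat) (X : R) (p : {poly R[i]}).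

(** The inequality x <= (1 + 1/delta) exp(delta x^d) is raised to the power i with i delta <= eps;
    the denominator i + 1 in delta covers i = 0. *)
Lemma expr_expR_bound (eps : R) i d : 0 < eps -> (0 < d)%N ->
  exists2 C : R, 0 <= C & forall x : R, 0 <= x -> x ^+ i <= C * expR (eps * x ^+ d).
Proof.
move=> eps0 d0; pose delta := eps / i.+1%:R.
have delta0 : 0 < delta by rewrite divr_gt0.
have V0 : 0 <= delta^-1 by rewrite invr_ge0 ltW.
have K0 : 0 <= 1 + delta^-1 by rewrite addr_ge0.
exists ((1 + delta^-1) ^+ i); first exact: exprn_ge0.
move=> x x0; have xd0 : 0 <= x ^+ d by exact: exprn_ge0.
have h : x <= (1 + delta^-1) * expR (delta * x ^+ d).
  rewrite (le_trans (ler_1DX x0 d0))//.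
  rewrite (@le_trans _ _ ((1 + delta^-1) * (1 + delta * x ^+ d)))//; last first.
    by rewrite ler_wpM2l// expR_ge1Dx.
  have -> : (1 + delta^-1) * (1 + delta * x ^+ d) =
    1 + x ^+ d + (delta^-1 + delta * x ^+ d).
    by field; rewrite gt_eqF.
  by rewrite lerDl addr_ge0// mulr_ge0// ltW.
rewrite (@le_trans _ _ (((1 + delta^-1) * expR (delta * x ^+ d)) ^+ i))//.
  by rewrite lerXn2r ?nnegrE// mulr_ge0// expR_ge0.
rewrite exprMn ler_wpM2l ?exprn_ge0// -expRM_natl ler_expR mulrA ler_wpM2r//.
rewrite /delta mulrCA ler_piMr ?(ltW eps0)//.
by rewrite ler_pdivrMr// mul1r ler_nat.
Qed.

Lemma poly_expR_bound p (eps : R) d : 0 < eps -> (0 < d)%N ->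
  exists2 C : R, 0 <= C & forall v, N p.[v] <= C * expR (eps * N v ^+ d).
Proof.
move=> eps0 d0.
have /choice[C hC] : forall i : nat, exists C : R, 0 <= C /\
    forall x : R, 0 <= x -> x ^+ i <= C * expR (eps * x ^+ d).
  by move=> i; have [C C0 hC] := expr_expR_bound i eps0 d0; exists C.
exists (\sum_(i < size p) N p`_i * C i).
  by apply: sumr_ge0 => i _; rewrite mulr_ge0 ?normc_ge0//; case: (hC i).
move=> v; rewrite (le_trans (normc_horner _ _))// mulr_suml.
apply: ler_sum => i _; rewrite -mulrA ler_wpM2l ?normc_ge0//.
by case: (hC i) => _; apply; exact: normc_ge0.
Qed.

Lemma contC_gkern X mu beta : (0 < mu)%N -> contC (fun u => gkern X mu beta u%:C).
Proof. by move=> /(entire_gkern X beta)[/(_ 0)]. Qed.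

Lemma normc_gkern_real X mu beta (u : R) :
  N (gkern X mu beta u%:C) = expR (- Re beta * u ^+ (2 * mu)).
Proof.
rewrite normc_gkern /= mulr0 oppr0 add0r -rmorphXn ReM /= mulr0 subr0.
by rewrite mulNr.
Qed.

(** Half of the rate absorbs the polynomial. Uniformity in X, from |exp(i X u)| = 1, later allows
    differentiation under the integral. *)
Lemma poly_gkern_bound p mu beta : (0 < mu)%N -> 0 < Re beta ->
  exists2 C : R, 0 <= C & forall X (u : R),
    N (p.[u%:C] * gkern X mu beta u%:C) <= C * expR (- (Re beta / 2) * u ^+ (2 * mu)).
Proof.
move=> mu0 b0; have b20 : 0 < Re beta / 2 by rewrite divr_gt0.
have d0 : (0 < 2 * mu)%N by rewrite muln_gt0.
have [C C0 hC] := poly_expR_bound p b20 d0.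
exists C => // X u; rewrite normcM normc_gkern_real.
rewrite (le_trans (ler_wpM2r (expR_ge0 _) (hC _)))// -(mulrA C) ler_wpM2l// -expRD.
rewrite normc_real normX_even ler_expR.
have -> : - Re beta = - (Re beta / 2) - Re beta / 2 by field.
by rewrite mulrDl mulNr addrCA subrr addr0.
Qed.

Lemma poly_gkern_intg p X mu beta : (0 < mu)%N -> 0 < Re beta ->
  intgC setT (fun u => p.[u%:C] * gkern X mu beta u%:C).
Proof.
move=> mu0 b0; have [C C0 hC] := poly_gkern_bound p mu0 b0.
have b20 : 0 < Re beta / 2 by rewrite divr_gt0.
apply: (@intgC_dom _ _ _ (fun u => C * expR (- (Re beta / 2) * u ^+ (2 * mu)))) => //.
- by apply: contCM; [apply: contC_horner; exact: contC_id|exact: contC_gkern].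
- exact: (@integrableZl _ _ _ leb _ _ C _ (gauss_integrable b20 mu0)).
Qed.

Lemma intC_setD (A E : set R) (f : R -> R[i]) : measurable A -> measurable E -> A
  `<=` E ->
  intgC E f -> intC E f = intC A f + intC (E `\` A) f.
Proof.
move=> mA mE AE [f1 f2].
have mD : measurable (E `\` A) by exact: measurableD.
have dis : [disjoint A & E `\` A] by apply/disj_setPS => t [/= At []].
have EE : A `|` (E `\` A) = E by exact: setDUK.
apply: complex_eq; rewrite ?ReD ?ImD /=.
  by rewrite -{1}EE Rintegral_setU// EE.
by rewrite -{1}EE Rintegral_setU// EE.
Qed.

Lemma intgC_sub (D E : set R) (f : R -> R[i]) : measurable D -> measurable E ->
  D `<=` E -> intgC E f -> intgC D f.
Proof. by move=> mD mE DE [f1 f2]; split; [move: f1|move: f2]; exact: integrableS. Qed.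

Lemma poly_gkern_tail p mu beta : (0 < mu)%N -> 0 < Re beta ->
  exists c C : R, [/\ 0 < c, 0 <= C & forall X A : R, 0 <= A ->
    N (intC setT (fun u => p.[u%:C] * gkern X mu beta u%:C) -
       intC `[- A, A] (fun u => p.[u%:C] * gkern X mu beta u%:C)) <=
    C * expR (- c * A ^+ (2 * mu))].
Proof.
move=> mu0 b0; have [C C0 hC] := poly_gkern_bound p mu0 b0.
(* The available rate Re beta / 2 is split evenly: one part gives smallness at A, the other stays
   integrable. *)
pose c := Re beta / 4; have c0 : 0 < c by rewrite divr_gt0.
exists c, (2 * C * gauss_int c mu); split=> // [|X A A0].
  by rewrite !mulr_ge0// gauss_int_ge0.
have hT := poly_gkern_intg p X mu0 b0.
have mA : measurable (`[- A, A]%classic : set R) by exact: measurable_itv.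
have mC : measurable (~` `[- A, A]%classic : set R) by exact: measurableC.
rewrite (intC_setD mA measurableT (@subsetT _ _) hT) setTD addrC addKr.
pose E := C * expR (- c * A ^+ (2 * mu)).
have E0 : 0 <= E by rewrite mulr_ge0// expR_ge0.
have ig := @integrableZl _ _ _ leb _ measurableT E _ (gauss_integrable c0 mu0).
have igC : leb.-integrable (~` `[- A, A]%classic)
    (EFin \o (fun u : R => E * expR (- c * u ^+ (2 * mu)))).
  exact: integrableS ig.
rewrite (le_trans (normc_intC mC _ igC _))//.
- exact: intgC_sub hT.
- move=> u /= /negP; rewrite in_itv /= -ler_norml -ltNge => Au.
  rewrite (le_trans (hC X u))// /E -mulrA ler_wpM2l// -expRD ler_expR.
  have : A ^+ (2 * mu) <= u ^+ (2 * mu).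
    by rewrite -(normX_even u) lerXn2r ?nnegrE// ltW.
  move/(ler_wpM2l (ltW c0)); rewrite /c; lra.
- have -> : 2 * C * gauss_int c mu * expR (- c * A ^+ (2 * mu)) = 2 * (E * gauss_int
  c mu).
    by rewrite /E; ring.
  rewrite ler_pM2l// /gauss_int -RintegralZl//; last exact: gauss_integrable.
  rewrite Rintegral_mkcond; apply: le_Rintegral => //.
  + by rewrite -restrict_EFin; apply/integrable_restrict => //; rewrite setTI.
  + by move=> u _; rewrite /patch; case: ifP => // _; rewrite mulr_ge0 ?expR_ge0.
Qed.

(** The segment may grow with y: up to y + 1 the contour shift applies with B = 1, and beyond it the
    tail already has the right size. The added 1 keeps the segment nondegenerate at y = 0. *)
Lemma poly_gkern_decay p mu beta : (0 < mu)%N -> 0 < Re beta ->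
  exists c C : R, [/\ 0 < c, 0 <= C & forall X y : R,
    0 <= y -> `|X| = y ^+ (2 * mu).-1 ->
    N (intC setT (fun u => p.[u%:C] * gkern X mu beta u%:C)) <=
    C * expR (- c * y ^+ (2 * mu))].
Proof.
move=> mu0 b0; have [c1 [C1 [c10 C10 tail]]] := poly_gkern_tail p mu0 b0.
have [eps eps0 /(_ 1 ltr01)[c2 [C2 [c20 C20 main]]]] := gauss_contour mu0 b0.
have d0 : (0 < 2 * mu)%N by rewrite muln_gt0.
have [D D0 hD] := poly_expR_bound p eps0 d0.
exists (Num.min c1 c2), (C2 * D + C1); split.
- by rewrite lt_min c10.
- by rewrite addr_ge0// mulr_ge0.
move=> X y y0 XE; have yd0 : 0 <= y ^+ (2 * mu) by exact: exprn_ge0.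
have A0 : 0 < y + 1 by rewrite ltr_wpDl.
have yA : y <= 1 * (y + 1) by rewrite mul1r lerDl.
have h1 := main (y + 1) y X D _ A0 y0 XE yA D0 (entire_horner p) (fun u eta _ _ => hD
  (u +i* eta)).
have h2 := tail X (y + 1) (ltW A0).
rewrite -[X in N X](subrK (intC `[- (y + 1), y + 1]
  (fun u => p.[u%:C] * gkern X mu beta u%:C))).
rewrite (le_trans (normcD _ _))// addrC mulrDl lerD//.
  rewrite (le_trans _ (le_trans h1 _))//.
    rewrite le_eqVlt; apply/orP; left; apply/eqP; congr N.
    by apply: eq_intC => u _; rewrite mulrC.
  by rewrite ler_wpM2l ?mulr_ge0// ler_expR !mulNr lerN2 ler_wpM2r// ge_min lexx orbT.
rewrite (le_trans h2)// ler_wpM2l// ler_expR !mulNr lerN2.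
apply: ler_pM => //; first by rewrite le_min !ltW.
  by rewrite ge_min lexx.
by rewrite lerXn2r ?nnegrE ?lerDl// ltW.
Qed.

(** Up to the factor 1/(2 pi) this is the q-th derivative of [Hgauss]: each X-derivative of exp(i X
    u) brings down i u. *)
Definition hermint q X mu beta : R[i] :=
  intC setT (fun u => ('i * u%:C) ^+ q * gkern X mu beta u%:C).

Lemma derC_hermint q mu beta : (0 < mu)%N -> 0 < Re beta ->
  derC (fun X => hermint q X mu beta) (fun X => hermint q.+1 X mu beta).
Proof.
move=> mu0 b0.
pose h (q : nat) (X u : R) := ('i * u%:C) ^+ q * gkern X mu beta u%:C.
have dh u : derC (fun X => h q X u) (fun X => h q.+1 X u).
  have dl : derC (fun X => ('i * u%:C) * X%:C) (fun=> 'i * u%:C).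
    apply: derC_eq (derCM (derC_cst ('i * u%:C)) derC_id) => // t.
    by rewrite mul0r add0r mulr1.
  apply: derC_eq (derCM (derC_cst (('i * u%:C) ^+ q))
    (derCM (derC_exp dl) (derC_cst (expC (- beta * u%:C ^+ (2 * mu)))))) => t.
    by rewrite /h /gkern; congr (_ * (expC _ * _)); ring.
  rewrite /h /gkern exprS mul0r add0r mulr0 addr0.
  by rewrite (_ : 'i * t%:C * u%:C = 'i * u%:C * t%:C); ring.
pose P n : {poly R[i]} := ('i *: 'X) ^+ n.
have hE n X u : h n X u = (P n).[u%:C] * gkern X mu beta u%:C.
  by rewrite /h /P horner_exp hornerZ hornerX.
have hI n X : intgC setT (h n X).
  by apply: eq_intgC (poly_gkern_intg (P n) X mu0 b0) => // t _; rewrite hE.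
have [C C0 hC] := poly_gkern_bound (P q.+1) mu0 b0.
(* One integrable majorant for all X, so the interval ]X - 1, X + 1[ used below is an arbitrary
   neighbourhood. *)
pose G (u : R) := C * expR (- (Re beta / 2) * u ^+ (2 * mu)).
have G0 u : 0 <= G u by rewrite mulr_ge0// expR_ge0.
have b20 : 0 < Re beta / 2 by rewrite divr_gt0.
have iG : leb.-integrable setT (EFin \o G).
  exact: (@integrableZl _ _ _ leb _ measurableT C _ (gauss_integrable b20 mu0)).
have hG X u : N (h q.+1 X u) <= G u by rewrite hE.
have aux (k k' : R -> R -> R) (X : R) :
    (forall X, leb.-integrable setT (EFin \o k X)) ->
    (forall X u : R, is_derive X 1 (k ^~ u) (k' X u)) ->
    (forall X u, `|k' X u| <= G u) ->
    is_derive X 1 (fun X => \int[leb]_u k X u) (\int[leb]_u k' X u).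
  move=> ik dk kG.
  have XI : `]X - 1, X + 1[%classic X by rewrite /= in_itv /=; lra.
  have dE x y : partial1of2 k x y = k' x y.
    by rewrite partial1of2E; case: (dk x y).
  have kG' x y : `]X - 1, X + 1[%classic x -> setT y -> `|partial1of2 k x y| <= G y.
    by move=> _ _; rewrite dE.
  have kd x y : `]X - 1, X + 1[%classic x -> setT y -> derivable (k ^~ y) x 1.
    by move=> _ _; case: (dk x y).
  have ik' x : `]X - 1, X + 1[%classic x -> leb.-integrable setT (EFin \o k x).
    by [].
  have e1 := @differentiation_under_integral R _ _ leb k setT measurableT X (X - 1)
    (X + 1) XI ik' kd G G0 iG kG'.
  have e2 := @derivable_under_integral R _ _ leb k setT measurableT X (X - 1)
    (X + 1) XI ik' kd G G0 iG kG'.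
  split=> //; rewrite -derive1E e1; apply: eq_Rintegral => u _; exact: dE.
move=> X; split.
  apply: (aux (fun X u => Re (h q X u)) (fun X u => Re (h q.+1 X u))).
  - by move=> x; case: (hI q x).
  - by move=> x u; case: (dh u x).
  - by move=> x u; rewrite (le_trans (normc_Re _)).
apply: (aux (fun X u => Im (h q X u)) (fun X u => Im (h q.+1 X u))).
- by move=> x; case: (hI q x).
- by move=> x u; case: (dh u x).
- by move=> x u; rewrite (le_trans (normc_Im _)).
Qed.

Lemma HgaussE mu beta (x : R) :
  Hgauss mu beta x = ((2 * pi)^-1)%:C * hermint 0 x mu beta.
Proof.
rewrite /Hgauss /hermint; congr (_ * _); rewrite -[LHS]/(intC setT _).
by apply: eq_intC => u _; rewrite expr0 mul1r gkern_real.
Qed.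

Lemma derivCn_Hgauss q mu beta (x : R) : (0 < mu)%N -> 0 < Re beta ->
  derivCn q (Hgauss mu beta) x = ((2 * pi)^-1)%:C * hermint q x mu beta.
Proof.
move=> mu0 b0; pose f q x := ((2 * pi)^-1)%:C * hermint q x mu beta.
have df n : derC (f n) (f n.+1).
  apply: derC_eq (derCM (derC_cst (((2 * pi)^-1)%:C)) (derC_hermint n mu0 b0)) => // t.
  by rewrite mul0r add0r.
have -> : Hgauss mu beta = f 0%N by apply/funext => t; rewrite HgaussE.
have dRe : derive1n q (fun t => Re (f 0%N t) : R) = (fun t => Re (f q t)).
  elim: q => [//|q ih]; rewrite derive1nS ih; apply/funext => t.
  by rewrite derive1E; case: (df q t) => -[_ ->].
have dIm : derive1n q (fun t => Im (f 0%N t) : R) = (fun t => Im (f q t)).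
  elim: q {dRe} => [//|q ih]; rewrite derive1nS ih; apply/funext => t.
  by rewrite derive1E; case: (df q t) => _ [_ ->].
by rewrite /derivCn dRe dIm -/(f q x); case: (f q x).
Qed.

End HermiteGauss.

(** * Local expansions *)

Section LocalExpansion.
Context {R : realType}.
Implicit Types (g : R[i] -> R[i]) (mu n m s : nat) (p q : {poly R[i]}).

(** Flatness on the real axis alone becomes an algebraic factor, hence a bound of the same order at
    complex arguments. *)
Lemma poly_flat_factor q k (M delta : R) : 0 < delta ->
  (forall x : R, `|x| < delta -> N q.[x%:C] <= M * `|x| ^+ k) ->
  exists q', q = q' * 'X^k.
Proof.
elim: k M delta => [|k ih] M delta d0 hq; first by exists q; rewrite expr0 mulr1.
have M0 : 0 <= M.
  have h2 : 0 < delta / 2 by rewrite divr_gt0.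
  have := hq (delta / 2); rewrite gtr0_norm// ltr_pdivrMr// ltr_pMr// ltr1n.
  move=> /(_ isT) /(le_trans (normc_ge0 _)).
  by rewrite pmulr_lge0// exprn_gt0.
(* For |x| <= 1 a bound of order k + 1 implies one of order k, as the induction hypothesis needs. *)
have d1 : 0 < Num.min delta 1 by rewrite lt_min d0 ltr01.
have hq1 (x : R) : `|x| < Num.min delta 1 -> N q.[x%:C] <= M * `|x| ^+ k.
  rewrite lt_min => /andP[xd x1]; rewrite (le_trans (hq x xd))//.
  by rewrite ler_wpM2l// exprS ler_piMl// ?exprn_ge0// ltW.
have [q1 q1E] := ih M _ d1 hq1.
have [q2 [c q2E]] : exists q2 c, q1 = q2 * 'X + c%:P.
  by elim/poly_ind: (q1) => [|q2 c _]; [exists 0, 0; rewrite mul0r add0r|exists q2, c].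
suff c0 : c = 0.
  by exists q2; rewrite q1E q2E c0 addr0 exprS mulrA.
have [M2 M20 hM2] := normc_bounded q2 delta.
(* After division by x^k the constant term is O(x) as x tends to 0, hence zero. *)
have key x : 0 < x -> x < delta -> N c <= (M + M2) * x.
  move=> x0 xd; have -> : c = q1.[x%:C] - q2.[x%:C] * x%:C.
    by rewrite q2E hornerMXaddC addrAC subrr add0r.
  rewrite (le_trans (ler_normcB _ _))// mulrDl lerD//.
    have xk : 0 < `|x| ^+ k by rewrite exprn_gt0// normr_gt0 gt_eqF.
    rewrite -(ler_pM2r xk); have := hq x; rewrite gtr0_norm// => /(_ xd).
    by rewrite q1E hornerM hornerXn normcM normcX normc_real gtr0_norm// exprS mulrA.
  rewrite normcM normc_real gtr0_norm// ler_wpM2r ?(ltW x0)// hM2//.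
  by rewrite normc_real gtr0_norm// ltW.
apply: ComplexField.Normc.eq0_normc; apply/eqP; rewrite eq_le normc_ge0 andbT.
apply/ler_addgt0Pr => e e0; rewrite add0r.
pose x := Num.min (delta / 2) (e / (M + M2 + 1)).
have MM : 0 < M + M2 + 1 by rewrite ltr_wpDl// addr_ge0.
have x0 : 0 < x by rewrite lt_min; apply/andP; split; exact: divr_gt0.
rewrite (le_trans (key x x0 _))//.
  by rewrite gt_min ltr_pdivrMr// ltr_pMr// ltr1n.
rewrite (@le_trans _ _ ((M + M2 + 1) * (e / (M + M2 + 1))))//.
  by apply: ler_pM; rewrite ?addr_ge0 ?(ltW x0)// ?lerDl// ge_min lexx orbT.
by rewrite mulrCA divff ?mulr1// gt_eqF.
Qed.

(** By Pascal's rule the remainder for (n + 1, M + 1) is the one for (n, M + 1) plus w times the one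
    for (n, M); the bounds add up to (n + 1)|w| (n|w|)^M (1 + |w|)^n. *)
Lemma binomial_remainder (w : R[i]) M n :
  N ((1 + w) ^+ n - \sum_(m < M) 'C(n, m)%:R * w ^+ m) <=
    (n%:R * N w) ^+ M * (1 + N w) ^+ n.
Proof.
have N1w : N (1 + w) <= 1 + N w by rewrite (le_trans (normcD _ _))// normc1.
have w0 := normc_ge0 w.
elim: n M => [|n ih] [|M].
- by rewrite big_ord0 subr0 !expr0 normc1 mulr1.
- rewrite big_ord_recl big1 ?addr0 ?bin0 ?mul1r ?expr0 ?subrr ?normc0.
    by rewrite mulr1 exprn_ge0// mulr_ge0.
  by move=> i _; rewrite bin_small// mul0r.
- rewrite big_ord0 subr0 expr0 mul1r normcX lerXn2r ?nnegrE ?normc_ge0//.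
  by rewrite addr_ge0.
have -> : (1 + w) ^+ n.+1 - \sum_(m < M.+1) 'C(n.+1, m)%:R * w ^+ m =
    ((1 + w) ^+ n - \sum_(m < M.+1) 'C(n, m)%:R * w ^+ m) +
    w * ((1 + w) ^+ n - \sum_(m < M) 'C(n, m)%:R * w ^+ m).
  have -> : \sum_(m < M.+1) 'C(n.+1, m)%:R * w ^+ m =
      \sum_(m < M.+1) 'C(n, m)%:R * w ^+ m + w * \sum_(m < M) 'C(n, m)%:R * w ^+ m.
    rewrite mulr_sumr [LHS]big_ord_recl [in RHS]big_ord_recl -addrA; congr (_ + _).
      by rewrite !bin0.
    rewrite -big_split /=; apply: eq_bigr => i _.
    by rewrite /bump /= add1n binS natrD exprS; ring.
  by rewrite exprS; ring.
rewrite (le_trans (normcD _ _))// normcM.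
have p1 : 1 <= 1 + N w by rewrite lerDl.
have pn0 : 0 <= (1 + N w) ^+ n by rewrite exprn_ge0// addr_ge0.
have nw0 : 0 <= n%:R * N w by rewrite mulr_ge0.
have h1 := ih M.+1; have h2 := ler_wpM2l w0 (ih M).
apply: (le_trans (lerD h1 h2)).
have -> : (n%:R * N w) ^+ M.+1 * (1 + N w) ^+ n + N w * ((n%:R * N w) ^+ M * (1 + N
  w) ^+ n)
   = (n.+1%:R * N w) * (n%:R * N w) ^+ M * (1 + N w) ^+ n.
  by rewrite exprS -natr1; ring.
rewrite exprS -!mulrA ler_wpM2l ?mulr_ge0//.
apply: ler_wpM2l => //; apply: ler_pM => //; first exact: exprn_ge0.
  by rewrite lerXn2r ?nnegrE ?mulr_ge0// ler_wpM2r// ler_nat.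
by rewrite exprSr ler_peMr.
Qed.

Lemma normc_subX (a b : R[i]) (W : R) m : 1 <= W -> N a <= W -> N b <= W ->
  N (a ^+ m - b ^+ m) <= N (a - b) * (m%:R * W ^+ m).
Proof.
move=> W1 aW bW; have W0 : 0 <= W by rewrite (le_trans _ W1).
rewrite subrXX normcM ler_wpM2l ?normc_ge0//.
rewrite (le_trans (normc_sum _ _ _))//.
have -> : m%:R * W ^+ m = \sum_(i < m) W ^+ m by rewrite sumr_const card_ord mulr_natl.
apply: ler_sum => i _; rewrite normcM !normcX.
rewrite (@le_trans _ _ (W ^+ (m.-1 - i) * W ^+ i))//.
  by apply: ler_pM; rewrite ?exprn_ge0 ?normc_ge0// lerXn2r ?nnegrE ?normc_ge0.
rewrite -exprD subnK; last by rewrite -ltnS prednK// (leq_trans _ (ltn_ord i)).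
by rewrite ler_weXn2l// leq_pred.
Qed.

(** This includes m > n: the natural subtraction is then truncated, but both sides already contain a
    zero factor. *)
Lemma natr_ffact n m :
  (n ^_ m)%:R = \prod_(i < m) (n%:R - i%:R) :> R[i].
Proof.
elim: m => [|m ih]; first by rewrite big_ord0 ffactn0.
rewrite ffactnSr natrM ih big_ord_recr /=.
have [mn|nm] := leqP m n; first by rewrite natrB.
by rewrite -ih ffact_small// !mul0r.
Qed.

Lemma leq_bin_exp n m : ('C(n, m) <= n ^ m)%N.
Proof.
rewrite (@leq_trans (n ^_ m))//.
  by rewrite -bin_ffact leq_pmulr// fact_gt0.
elim: m => [|m ih]; first by rewrite ffactn0.
by rewrite ffactnSr expnSr leq_mul// leq_subr.
Qed.

Lemma horner2_coef_wide k (T : {poly {poly R[i]}}) (x v : R[i]) :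
  (size T <= k)%N ->
  T.[x%:P].[v] = \sum_(i < k) x ^+ i * (T`_i).[v].
Proof.
move=> kT; rewrite (horner_coef_wide _ kT) horner_sum; apply: eq_bigr => i _.
by rewrite hornerM horner_exp hornerC mulrC.
Qed.

(* The binomial sum in q (h v) with q = q' X^(2 mu + 1) and n = h^(-2 mu),
   as a polynomial in h (outer variable) and v (inner variable). *)
Definition binomial_poly mu s q' : {poly {poly R[i]}} :=
  let Y : {poly {poly R[i]}} := 'X in
  let V : {poly {poly R[i]}} := ('X : {poly R[i]})%:P in
  let Q : {poly {poly R[i]}} := map_poly polyC q' \Po (Y * V) in
  let c (m : nat) : {poly {poly R[i]}} := ((m`!%:R^-1 : R[i])%:P : {poly R[i]})%:P in
  \sum_(m < s) c m * (\prod_(i < m) (1 - i%:R * Y ^+ (2 * mu))) * Y ^+ m *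
    (V ^+ (2 * mu).+1 * Q) ^+ m.

(** ['C(n, m)] equals n^m / m! times the product of the 1 - i/n. With 1/n = h^(2 mu), the factor n^m
    cancels all but h^m of (h v)^((2 mu + 1) m), so only nonnegative powers of h survive. *)
Lemma binomial_polyE mu s q' n (h v : R[i]) : h ^+ (2 * mu) * n%:R = 1 ->
  (binomial_poly mu s q').[h%:P].[v] =
  \sum_(m < s) 'C(n, m)%:R * (q' * 'X^((2 * mu).+1)).[h * v] ^+ m.
Proof.
move=> hn; rewrite /binomial_poly !horner_sum; apply: eq_bigr => m _.
have n0 : n%:R != 0 :> R[i].
  by apply/eqP => n0; move: hn; rewrite n0 mulr0 => /eqP; rewrite eq_sym oner_eq0.
have hV : h ^+ (2 * mu) = n%:R^-1 by rewrite -[LHS](mulfK n0) hn mul1r.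
have e1 : (map_poly polyC q' \Po ('X * 'X%:P)).[h%:P].[v] = q'.[h * v].
  rewrite horner_comp hornerM hornerX hornerC.
  have -> : h%:P * 'X = h *: 'X :> {poly R[i]} by rewrite mul_polyC.
  by rewrite -/(comp_poly _ _) horner_comp hornerZ hornerX.
have e2 : (\prod_(i < m) (1 - i%:R * 'X^(2 * mu))).[h%:P].[v] =
    \prod_(i < m) (1 - i%:R / n%:R) :> R[i].
  rewrite !horner_prod; apply: eq_bigr => i _.
  rewrite hornerD hornerN hornerM hornerXn hornerC.
  rewrite -(polyC_natr _ i) hornerC hornerD hornerN hornerC.
  by rewrite -(polyC_natr _ i) hornerM hornerC horner_exp hornerC hV.
have fm : m`!%:R != 0 :> R[i] by rewrite pnatr_eq0 -lt0n fact_gt0.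
have e3 : 'C(n, m)%:R = m`!%:R^-1 * \prod_(i < m) (1 - i%:R / n%:R) * n%:R ^+ m :> R[i].
  apply: (mulIf fm); rewrite -natrM bin_ffact natr_ffact.
  rewrite mulrC !mulrA divff// mul1r -[m in n%:R ^+ m]card_ord -prodr_const.
  rewrite -big_split /=; apply: eq_bigr => i _.
  by rewrite mulrBl mul1r divfK.
rewrite !(hornerM, horner_exp) !hornerC e1 e2 !hornerX e3 hornerC.
rewrite -!mulrA; congr (_ * (_ * _)); rewrite -!exprMn; congr (_ ^+ _).
rewrite exprMn !exprS hV.
by field.
Qed.

(* g is 1 + O(z^(2 mu + 1)); with h = n^(-1/(2 mu)) and z = h v the power
   (1 + w)^n is expanded by Newton's formula, where w is O(h^(2 mu + 1)). *)
Lemma local_expansion g mu s (M delta : R) : (0 < mu)%N -> entire g -> 0 < delta ->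
  (forall x : R, `|x| < delta -> N (g x%:C - 1) <= M * `|x| ^+ (2 * mu).+1) ->
  exists P : nat -> {poly R[i]}, forall eps : R, 0 < eps -> exists r C : R,
    [/\ 0 < r, 0 <= C & forall n (h : R) (v : R[i]), (0 < n)%N -> 0 < h ->
      h ^+ (2 * mu) * n%:R = 1 -> h * N v <= r ->
      N (g (h%:C * v) ^+ n - \sum_(j < s) h%:C ^+ j * (P j).[v]) <=
        C * h ^+ s * expR (eps * N v ^+ (2 * mu))].
Proof.
move=> mu0 hg delta0 gM.
set d := (2 * mu)%N in gM *.
have d0 : (0 < d)%N by rewrite muln_gt0.
(* Order d + 1 is needed for the flat factor; order d s + s lets the Taylor error survive
   multiplication by n^s = h^(-d s) with h^s to spare. *)
pose o := (d * s + s + d.+1)%N.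
have [_ _ /(_ o 1)[p [C1 C10 hp]]] := hg.
have expo_o (x : R) k : 0 <= x -> x <= 1 -> (k <= o)%N -> x ^+ o <= x ^+ k.
  by move=> x0 x1 ko; rewrite ler_wiXn2l.
have [q' qE] : exists q', p - 1 = q' * 'X^(d.+1).
  apply: (@poly_flat_factor _ d.+1 (M + C1) (Num.min delta 1)).
    by rewrite lt_min delta0 ltr01.
  move=> x; rewrite lt_min => /andP[xd x1].
  have -> : (p - 1).[x%:C] = (g x%:C - 1) - (g x%:C - p.[x%:C]).
    by rewrite hornerD hornerN hornerC; ring.
  rewrite (le_trans (ler_normcB _ _))// mulrDl lerD ?gM//.
  have x1' := ltW x1; have hx := hp x%:C; rewrite normc_real in hx.
  rewrite (le_trans (hx x1'))// ler_wpM2l// ler_wiXn2l//.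
  exact: leq_addl.
pose w z := g z - 1.
have [Mq Mq0 hMq] := normc_bounded q' 1.
have wq z : N z <= 1 -> N (w z - (q' * 'X^(d.+1)).[z]) <= C1 * N z ^+ o.
  move=> z1; have -> : w z - (q' * 'X^(d.+1)).[z] = g z - p.[z].
    by rewrite -qE hornerD hornerN hornerC /w; ring.
  exact: hp.
pose Cw := C1 + Mq; have Cw0 : 0 <= Cw by rewrite addr_ge0.
have wb z : N z <= 1 -> N (w z) <= Cw * N z ^+ d.+1.
  move=> z1; rewrite -[w z](subrK (q' * 'X^(d.+1)).[z]) (le_trans (normcD _ _))//.
  rewrite mulrDl; apply: lerD.
    rewrite (le_trans (wq z z1))// ler_wpM2l// ler_wiXn2l ?normc_ge0//.
    exact: leq_addl.
  by rewrite hornerM hornerXn normcM normcX ler_wpM2r ?hMq// exprn_ge0 ?normc_ge0.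
pose T := binomial_poly mu s q'.
exists (fun j => T`_j) => eps eps0.
have eps20 : 0 < eps / 2 by rewrite divr_gt0.
have [K1 K10 hK1] := expr_expR_bound (d.+1 * s) eps20 d0.
have [K2 K20 hK2] := expr_expR_bound (d * s + s) eps0 d0.
have /choice[K3 hK3] : forall i : nat, exists C : R, 0 <= C /\
    forall v, N (T`_i).[v] <= C * expR (eps * N v ^+ d).
  by move=> i; have [C C0 hC] := poly_expR_bound (T`_i) eps0 d0; exists C.
(* [W] dominates w and its Taylor part on the unit disc. [r] is such that n|w| <= Cw h x^(d+1) <=
   (eps/2) x^d whenever h x <= r. *)
pose W := 1 + C1 + Cw + Mq; pose r := Num.min 1 (eps / 2 / (1 + Cw)).
have r0 : 0 < r by rewrite lt_min ltr01 divr_gt0// ltr_wpDr.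
pose Ca := Cw ^+ s * K1.
pose Cb := \sum_(m < s) C1 * (m%:R * W ^+ m) * K2.
pose Cc := \sum_(i < size T) K3 (s + i)%N.
have W1 : 1 <= W by rewrite /W -!addrA lerDl !addr_ge0.
have Cb0 : 0 <= Cb.
  apply: sumr_ge0 => m _; rewrite !mulr_ge0// exprn_ge0// (le_trans _ W1)//.
have Cc0 : 0 <= Cc by apply: sumr_ge0 => i _; case: (hK3 (s + i)%N).
have Ca0 : 0 <= Ca by rewrite mulr_ge0// exprn_ge0.
exists r, (Ca + Cb + Cc); split => //; first by rewrite !addr_ge0.
move=> n h v n0 h0 hn hv; have h0' := ltW h0.
set z := h%:C * v; set x := N v; set E := expR _.
have x0 : 0 <= x := normc_ge0 v.
have Nz : N z = h * x by rewrite normcM normc_real gtr0_norm.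
have hx0 : 0 <= h * x by rewrite mulr_ge0.
have hx1 : h * x <= 1 by rewrite (le_trans hv)// ge_min lexx.
have z1 : N z <= 1 by rewrite Nz.
have nR1 : 1 <= n%:R :> R by rewrite ler1n.
have h1 : h <= 1.
  rewrite leNgt; apply/negP => hgt.
  have hd : 1 < h ^+ d by rewrite exprn_egt1// -lt0n.
  have : 1 < h ^+ d * n%:R.
    by rewrite (lt_le_trans hd)// ler_peMr// ltW// (lt_trans ltr01).
  by rewrite hn ltxx.
have hs0 : 0 <= h ^+ s by rewrite exprn_ge0.
have hnC : h%:C ^+ d * n%:R = 1.
  by rewrite -rmorphXn -(rmorph_nat (real_complex R)) -rmorphM hn rmorph1.
have nwE : n%:R * (Cw * (h * x) ^+ d.+1) = Cw * (h * x ^+ d.+1).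
  have -> : n%:R * (Cw * (h * x) ^+ d.+1) = Cw * (h * x ^+ d.+1) * (h ^+ d * n%:R).
    by rewrite exprMn (exprS h); ring.
  by rewrite hn mulr1.
have nw : n%:R * N (w z) <= Cw * (h * x ^+ d.+1).
  by rewrite -nwE ler_wpM2l// -Nz wb.
have nw0 : 0 <= n%:R * N (w z) by rewrite mulr_ge0// normc_ge0.
have nw_eps : n%:R * N (w z) <= eps / 2 * x ^+ d.
  rewrite (le_trans nw)// exprS mulrA mulrA ler_wpM2r ?exprn_ge0// -mulrA.
  rewrite (@le_trans _ _ (Cw * (eps / 2 / (1 + Cw))))//.
    by rewrite ler_wpM2l// (le_trans hv)// ge_min lexx orbT.
  rewrite mulrCA ler_piMr ?(ltW eps20)// ler_pdivrMr ?ltr_wpDr//.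
  by rewrite mul1r lerDr.
(* Truncation error: (n|w|)^s yields h^s and powers of x absorbed by half of eps; (1 + |w|)^n <=
   exp(n|w|) uses the other half. *)
have partA : N ((1 + w z) ^+ n - \sum_(m < s) 'C(n, m)%:R * w z ^+ m) <= Ca * h ^+ s
  * E.
  rewrite (le_trans (binomial_remainder _ _ _))//.
  have eE : E = expR (eps / 2 * x ^+ d) * expR (eps / 2 * x ^+ d).
    by rewrite -expRD /E; congr expR; field.
  rewrite eE mulrA; apply: ler_pM.
  - exact: exprn_ge0.
  - by rewrite exprn_ge0// addr_ge0// normc_ge0.
  - rewrite (@le_trans _ _ ((Cw * (h * x ^+ d.+1)) ^+ s))//.
      by rewrite lerXn2r ?nnegrE ?mulr_ge0 ?exprn_ge0// normc_ge0.
    rewrite 2!exprMn -exprM /Ca.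
    have -> : Cw ^+ s * K1 * h ^+ s * expR (eps / 2 * x ^+ d) =
      Cw ^+ s * (h ^+ s * (K1 * expR (eps / 2 * x ^+ d))) by ring.
    by rewrite ler_wpM2l ?exprn_ge0// ler_wpM2l// hK1.
  - rewrite (@le_trans _ _ (expR (N (w z)) ^+ n))//.
      rewrite lerXn2r ?nnegrE ?expR_ge0 ?addr_ge0 ?normc_ge0//.
      exact: expR_ge1Dx.
    by rewrite -expRM_natl ler_expR.
have qW : N (q' * 'X^(d.+1)).[z] <= W.
  have -> : (q' * 'X^(d.+1)).[z] = w z - (w z - (q' * 'X^(d.+1)).[z]) by ring.
  rewrite (le_trans (ler_normcB _ _))// addrC.
  rewrite (@le_trans _ _ (C1 + Cw))//.
    apply: lerD; first by rewrite (le_trans (wq z z1))// ler_piMr// exprn_ile1//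
      normc_ge0.
    by rewrite (le_trans (wb z z1))// ler_piMr// exprn_ile1// normc_ge0.
  by rewrite /W; move: Mq0; lra.
have wW : N (w z) <= W.
  rewrite (le_trans (wb z z1))// (@le_trans _ _ Cw)//.
    by rewrite ler_piMr// exprn_ile1// normc_ge0.
  by rewrite /W; move: Mq0 C10; lra.
(* Error of replacing w by its Taylor part. *)
have partB : N (\sum_(m < s) 'C(n, m)%:R * w z ^+ m -
    \sum_(m < s) 'C(n, m)%:R * (q' * 'X^(d.+1)).[z] ^+ m) <= Cb * h ^+ s * E.
  rewrite -sumrB (le_trans (normc_sum _ _ _))// /Cb !mulr_suml.
  apply: ler_sum => m _; rewrite -mulrBr normcM normc_nat.
  have mW0 : 0 <= m%:R * W ^+ m by rewrite mulr_ge0// exprn_ge0// (le_trans _ W1).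
  rewrite (@le_trans _ _ (n%:R ^+ s * (C1 * (h * x) ^+ (d * s + s) * (m%:R * W ^+
    m))))//.
    apply: ler_pM => //; first exact: normc_ge0.
      rewrite -natrX ler_nat (leq_trans (leq_bin_exp _ _))// leq_pexp2l//.
      exact: ltnW.
    rewrite (le_trans (normc_subX _ W1 wW qW))// ler_wpM2r// (le_trans (wq z z1))//.
    by rewrite Nz ler_wpM2l// ler_wiXn2l// leq_addr.
  have -> : n%:R ^+ s * (C1 * (h * x) ^+ (d * s + s) * (m%:R * W ^+ m)) =
      C1 * (m%:R * W ^+ m) * (h ^+ s * x ^+ (d * s + s)) * (h ^+ d * n%:R) ^+ s.
    by rewrite exprMn exprD exprM exprMn; ring.
  rewrite hn expr1n mulr1.
  have -> : C1 * (m%:R * W ^+ m) * K2 * h ^+ s * E =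
    C1 * (m%:R * W ^+ m) * (h ^+ s * (K2 * E)) by ring.
  apply: ler_wpM2l; first exact: mulr_ge0.
  by rewrite ler_wpM2l// hK2.
have partC : N (T.[h%:C%:P].[v] - \sum_(j < s) h%:C ^+ j * (T`_j).[v]) <= Cc * h ^+ s
  * E.
  (* Padding to s + size T terms isolates the orders at least s even when T has fewer than s
     coefficients. *)
  rewrite (@horner2_coef_wide (s + size T)) ?leq_addl// big_split_ord /=.
  rewrite addrAC subrr add0r (le_trans (normc_sum _ _ _))// /Cc !mulr_suml.
  apply: ler_sum => i _; rewrite normcM normcX normc_real gtr0_norm//.
  case: (hK3 (s + i)%N) => K0 hK; rewrite mulrAC [leRHS]mulrC.
  apply: ler_pM; rewrite ?exprn_ge0 ?normc_ge0//.
  by rewrite ler_wiXn2l// leq_addr.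
have -> : g z = 1 + w z by rewrite /w addrC subrK.
rewrite -/z.
have -> : (1 + w z) ^+ n - \sum_(j < s) h%:C ^+ j * (T`_j).[v] =
    ((1 + w z) ^+ n - \sum_(m < s) 'C(n, m)%:R * w z ^+ m) +
    (\sum_(m < s) 'C(n, m)%:R * w z ^+ m -
      \sum_(m < s) 'C(n, m)%:R * (q' * 'X^(d.+1)).[z] ^+ m) +
    (T.[h%:C%:P].[v] - \sum_(j < s) h%:C ^+ j * (T`_j).[v]).
  rewrite (@binomial_polyE mu s q' n h%:C v hnC) -/d -/z.
  by rewrite !subrKA.
rewrite (le_trans (normcD _ _))// !mulrDl lerD//.
by rewrite (le_trans (normcD _ _))// lerD.
Qed.

End LocalExpansion.

(** * Fourier representation of the Green function *)

Section FourierRepresentation.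
Context {R : realType}.
Implicit Types (a : int -> R[i]) (f : R -> R[i]).

Lemma finite_support_seq a : finite_set [set j | a j != 0] ->
  exists S : seq int, [/\ forall kappa, symbol a kappa = \sum_(l <- S) a l * kappa ^ l,
    forall u j, convL a u j = \sum_(l <- S) a l * u (j + l) &
    exists L : nat, forall l, l \in S -> (absz l <= L)%N].
Proof.
move=> /finite_seqP[r rE]; pose A := undup r.
have A0 l : l \notin A -> a l = 0.
  rewrite mem_undup => /negP h; apply/eqP; apply: contrapT => al.
  by apply: h; have : [set j | a j != 0] l; [exact/negP|rewrite rE].
have sumE (f : int -> R[i]) : (forall l, a l = 0 -> f l = 0) ->
    \sum_(l \in [set: int]) f l = \sum_(l <- A) f l.
  move=> f0; rewrite (fsbigE A) ?undup_uniq//.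
    by apply: eq_bigl => l; exact: mem_set.
  by move=> l _ /A0 /f0.
exists A; split.
- by move=> kappa; rewrite /symbol sumE// => l ->; rewrite mul0r.
- by move=> u j; rewrite /convL sumE// => l ->; rewrite mul0r.
- exists (\max_(l <- A) absz l)%N => l lA.
  by apply: (@leq_bigmax_seq _ A xpredT (fun l : int => absz l) l).
Qed.

Lemma green_out_of_reach a (S : seq int) (L : nat) :
  (forall u j, convL a u j = \sum_(l <- S) a l * u (j + l)) ->
  (forall l, l \in S -> (absz l <= L)%N) ->
  forall n j, (L * n < absz j)%N -> green a n j = 0.
Proof.
move=> hS hL; elim=> [|n ih] j jn.
  by rewrite /green /= /delta0; case: eqP jn => // ->; rewrite muln0.
rewrite /green iterS -/(green a n) hS big_seq big1// => l lS.
rewrite ih ?mulr0//; have := hL l lS; move: jn; rewrite mulnS; lia.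
Qed.

(** The clockwise orientation makes the phase near kappa_k equal to exp(i (n alpha - j) x), which
    has the sign used in [Hgauss]. *)
Definition circ (t : R) : R[i] := expC (- 'i * t%:C).

Lemma circD t u : circ (t + u) = circ t * circ u.
Proof. by rewrite /circ rmorphD mulrDr expCD. Qed.

Lemma circE t : circ t = (cos t) -i* (sin t).
Proof.
rewrite /circ; have -> : - 'i * t%:C = 0 +i* (- t).
  by apply: complex_eq; rewrite ?ReM ?ImM /=; ring.
by rewrite /expC /= expR0 cosN sinN mul1r.
Qed.

Lemma normc_circ t : N (circ t) = 1.
Proof. by rewrite /circ normc_expC ReM /= oppr0 mul0r mulr0 subr0 expR0. Qed.

Lemma circ_2pi : circ (2 * pi) = 1.
Proof. by rewrite circE mulr_natl cos2pi sin2pi oppr0. Qed.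

Lemma circ_expz t (j : int) : circ t ^ j = expC ((- 'i * (j%:~R)%:C) * t%:C).
Proof.
rewrite /circ -expCXz; congr expC; rewrite -[LHS]mulrzr rmorph_int.
by rewrite mulrAC.
Qed.

Lemma contC_circ_expz (j : int) : contC (fun t => circ t ^ j).
Proof.
apply: (@contC_eq _ (fun t => expC ((- 'i * (j%:~R)%:C) * t%:C))).
  by move=> t; rewrite circ_expz.
by apply: contC_exp; apply: contCM; [exact: contC_cst|exact: contC_id].
Qed.

Lemma normc_expz (z : R[i]) (j : int) : N z = 1 -> N (z ^ j) = 1.
Proof.
move=> z1; case: j => n; first by rewrite -exprnP normcX z1 expr1n.
by rewrite NegzE -exprnN normcV normcX z1 expr1n invr1.
Qed.

Lemma int_circ_expz (b : R) (j : int) :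
  intC `[b, b + 2 * pi] (fun t => circ t ^ j) = (2 * pi * (j == 0)%:R)%:C.
Proof.
have bb : b < b + 2 * pi by rewrite ltrDl mulr_gt0// pi_gt0.
have [->|j0] := eqVneq j 0.
  rewrite (@eq_intC _ _ _ (fun=> 1)); last by move=> t _; rewrite expr0z.
  rewrite (@intC_FTC _ (fun t => t%:C) (fun=> 1))//.
  - by rewrite mulr1 -rmorphB addrC addKr.
  - exact: derC_id.
  - exact: contC_cst.
rewrite mulr0; pose c : R[i] := - 'i * (j%:~R)%:C.
have c0 : c != 0.
  rewrite mulf_neq0//.
    by rewrite oppr_eq0 eq_complex /= oner_eq0 andbF.
  by rewrite eq_complex /= intr_eq0 (negbTE j0).
have dl : derC (fun t => c * t%:C) (fun=> c).
  apply: derC_eq (derCM (derC_cst c) derC_id) => // t.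
  by rewrite mul0r add0r mulr1.
rewrite (@intC_FTC _ (fun t => c^-1 * circ t ^ j))//.
- rewrite circD circ_2pi mulr1; exact: subrr.
- apply: derC_eq (derCM (derC_cst c^-1) (derC_exp dl)) => t.
    by rewrite circ_expz.
  by rewrite mul0r add0r mulKf// circ_expz.
- exact: contC_circ_expz.
Qed.

Lemma contC_symbol a (S : seq int) :
  (forall kappa, symbol a kappa = \sum_(l <- S) a l * kappa ^ l) ->
  contC (fun t => symbol a (circ t)).
Proof.
move=> hF; apply: (@contC_eq _ (fun t => \sum_(l <- S) a l * circ t ^ l)) => [t|].
  by rewrite hF.
by apply: contC_sum => l; apply: contCM; [exact: contC_cst|exact: contC_circ_expz].
Qed.

(** The sequence kappa^j is an eigenvector of [convL a] with eigenvalue F(kappa). The free starting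
    point b later prevents arcs from being cut by the end of the period. *)
Lemma green_Fourier a (S : seq int) (b : R) :
  (forall kappa, symbol a kappa = \sum_(l <- S) a l * kappa ^ l) ->
  (forall u j, convL a u j = \sum_(l <- S) a l * u (j + l)) ->
  forall n j, green a n j = ((2 * pi)^-1)%:C *
    intC `[b, b + 2 * pi] (fun t => symbol a (circ t) ^+ n * circ t ^ j).
Proof.
move=> hF hS n; have pi0 : 2 * pi != 0 :> R by rewrite gt_eqF// mulr_gt0// pi_gt0.
have cF := contC_symbol hF.
have cI n' j : intgC `[b, b + 2 * pi] (fun t => symbol a (circ t) ^+ n' * circ t ^ j).
  by apply: contC_intgC; apply: contCM; [exact: contCX|exact: contC_circ_expz].
elim: n => [|n ih] j.
  rewrite (@eq_intC _ _ _ (fun t => circ t ^ j)); last first.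
    by move=> t _; rewrite expr0 mul1r.
  rewrite int_circ_expz -rmorphM mulrA mulVf// mul1r /green /= /delta0.
  by rewrite rmorph_nat.
rewrite /green iterS -/(green a n) hS.
under eq_bigr do rewrite ih mulrCA.
rewrite -mulr_sumr; congr (_ * _).
under eq_bigr do rewrite -intCZ//.
rewrite -intC_sum//; last by move=> l; exact: intgCZ.
apply: eq_intC => t _; rewrite exprSr -mulrA hF mulr_suml mulr_sumr.
apply: eq_bigr => l _; rewrite expfzDr; last exact: expC_neq0.
by ring.
Qed.

Lemma circ_surj (kappa : R[i]) : N kappa = 1 ->
  exists2 t : R, 0 <= t < 2 * pi & kappa = circ t.
Proof.
case: kappa => x y nk.
have x2 : x ^+ 2 + y ^+ 2 = 1.
  have := congr1 (fun r => r ^+ 2) nk; rewrite /= sqr_sqrtr ?expr1n//.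
  by rewrite addr_ge0 ?sqr_ge0.
have xb : -1 <= x <= 1.
  by rewrite -ler_norml -(@expr_le1 _ 2)// real_normK ?num_real// -x2 lerDl sqr_ge0.
have sq : sin (acos x) = `|y|.
  by rewrite sin_acos// -x2 addrC addKr sqrtr_sqr.
have a0 := acos_ge0 xb; have ap := acos_lepi xb; have cx := acosK xb.
have pi0 := @pi_gt0 R.
have [y0|y0] := leP y 0.
  exists (acos x); first by rewrite a0 /=; lra.
  by rewrite circE cx sq ler0_norm// opprK.
(* Strictness keeps the angle 2 pi - acos x inside the half-open interval. *)
have x1 : x < 1.
  rewrite lt_neqAle; case/andP: xb => _ ->; rewrite andbT; apply/eqP => xE.
  move: x2; rewrite xE expr1n => /eqP; rewrite -[X in _ == X]addr0.
  by rewrite (inj_eq (addrI _)) sqrf_eq0 gt_eqF.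
have a1 : 0 < acos x by apply: acos_gt0; rewrite x1 andbT; case/andP: xb.
exists (- acos x + 2 * pi); first by lra.
by rewrite circD circ_2pi mulr1 circE cosN sinN opprK cx sq gtr0_norm.
Qed.

(** If cos w = 1, then sin(w/2) = 0, whereas the sine is positive on ]0, pi[. *)
Lemma circ_inj (t u : R) : `|t - u| < 2 * pi -> circ t = circ u -> t = u.
Proof.
wlog ut : t u / u <= t.
  move=> h; have [ut|tu] := leP u t; first exact: h.
  by rewrite distrC => h1 /esym h2; apply/esym/h => //; exact: ltW.
rewrite ger0_norm ?subr_ge0// => tu2 e.
set w := t - u in tu2 *; have w0 : 0 <= w by rewrite subr_ge0.
have cw : circ w = 1.
  apply: (@mulIf _ (circ u)); first exact: expC_neq0.
  by rewrite -circD subrK mul1r.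
have cosw : cos w = 1 by move: cw; rewrite circE => -[].
have : sin (w / 2) = 0.
  have e2 : (w / 2) *+ 2 = w by rewrite mulr2n; field.
  have := cos_mulr2n (w / 2); rewrite e2 cosw cos2sin2 mulr2n => h.
  by apply/eqP; rewrite -sqrf_eq0; apply/eqP; lra.
move=> s0; apply/eqP; rewrite -subr_eq0 -/w; apply/negPn/negP => wn0.
have : 0 < sin (w / 2).
  have w1 : 0 < w by rewrite lt_neqAle eq_sym wn0 w0.
  by apply: sin_gt0_pi; apply/andP; split; lra.
by rewrite s0 ltxx.
Qed.

End FourierRepresentation.

(** * Splitting the circle into arcs and a compact remainder *)

Section Arcs.
Context {R : realType}.
Implicit Types (f : R -> R[i]).

Lemma intC_arcs (I : eqType) (A : I -> set R) (E : set R) f (s : seq I) :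
  measurable E -> (forall i, measurable (A i)) -> (forall i, A i `<=` E) ->
  (forall i j t, A i t -> A j t -> i = j) -> intgC E f -> uniq s ->
  exists D : set R, [/\ measurable D,
    forall t, D t <-> E t /\ forall i, i \in s -> ~ A i t &
    intC E f = \sum_(i <- s) intC (A i) f + intC D f].
Proof.
move=> mE mA AE dis fE; elim: s => [_|i s ih /= /andP[is_ us]].
  exists E; split=> //; first by move=> t; split=> [Et|[]].
  by rewrite big_nil add0r.
have [D [mD DE eD]] := ih us.
exists (D `\` A i); split.
- exact: measurableD.
- move=> t; split.
    move=> [/DE[Et h] nA]; split=> // j; rewrite inE => /predU1P[-> //|]; exact: h.
  move=> [Et h]; split; last by apply: h; rewrite mem_head.
  by apply/DE; split=> // j js; apply: h; rewrite inE js orbT.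
- have AD : A i `<=` D.
    move=> t At; apply/DE; split; first exact: AE At.
    by move=> j js Aj; move: is_; rewrite (dis _ _ _ At Aj) js.
  have fD : intgC D f.
    by apply: intgC_sub fE => // t /DE[].
  by rewrite big_cons eD (intC_setD (mA i) mD AD fD) addrCA addrA.
Qed.

Lemma normc_intC_sub (D : set R) (a b M : R) f : measurable D -> a <= b ->
  D `<=` `[a, b] -> intgC D f -> 0 <= M -> (forall t, D t -> N (f t) <= M) ->
  N (intC D f) <= 2 * M * (b - a).
Proof.
move=> mD ab Dab fD M0 fM.
have iM : leb.-integrable `[a, b] (EFin \o (cst M : R -> R)).
  apply: continuous_compact_integrable; first exact: segment_compact.
  by apply: continuous_subspaceT => t; exact: cst_continuous.
have mab : measurable (`[a, b]%classic : set R) by exact: measurable_itv.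
have iMD : leb.-integrable D (EFin \o (cst M : R -> R)) by exact: integrableS iM.
rewrite (le_trans (normc_intC mD fD iMD fM))// -mulrA ler_pM2l//.
have -> : M * (b - a) = \int[leb]_(t in `[a, b]) M.
  rewrite Rintegral_cst//= lebesgue_measure_itv /= lte_fin.
  case: ifPn => [|]; first by rewrite -EFinB.
  rewrite -leNgt => ba; have -> : a = b by apply: le_anti; rewrite ab ba.
  by rewrite subrr !mulr0.
rewrite Rintegral_mkcond [leRHS]Rintegral_mkcond; apply: le_Rintegral => //.
- by rewrite -restrict_EFin; apply/integrable_restrict => //; rewrite setTI.
- by rewrite -restrict_EFin; apply/integrable_restrict => //; rewrite setTI.
- move=> t _; rewrite /patch; case: ifPn => [tD|_]; case: ifPn => //.
  by move=> /negP; case; rewrite inE; apply: Dab; rewrite -inE.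
Qed.

Lemma intC_affine f (t0 h A : R) : contC f -> 0 < h -> 0 < A ->
  intC `[t0 - h * A, t0 + h * A] f =
  h%:C * intC `[- A, A] (fun u => f (t0 + h * u)).
Proof.
move=> [c1 c2] h0 A0.
have AA : - A < A by rewrite (lt_trans _ A0)// oppr_lt0.
pose F (u : R) := t0 + h * u.
have dF (u : R) : is_derive u 1 F h.
  have e1 := is_derive_mul (is_derive_cst h u (1 : R)) (is_derive_id u (1 : R)).
  have e2 := is_derive_add (is_derive_cst t0 u (1 : R)) e1.
  apply: (is_derive_val e2).
  by rewrite /cst /= mulr1 mulr0 addr0 add0r.
have DF : F^`()%classic = cst h.
  by apply/funext => u; rewrite derive1E; case: (dF u).
have cF : continuous F.
  by move=> u; apply/differentiable_continuous/derivable1_diffP; case: (dF u).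
have aux (g : R -> R) : continuous g ->
    \int[leb]_(t in `[t0 - h * A, t0 + h * A]) g t =
    h * \int[leb]_(u in `[- A, A]) g (F u).
  move=> cg; have cgF : continuous (g \o F).
    by move=> u; apply: continuous_comp; [exact: cF|exact: cg].
  rewrite -RintegralZl//; last first.
    apply: continuous_compact_integrable; first exact: segment_compact.
    exact: continuous_subspaceT.
  rewrite /Rintegral.
  have -> : t0 - h * A = F (- A) by rewrite /F mulrN.
  rewrite -/(F A) (@integration_by_substitution_increasing _ F g (- A) A (ltW AA)).
  - by congr fine; apply: eq_integral => u _ /=; rewrite DF mulrC.
  - by move=> u v _ _ uv; rewrite /F ltrD2l ltr_pM2l.
  - by rewrite DF => u _; exact: cst_continuous.
  - by rewrite DF; exact: is_cvg_cst.
  - by rewrite DF; exact: is_cvg_cst.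
  - split=> [u _||]; first by case: (dF u).
      by apply: cvg_at_right_filter; exact: cF.
    by apply: cvg_at_left_filter; exact: cF.
  - exact: continuous_subspaceT.
apply: complex_eq; rewrite ?ReM ?ImM /= mul0r ?subr0 ?addr0.
  exact: (aux _ c1).
exact: (aux _ c2).
Qed.

(** The set of admissible t is compact, so F attains its maximum there. *)
Lemma circle_gap (I : finType) (th : I -> R) (F : R -> R) (a b rho : R) :
  continuous F -> (forall t, a <= t <= b -> (forall i, rho <= `|t - th i|) -> F t <
    1) ->
  exists2 q : R, 0 < q < 1 & forall t, a <= t <= b ->
    (forall i, rho <= `|t - th i|) -> F t <= q.
Proof.
move=> cF F1.
pose A : set R := `[a, b] `&` \bigcap_(i in [set: I]) [set t | rho <= `|t - th i|].
have AP t : A t <-> a <= t <= b /\ forall i, rho <= `|t - th i|.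
  rewrite /A /=; rewrite in_itv /=; split=> [[ab h]|[ab h]].
    by split=> // i; exact: (h i).
  by split=> // i _; exact: h.
have cA : compact A.
  apply: (@subclosed_compact _ _ `[a, b]%classic); last by move=> t [].
    apply: closedI; first exact: itv_closed.
    apply: closed_bigI => i _.
    apply: (@preimage_closed _ _ (fun t => `|t - th i|) [set x | rho <= x]).
      move=> t _; apply: (@continuous_comp _ _ _ (fun t => t - th i) (@Num.norm R R)).
        by apply: continuousB; [exact: id|exact: cst_continuous].
      exact: norm_continuous.
    exact: closed_ge.
  exact: segment_compact.
have [A0|A0] := pselect (A !=set0); last first.
  exists 2^-1; first by rewrite invr_gt0 ltr0n /= invf_lt1// ltr1n.
  by move=> t tab ht; case: A0; exists t; apply/AP.
have [c cA' cmax] := compact_EVT_max A0 cA (continuous_subspaceT cF).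
have Fc : F c < 1.
  by move: cA'; rewrite inE => /AP[cab hc]; exact: F1.
(* The maximum with 1/2 keeps q positive, since ln q is needed later. *)
exists (Num.max 2^-1 (F c)).
  rewrite lt_max gt_max invr_gt0 ltr0n /= Fc andbT invf_lt1// ltr1n.
  by [].
by move=> t tab ht; rewrite le_max cmax ?orbT// inE; apply/AP.
Qed.

End Arcs.

(** * Generalized Gaussian bounds *)

Section LocalPart.
Context {R : realType}.
Implicit Types (beta : R[i]) (mu n s : nat) (h y X : R).

Lemma scale_le1 h n d : (0 < d)%N -> (0 < n)%N -> 0 < h -> h ^+ d * n%:R = 1 -> h <= 1.
Proof.
move=> d0 n0 h0 hn; rewrite leNgt; apply/negP => hgt.
have hd : 1 < h ^+ d by rewrite exprn_egt1// -lt0n.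
have : 1 < h ^+ d * n%:R.
  by rewrite (lt_le_trans hd)// ler_peMr ?ler1n// ltW// (lt_trans ltr01).
by rewrite hn ltxx.
Qed.

(** As h <= 1, h n >= h^d n = 1; hence h^m n^m >= 1, and n^m is absorbed by the exponential. *)
Lemma expRN_nat_le (lam : R) m d : 0 < lam -> (0 < d)%N ->
  exists2 K : R, 0 <= K & forall n h, (0 < n)%N -> 0 < h -> h ^+ d * n%:R = 1 ->
    expR (- lam * n%:R) <= K * h ^+ m.
Proof.
move=> lam0 d0; have [K K0 hK] := @expr_expR_bound R lam m 1 lam0 isT.
exists K => // n h n0 h0 hn; have h1 := scale_le1 d0 n0 h0 hn.
have := hK n%:R (ler0n _ _); rewrite expr1 => hKn.
have one : 1 <= h ^+ m * n%:R ^+ m.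
  rewrite -exprMn exprn_ege1// -[leLHS]hn ler_wpM2r//.
  by rewrite -(prednK d0) exprS ler_piMr ?(ltW h0)// exprn_ile1// ltW.
rewrite mulNr expRN -[leLHS]mul1r ler_pdivrMr ?expR_gt0//.
rewrite (le_trans one)// [K * _]mulrC -mulrA ler_wpM2l// exprn_ge0// ltW//.
Qed.

(** One half of lam n yields the power of h, the other the decay in y, because y^d = (h y)^d n <=
    B^d n. *)
Lemma expRN_nat_absorb (lam B : R) m d : 0 < lam -> (0 < d)%N -> 0 < B ->
  exists c K : R, [/\ 0 < c, 0 <= K & forall n h y, (0 < n)%N -> 0 < h ->
    h ^+ d * n%:R = 1 -> 0 <= y -> h * y <= B ->
    expR (- lam * n%:R) <= K * h ^+ m * expR (- c * y ^+ d)].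
Proof.
move=> lam0 d0 B0; have l20 : 0 < lam / 2 by rewrite divr_gt0.
have [K K0 hK] := @expRN_nat_le _ m d l20 d0.
have Bd : 0 < B ^+ d by rewrite exprn_gt0.
exists (lam / 2 / B ^+ d), K; split=> //; first by rewrite divr_gt0.
move=> n h y n0 h0 hn y0 hy.
have -> : - lam * n%:R = - (lam / 2) * n%:R + - (lam / 2) * n%:R by field.
rewrite expRD; apply: ler_pM; rewrite ?expR_ge0//; first exact: hK.
rewrite ler_expR !mulNr lerN2 -(mulrA (lam / 2)) ler_pM2l// ler_pdivrMl//.
have -> : y ^+ d = (h * y) ^+ d * n%:R by rewrite exprMn mulrAC hn mul1r.
rewrite ler_wpM2r// lerXn2r ?nnegrE ?(ltW B0)//.
by rewrite mulr_ge0// ltW.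
Qed.

(** The contour shift is applied to g^n minus its expansion, which is entire and O(h^s); the
    integrals of the expansion are then extended to the whole line. [rho] is quantified after P so
    that all arcs can be shrunk together. *)
Lemma local_part beta mu s (g : R[i] -> R[i]) (M delta : R) :
  (0 < mu)%N -> 0 < Re beta -> entire g -> 0 < delta ->
  (forall x : R, `|x| < delta -> N (g x%:C - 1) <= M * `|x| ^+ (2 * mu).+1) ->
  exists (P : nat -> {poly R[i]}) (rho0 : R), 0 < rho0 /\
  forall rho B : R, 0 < rho -> rho <= rho0 -> 0 < B ->
  exists c C : R, [/\ 0 < c, 0 <= C & forall n h y X,
    (0 < n)%N -> 0 < h -> h ^+ (2 * mu) * n%:R = 1 -> 0 <= y ->
    `|X| = y ^+ (2 * mu).-1 -> h * y <= B ->
    N (intC `[- (rho / h), rho / h]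
         (fun u => gkern X mu beta u%:C * g (h%:C * u%:C) ^+ n) -
       \sum_(j < s) h%:C ^+ j *
         intC setT (fun u => (P j).[u%:C] * gkern X mu beta u%:C)) <=
      C * h ^+ s * expR (- c * y ^+ (2 * mu))].
Proof.
move=> mu0 b0 hg delta0 gM; have d0 : (0 < 2 * mu)%N by rewrite muln_gt0.
have [P hP] := local_expansion s mu0 hg delta0 gM.
have [eps eps0 contour] := gauss_contour mu0 b0.
have [r [C1 [r0 C10 expan]]] := hP eps eps0.
(* On the box |u|, |eta| <= rho / h one has h |v| <= 2 rho, which must not exceed the radius r of
   the expansion. *)
exists P, (r / 2); split=> [|rho B rho0 rho_r B0]; first by rewrite divr_gt0.
(* With A = rho / h, the hypothesis h y <= B reads y <= (B / rho) A. *)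
have Brho : 0 < B / rho by rewrite divr_gt0.
have [c2 [C2 [c20 C20 hmain]]] := contour (B / rho) Brho.
have /choice[tl htl] : forall j : nat, exists t : R * R, [/\ 0 < t.1, 0 <= t.2 &
  forall X A : R, 0 <= A ->
    N (intC setT (fun u => (P j).[u%:C] * gkern X mu beta u%:C) -
       intC `[- A, A] (fun u => (P j).[u%:C] * gkern X mu beta u%:C)) <=
    t.2 * expR (- t.1 * A ^+ (2 * mu))].
  by move=> j; have [c [C h]] := poly_gkern_tail (P j) mu0 b0; exists (c, C).
have /choice[ab hab] : forall j : nat, exists t : R * R, [/\ 0 < t.1, 0 <= t.2 &
  forall n h y, (0 < n)%N -> 0 < h ->
    h ^+ (2 * mu) * n%:R = 1 -> 0 <= y -> h * y <= B ->
    expR (- ((tl j).1 * rho ^+ (2 * mu)) * n%:R) <=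
      t.2 * h ^+ s * expR (- t.1 * y ^+ (2 * mu))].
  move=> j; have t0 : 0 < (tl j).1 * rho ^+ (2 * mu).
    by case: (htl j) => *; rewrite mulr_gt0// exprn_gt0.
  by have [c [C h]] := @expRN_nat_absorb _ B s _ t0 d0 B0; exists (c, C).
pose c := \big[Num.min/c2]_(j < s) (ab j).1.
have c0 : 0 < c by apply: lt_bigmin => // j _; case: (hab j).
pose C := C2 * C1 + \sum_(j < s) (tl j).2 * (ab j).2.
have Cs0 : 0 <= \sum_(j < s) (tl j).2 * (ab j).2.
  by apply: sumr_ge0 => j _; case: (hab j) => _ ? _; case: (htl j) => _ ? _; exact:
    mulr_ge0.
exists c, C; split=> //; first by rewrite addr_ge0// mulr_ge0.
move=> n h y X n0 h0 hn y0 XE hy.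
have h1 := scale_le1 d0 n0 h0 hn.
set A := rho / h; have A0 : 0 < A by rewrite divr_gt0.
have hA : h * A = rho by rewrite mulrCA divff ?mulr1// gt_eqF.
have yd0 : 0 <= y ^+ (2 * mu) by exact: exprn_ge0.
have hs0 : 0 <= h ^+ s by rewrite exprn_ge0// ltW.
have expc (t : R) : c <= t -> expR (- t * y ^+ (2 * mu)) <= expR (- c * y ^+ (2 * mu)).
  by move=> ct; rewrite ler_expR !mulNr lerN2 ler_wpM2r.
pose T (v : R[i]) := \sum_(j < s) h%:C ^+ j * (P j).[v].
have aT : entire T.
  by apply: entire_sum => j; apply: entireM; [exact: entire_cst|exact: entire_horner].
pose f (v : R[i]) := g (h%:C * v) ^+ n - T v.
have af : entire f by apply: entireB => //; apply: entireX; exact: entire_scale.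
have yA : y <= B / rho * A.
  by rewrite /A mulrA divfK ?gt_eqF// ler_pdivlMr// mulrC.
have fD (u eta : R) : `|u| <= A -> `|eta| <= A ->
    N (f (u +i* eta)) <= C1 * h ^+ s * expR (eps * N (u +i* eta) ^+ (2 * mu)).
  move=> uA eA; apply: expan => //.
  rewrite (@le_trans _ _ (h * (A + A)))//.
    by rewrite ler_pM2l// (le_trans (normc_leReIm _))// lerD.
  by rewrite mulrDr hA; lra.
have D0 : 0 <= C1 * h ^+ s by rewrite mulr_ge0.
have main := hmain A y X _ f A0 y0 XE yA D0 af fD.
have ip j : intgC `[- A, A] (fun u => (P j).[u%:C] * gkern X mu beta u%:C).
  apply: contC_intgC; apply: contCM; last exact: contC_gkern.
  by apply: contC_horner; exact: contC_id.
have ig : intgC `[- A, A] (fun u => gkern X mu beta u%:C * f u%:C).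
  apply: contC_intgC; apply: contCM; first exact: contC_gkern.
  by case: af => /(_ 0).
have split0 : intC `[- A, A] (fun u => gkern X mu beta u%:C * g (h%:C * u%:C) ^+ n) =
    intC `[- A, A] (fun u => gkern X mu beta u%:C * f u%:C) +
    \sum_(j < s) h%:C ^+ j * intC `[- A, A] (fun u => (P j).[u%:C] * gkern X mu beta
      u%:C).
  rewrite (eq_bigr (fun j : 'I_s => intC `[- A, A]
    (fun u => h%:C ^+ j * ((P j).[u%:C] * gkern X mu beta u%:C)))); last first.
    by move=> j _; rewrite intCZ.
  rewrite -intC_sum//; last by move=> j; exact: intgCZ.
  rewrite -intCD//; last by apply: intgC_sum => // j; exact: intgCZ.
  apply: eq_intC => u _; rewrite /f /T mulrBr mulr_sumr -addrA; apply/esym.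
  rewrite -[RHS]addr0; congr (_ + _); rewrite addrC; apply/eqP.
  by rewrite subr_eq0; apply/eqP; apply: eq_bigr => j _; ring.
rewrite split0 -addrA -sumrB (le_trans (normcD _ _))// mulrDl mulrDl lerD//.
  rewrite (le_trans main)//.
  have -> : C2 * (C1 * h ^+ s) = C2 * C1 * h ^+ s by ring.
  rewrite ler_wpM2l ?mulr_ge0// expc//.
  exact: bigmin_le_id.
rewrite (le_trans (normc_sum _ _ _))// !mulr_suml; apply: ler_sum => j _.
rewrite -mulrBr normcM normcX normc_real gtr0_norm//.
have [a1 a2 a3] := htl j; have [b1 b2 b3] := hab j.
have hj1 : h ^+ j <= 1 by rewrite exprn_ile1// ltW.
have hj0 : 0 <= h ^+ j by rewrite exprn_ge0// ltW.
rewrite (@le_trans _ _ ((tl j).2 * expR (- (tl j).1 * A ^+ (2 * mu))))//.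
  rewrite -[leRHS]mul1r; apply: ler_pM; rewrite ?normc_ge0// normcB.
  exact: a3 (ltW A0).
(* Since A^(2 mu) = rho^(2 mu) n, the tails are exponentially small in n. *)
have -> : - (tl j).1 * A ^+ (2 * mu) = - ((tl j).1 * rho ^+ (2 * mu)) * n%:R.
  have -> : A ^+ (2 * mu) = rho ^+ (2 * mu) * n%:R.
    rewrite -hA; have -> : (h * A) ^+ (2 * mu) = h ^+ (2 * mu) * A ^+ (2 * mu).
      exact: exprMn.
    by rewrite mulrAC hn mul1r.
  by ring.
rewrite -!mulrA ler_wpM2l// mulrA (le_trans (b3 n h y n0 h0 hn y0 hy))//.
rewrite ler_wpM2l ?mulr_ge0// expc//.
exact: bigmin_le_cond.
Qed.

(** Here y^(2 mu) >= n, so half of the decay in y is exponentially small in n and provides h^s. *)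
Lemma local_far beta mu s (P : nat -> {poly R[i]}) : (0 < mu)%N -> 0 < Re beta ->
  exists c C : R, [/\ 0 < c, 0 <= C & forall n h y X,
    (0 < n)%N -> 0 < h -> h ^+ (2 * mu) * n%:R = 1 -> 0 <= y ->
    `|X| = y ^+ (2 * mu).-1 -> 1 <= h * y ->
    N (\sum_(j < s) h%:C ^+ j *
         intC setT (fun u => (P j).[u%:C] * gkern X mu beta u%:C)) <=
      C * h ^+ s * expR (- c * y ^+ (2 * mu))].
Proof.
move=> mu0 b0; have d0 : (0 < 2 * mu)%N by rewrite muln_gt0.
have /choice[tl htl] : forall j : nat, exists t : R * R, [/\ 0 < t.1, 0 <= t.2 &
  forall X y : R,
    0 <= y -> `|X| = y ^+ (2 * mu).-1 ->
    N (intC setT (fun u => (P j).[u%:C] * gkern X mu beta u%:C)) <=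
    t.2 * expR (- t.1 * y ^+ (2 * mu))].
  by move=> j; have [c [C h]] := poly_gkern_decay (P j) mu0 b0; exists (c, C).
pose c := \big[Num.min/1]_(j < s) (tl j).1.
have c0 : 0 < c by apply: lt_bigmin => // j _; case: (htl j).
have c20 : 0 < c / 2 by rewrite divr_gt0.
have [K K0 hK] := @expRN_nat_le _ s _ c20 d0.
have Cs0 : 0 <= \sum_(j < s) (tl j).2.
  by apply: sumr_ge0 => j _; case: (htl j).
exists (c / 2), ((\sum_(j < s) (tl j).2) * K); split=> //; first exact: mulr_ge0.
move=> n h y X n0 h0 hn y0 XE hy; have h1 := scale_le1 d0 n0 h0 hn.
have yd0 : 0 <= y ^+ (2 * mu) by exact: exprn_ge0.
have ny : n%:R <= y ^+ (2 * mu).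
  have -> : y ^+ (2 * mu) = (h * y) ^+ (2 * mu) * n%:R by rewrite exprMn mulrAC hn
    mul1r.
  by rewrite ler_peMl// exprn_ege1.
have E : expR (- c * y ^+ (2 * mu)) <= K * h ^+ s * expR (- (c / 2) * y ^+ (2 * mu)).
  have -> : - c * y ^+ (2 * mu) = - (c / 2) * y ^+ (2 * mu) + - (c / 2) * y ^+ (2 * mu).
    by field.
  rewrite expRD ler_wpM2r ?expR_ge0// (le_trans _ (hK n h n0 h0 hn))//.
  by rewrite ler_expR !mulNr lerN2 ler_pM2l.
rewrite (le_trans (normc_sum _ _ _))// -!mulrA mulr_suml; apply: ler_sum => j _.
have [a1 a2 a3] := htl j.
rewrite normcM normcX normc_real gtr0_norm//.
have hj1 : h ^+ j <= 1 by rewrite exprn_ile1// ltW.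
have hj0 : 0 <= h ^+ j by rewrite exprn_ge0// ltW.
rewrite (@le_trans _ _ ((tl j).2 * expR (- c * y ^+ (2 * mu))))//.
  rewrite -[leRHS]mul1r; apply: ler_pM; rewrite ?normc_ge0//.
  rewrite (le_trans (a3 X y y0 XE))// ler_wpM2l// ler_expR !mulNr lerN2 ler_wpM2r//.
  exact: bigmin_le_cond.
by rewrite ler_wpM2l// mulrA.
Qed.

End LocalPart.

(** * From the symbol near one point to the kernel *)

Section Assembly.
Context {R : realType}.
Implicit Types (a : int -> R[i]) (kappa z beta : R[i]) (alpha : R) (mu n s : nat).

(** g is the symbol divided by its leading exponential: a finite sum of exponentials times an
    exponential, hence entire. On the real axis it equals exp(r) with r = O(|x|^(2 mu + 1)). *)
Lemma symbol_local a (S : seq int) kappa z alpha beta mu (M : R) :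
  (forall x, symbol a x = \sum_(l <- S) a l * x ^ l) ->
  (0 < mu)%N -> kappa != 0 -> z != 0 ->
  (\forall xi \near (0 : R), exists2 r : R[i],
      `|r| <= (M * `|xi| ^+ (2 * mu).+1)%:C &
      symbol a (kappa * expC ('i * xi%:C)) =
        z * expC (- 'i * (alpha * xi)%:C - beta * (xi ^+ (2 * mu))%:C + r)) ->
  exists (g : R[i] -> R[i]) (M' delta : R), [/\ entire g, 0 < delta,
    forall x : R, `|x| < delta -> N (g x%:C - 1) <= M' * `|x| ^+ (2 * mu).+1 &
    forall x : R, symbol a (kappa * circ x) = z * gkern alpha mu beta x%:C * g x%:C].
Proof.
move=> hF mu0 k0 z0 near0; have d0 : (0 < 2 * mu)%N by rewrite muln_gt0.
pose S0 (v : R[i]) := \sum_(l <- S) a l * kappa ^ l * expC ((- 'i * (l%:~R)%:C) * v).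
pose g v := z^-1 * S0 v * (expC ((- 'i * alpha%:C) * v) * expC (beta * v ^+ (2 * mu))).
have lin (c : R[i]) : entire (fun v => expC (c * v)).
  by apply: entire_eq (entire_exp c 0) => v; rewrite expr1.
have ag : entire g.
  apply: entireM; first apply: entireM; first exact: entire_cst.
    by apply: entire_sum => l; apply: entireM; [exact: entire_cst|exact: lin].
  apply: entireM; first exact: lin.
  by apply: entire_eq (entire_exp beta (2 * mu).-1) => v; rewrite prednK.
have factor (x : R) : symbol a (kappa * circ x) = z * gkern alpha mu beta x%:C * g x%:C.
  have -> : symbol a (kappa * circ x) = S0 x%:C.
    rewrite hF; apply: eq_bigr => l _.
    by rewrite expfzMl -mulrA circ_expz.
  rewrite /g /gkern.
  have e1 : expC ('i * alpha%:C * x%:C) * expC ((- 'i * alpha%:C) * x%:C) = 1.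
    by rewrite -expCD !mulNr subrr expC0.
  have e2 : expC (- beta * x%:C ^+ (2 * mu)) * expC (beta * x%:C ^+ (2 * mu)) = 1.
    by rewrite -expCD mulNr addNr expC0.
  move: e1 e2; set A := expC _; set B := expC _; set C := expC _; set D := expC _.
  move=> e1 e2; have -> : z * (A * C) * (z^-1 * S0 x%:C * (B * D)) =
    (z * z^-1) * (A * B) * (C * D) * S0 x%:C by ring.
  by rewrite e1 e2 divff// !mul1r.
case/nbhs_ballP: near0 => delta /= delta0 hd.
(* For |x| <= 1 one has |r| <= |M|, which makes exp |r| a constant; M itself may be negative. *)
pose del := Num.min delta 1.
have del0 : 0 < del by rewrite lt_min delta0 ltr01.
exists g, (expR `|M| * (2 * `|M|)), del; split=> // x.
rewrite lt_min => /andP[xd x1].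
(* xi = -x, because [circ] runs clockwise. *)
have [|r rM rE] := hd (- x); first by rewrite /ball /= sub0r opprK.
have {}rM : N r <= `|M| * `|x| ^+ (2 * mu).+1.
  rewrite normcE lecR normrN in rM; rewrite (le_trans rM)// ler_wpM2r ?exprn_ge0//.
  exact: ler_norm.
have gE : g x%:C = expC r.
  have := factor x.
  have -> : kappa * circ x = kappa * expC ('i * (- x)%:C).
    by rewrite /circ rmorphN mulNr mulrN.
  rewrite rE => e; have zk : z * gkern alpha mu beta x%:C != 0.
    by rewrite mulf_neq0// /gkern mulf_neq0// expC_neq0.
  apply: (mulfI zk); rewrite -e expCD mulrA; congr (_ * _ * _).
  rewrite gkern_real expCD; congr (expC _ * expC _).
    by rewrite mulrN rmorphN mulrN mulNr opprK.
  by rewrite mulNr exprM sqrrN -exprM.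
have := @expC_taylorP R r 1 1; rewrite ler01 lexx => /(_ isT).
rewrite rmorph1 mul1r.
have -> : (expC_taylor 1).[r] = 1 :> R[i].
  by rewrite horner_poly big_ord1 expr0 mulr1 invr1.
rewrite -gE !expr1 mulr1 divr1 => h; rewrite (le_trans h)// -mulrA.
have x1' := ltW x1.
apply: ler_pM; rewrite ?expR_ge0 ?mulr_ge0 ?normc_ge0//.
  rewrite ler_expR (le_trans rM)// ler_piMr// exprn_ile1//.
by rewrite -mulrA ler_pM2l.
Qed.

(** The relation h^(2 mu) n = 1 turns the n-th power of the kernel at h u into the kernel at u; the
    factor of exponent j joins the linear phase. *)
Lemma arc_integrand a kappa z alpha beta mu (g : R[i] -> R[i]) (t0 h : R) n (j : int) :
  (forall x : R, symbol a (kappa * circ x) = z * gkern alpha mu beta x%:C * g x%:C) ->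
  kappa = circ t0 -> h ^+ (2 * mu) * n%:R = 1 ->
  forall u : R, symbol a (circ (t0 + h * u)) ^+ n * circ (t0 + h * u) ^ j =
    z ^+ n * kappa ^ j *
      (gkern ((n%:R * alpha - j%:~R) * h) mu beta u%:C * g (h%:C * u%:C) ^+ n).
Proof.
move=> hs kE hn u; rewrite circD -kE hs expfzMl [(z * _ * _) ^+ n]exprMn [(z * _) ^+
  n]exprMn -rmorphM.
have -> : gkern ((n%:R * alpha - j%:~R) * h) mu beta u%:C =
    gkern alpha mu beta (h * u)%:C ^+ n * circ (h * u) ^ j.
  rewrite /gkern exprMn -!expCXn circ_expz [RHS]mulrAC -[in RHS]expCD; congr (expC _
    * expC _).
    rewrite -[X in _ = X + _]mulr_natr !rmorphM rmorphB rmorphM /= rmorph_nat.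
    by ring.
  rewrite -[RHS]mulr_natr rmorphM /= exprMn.
  have hnC : h%:C ^+ (2 * mu) * n%:R = 1.
    by rewrite -rmorphXn -(rmorph_nat (real_complex R)) -rmorphM hn rmorph1.
  have -> : - beta * (h%:C ^+ (2 * mu) * u%:C ^+ (2 * mu)) * n%:R =
    - beta * u%:C ^+ (2 * mu) * (h%:C ^+ (2 * mu) * n%:R) by ring.
  by rewrite hnC mulr1.
ring.
Qed.

(* u^q e^(iXu) is (-i)^q times the q-th X-derivative of e^(iXu), so that a
   polynomial factor p(u) under the integral becomes p(-i d/dX). *)
Definition hermite_poly (p : {poly R[i]}) : {poly {poly R[i]}} :=
  map_poly polyC (p \Po ('i^-1 *: 'X)).

(** One has p(u) = q(i u), and powers of i u under the integral are derivatives of [Hgauss]. The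
    coefficients are constant in X: the resulting operators involve d/dx only. *)
Lemma polyop_hermite (p : {poly R[i]}) mu beta (X : R) : (0 < mu)%N -> 0 < Re beta ->
  polyop (hermite_poly p) (Hgauss mu beta) X =
  ((2 * pi)^-1)%:C * intC setT (fun u => p.[u%:C] * gkern X mu beta u%:C).
Proof.
move=> mu0 b0; set q := p \Po ('i^-1 *: 'X).
have i0 : ('i : R[i]) != 0 by rewrite eq_complex /= oner_eq0 andbF.
have qE v : p.[v] = q.['i * v].
  by rewrite horner_comp hornerZ hornerX mulKf.
have sz : size (hermite_poly p) = size q.
  by rewrite /hermite_poly size_map_inj_poly//; exact: polyC_inj.
have ip k : intgC setT (fun u => q`_k * (('i * u%:C) ^+ k * gkern X mu beta u%:C)).
  apply: intgCZ => //.
  apply: eq_intgC (poly_gkern_intg (('i *: 'X) ^+ k) X mu0 b0) => // u _.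
  by rewrite horner_exp hornerZ hornerX.
have ip' k : intgC setT (fun u => ('i * u%:C) ^+ k * gkern X mu beta u%:C).
  apply: eq_intgC (poly_gkern_intg (('i *: 'X) ^+ k) X mu0 b0) => // u _.
  by rewrite horner_exp hornerZ hornerX.
rewrite /polyop sz.
rewrite (eq_bigr (fun k : 'I_(size q) => ((2 * pi)^-1)%:C *
  intC setT (fun u => q`_k * (('i * u%:C) ^+ k * gkern X mu beta u%:C)))); last first.
  move=> k _; rewrite derivCn_Hgauss// /hermint intCZ//.
  by rewrite /hermite_poly -/q coef_map /= hornerC mulrCA.
rewrite -mulr_sumr -intC_sum//; congr (_ * _); apply: eq_intC => u _.
rewrite qE horner_coef mulr_suml; apply: eq_bigr => k _.
by rewrite mulrA.
Qed.

Lemma scaleP n d : (0 < n)%N -> (0 < d)%N ->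
  let h : R := (n%:R `^ d%:R^-1)^-1 in
  [/\ 0 < h, h ^+ d * n%:R = 1 &
    forall m : nat, n%:R `^ (m%:R / d%:R) = (h ^+ m)^-1].
Proof.
move=> n0 d0 h; have nR : 0 < n%:R :> R by rewrite ltr0n.
have p0 : 0 < (n%:R : R) `^ d%:R^-1 by exact: powR_gt0.
have pE m : n%:R `^ (m%:R / d%:R) = ((n%:R : R) `^ d%:R^-1) ^+ m.
  by rewrite mulrC powRrM powR_mulrn// ltW.
split; first by rewrite invr_gt0.
  rewrite exprVn -pE divff; last by rewrite pnatr_eq0 -lt0n.
  by rewrite powRr1 ?(ltW nR)// mulVf// gt_eqF.
by move=> m; rewrite pE exprVn invrK.
Qed.

Lemma rootP (x : R) d : 0 <= x -> (1 < d)%N ->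
  let y := x `^ (d.-1%:R)^-1 in
  [/\ 0 <= y, x = y ^+ d.-1 & x `^ (d%:R / (d%:R - 1)) = y ^+ d].
Proof.
move=> x0 d1 y; have y0 : 0 <= y by exact: powR_ge0.
have dm : (0 < d.-1)%N by rewrite -ltnS prednK// ltnW.
have dR : d%:R - 1 = d.-1%:R :> R.
  by rewrite -[in LHS](prednK (ltnW d1)) -natr1 addrK.
split=> //.
  rewrite -powR_mulrn// -powRrM mulVf ?powRr1// pnatr_eq0 -lt0n//.
by rewrite dR mulrC powRrM powR_mulrn.
Qed.

End Assembly.

(** * The estimate on one arc in the variables n and j *)

Section LocalEstimates.
Context {R : realType}.
Implicit Types (a : int -> R[i]) (kappa z beta : R[i]) (alpha : R) (mu n s : nat).

(* h is the scale n^(-1/(2 mu)), and y = |X|^(1/(2 mu - 1)) turns the fractional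
   powers of the statement into natural powers. *)
Lemma scaling n (j : int) alpha mu (L : nat) : (0 < n)%N -> (0 < mu)%N ->
  `|alpha| + 1 <= L%:R ->
  exists h y : R, [/\ [/\ 0 < h, h ^+ (2 * mu) * n%:R = 1 &
      forall m : nat, n%:R `^ (m%:R / (2 * mu)%:R) = (h ^+ m)^-1],
    [/\ 0 <= y, `|Xvar n j alpha mu| = y ^+ (2 * mu).-1 &
      `|Xvar n j alpha mu| `^ ((2 * mu)%:R / ((2 * mu)%:R - 1)) = y ^+ (2 * mu)],
    Xvar n j alpha mu = (n%:R * alpha - j%:~R) * h,
    (absz j <= L * n)%N -> h * y <= 1 + `|alpha| + L%:R &
    (L * n < absz j)%N -> 1 <= h * y].
Proof.
move=> n0 mu0 aL; set d := (2 * mu)%N; set X := Xvar _ _ _ _.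
have d1 : (1 < d)%N by rewrite /d mul2n -addnn -(prednK mu0) addSn addnS.
have [h0 hn hm] := @scaleP R n d n0 (ltnW d1).
have [y0 XE XE'] := @rootP R `|X| d (normr_ge0 _) d1.
set h := _^-1 in h0 hn hm; set y := _ `^ _ in y0 XE XE'.
have Xh : X = (n%:R * alpha - j%:~R) * h by [].
exists h, y; split=> //.
(* As h^d = 1/n, the right-hand side is |alpha - j/n|, which decides both regimes. *)
all: have hyE : (h * y) ^+ d.-1 = `|n%:R * alpha - j%:~R| * (h ^+ d);
  first by rewrite exprMn -XE Xh normrM (gtr0_norm h0) -[in h ^+ d](prednK (ltnW d1))
    exprS; ring.
all: have hy0 : 0 <= h * y by rewrite mulr_ge0// ltW.
all: have dm : (0 < d.-1)%N by rewrite -ltnS prednK// ltnW.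
all: have nR : 0 < n%:R :> R by rewrite ltr0n.
all: have hd0 : 0 <= h ^+ d by rewrite exprn_ge0// ltW.
all: have jE : `|j%:~R| = (absz j)%:R :> R by rewrite natr_absz intr_norm.
- move=> jL; set B := 1 + _ + _.
  have aB : `|alpha| + L%:R <= B by rewrite /B; lra.
  have B1 : 1 <= B by rewrite /B -addrA lerDl addr_ge0.
  have B0 : 0 <= B by rewrite (le_trans _ B1).
  rewrite -(@ler_pXn2r _ d.-1)// ?nnegrE// hyE.
  rewrite (@le_trans _ _ B)//; last by rewrite ler_eXnr.
  rewrite (le_trans _ aB)//.
  rewrite (@le_trans _ _ ((`|alpha| + L%:R) * n%:R * h ^+ d))//.
    rewrite ler_wpM2r// (le_trans (ler_normB _ _))// mulrDl normrM jE.
    by rewrite (gtr0_norm nR) mulrC lerD2l -natrM ler_nat.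
  by rewrite -mulrA [n%:R * _]mulrC hn mulr1.
- move=> jL; rewrite -(@ler_pXn2r _ d.-1)// ?nnegrE// expr1n hyE -[leLHS]hn mulrC.
  rewrite ler_wpM2r//.
  (* Then |n alpha - j| >= (L - |alpha|) n >= n, which is where the 1 in |alpha| + 1 <= L enters. *)
  have h1 : L%:R * n%:R <= `|j%:~R| :> R by rewrite jE -natrM ler_nat ltnW.
  have h2 := ler_distD (n%:R * alpha) 0 j%:~R.
  rewrite !sub0r !normrN normrM (gtr0_norm nR) in h2.
  have h3 := ler_wpM2r (ltW nR) aL; lra.
Qed.

(** [approx] and [envelope] copy the summands of the theorem literally, so its two sides are
    recovered by conversion. *)
Definition approx (P : nat -> {poly {poly R[i]}}) s kappa z alpha mu beta n (j : int)
  : R[i] :=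
  \sum_(1 <= sigma < s.+1)
    z ^+ n * kappa ^ j / (n%:R `^ (sigma%:R / (2 * mu)%:R))%:C
      * polyop (P sigma) (Hgauss mu beta) (Xvar n j alpha mu).

Definition envelope (C c : R) s alpha mu n (j : int) : R :=
  C / n%:R `^ ((s.+1)%:R / (2 * mu)%:R) *
  expR (- c * `|Xvar n j alpha mu| `^ ((2 * mu)%:R / ((2 * mu)%:R - 1))).

Lemma envelope_mono (C c C' c' : R) s alpha mu n (j : int) :
  0 <= C -> C <= C' -> c' <= c ->
  envelope C c s alpha mu n j <= envelope C' c' s alpha mu n j.
Proof.
move=> C0 CC cc; apply: ler_pM; rewrite ?expR_ge0//.
- by rewrite mulr_ge0// invr_ge0 powR_ge0.
- by rewrite ler_wpM2r// invr_ge0 powR_ge0.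
- by rewrite ler_expR !mulNr lerN2 ler_wpM2r// powR_ge0.
Qed.

Lemma envelope_ge0 (C c : R) s alpha mu n (j : int) : 0 <= C ->
  0 <= envelope C c s alpha mu n j.
Proof. by move=> C0; rewrite mulr_ge0 ?expR_ge0// mulr_ge0// invr_ge0 powR_ge0. Qed.

Lemma pi2V : 0 < (2 * pi)^-1 :> R.
Proof. by rewrite invr_gt0 mulr_gt0// pi_gt0. Qed.

Lemma pi2V_le1 : (2 * pi)^-1 <= 1 :> R.
Proof.
rewrite invf_le1 ?mulr_gt0 ?pi_gt0//; have := @pi_ge2 R; lra.
Qed.

(** The same P must serve both regimes of j, hence the joint statement; the half-width rho comes
    after P because it depends on all arcs. *)
Lemma arc_estimate a (S : seq int) kappa z alpha beta mu s (t0 M : R) (L : nat) :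
  (forall x, symbol a x = \sum_(l <- S) a l * x ^ l) ->
  (0 < mu)%N -> 0 < Re beta -> N kappa = 1 -> N z = 1 -> kappa = circ t0 ->
  `|alpha| + 1 <= L%:R ->
  (\forall xi \near (0 : R), exists2 r : R[i],
      `|r| <= (M * `|xi| ^+ (2 * mu).+1)%:C &
      symbol a (kappa * expC ('i * xi%:C)) =
        z * expC (- 'i * (alpha * xi)%:C - beta * (xi ^+ (2 * mu))%:C + r)) ->
  exists (P : nat -> {poly {poly R[i]}}) (rho0 : R), [/\ 0 < rho0,
    exists c C : R, [/\ 0 < c, 0 <= C & forall n (j : int), (0 < n)%N ->
      (L * n < absz j)%N ->
      N (approx P s kappa z alpha mu beta n j) <= envelope C c s alpha mu n j] &
    forall rho : R, 0 < rho -> rho <= rho0 ->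
    exists c C : R, [/\ 0 < c, 0 <= C & forall n (j : int), (0 < n)%N ->
      (absz j <= L * n)%N ->
      N (((2 * pi)^-1)%:C * intC `[t0 - rho, t0 + rho]
           (fun t => symbol a (circ t) ^+ n * circ t ^ j) -
         approx P s kappa z alpha mu beta n j) <= envelope C c s alpha mu n j]].
Proof.
move=> hF mu0 b0 nk nz kE aL near0.
have k0 : kappa != 0 by rewrite kE expC_neq0.
have z0 : z != 0.
  by apply/eqP => zE; move: nz; rewrite zE normc0 => /eqP; rewrite eq_sym oner_eq0.
have [g [M' [delta [ag delta0 flat fact]]]] := symbol_local hF mu0 k0 z0 near0.
have [p [rho0 [rho00 hp]]] := local_part s mu0 b0 ag delta0 flat.
have [cf [Cf [cf0 Cf0 far]]] := local_far s p mu0 b0.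
(* The substitution t = t0 + h u contributes a further factor h, so the coefficient of h^l belongs
   to sigma = l + 1. *)
pose P sigma := hermite_poly (p sigma.-1).
pose G X j := intC setT (fun u => (p j).[u%:C] * gkern X mu beta u%:C).
have phase n j : N (z ^+ n * kappa ^ j) = 1.
  by rewrite normcM normcX nz expr1n mul1r normc_expz.
have approxE n j h : (forall m : nat, n%:R `^ (m%:R / (2 * mu)%:R) = (h ^+ m)^-1) ->
    approx P s kappa z alpha mu beta n j =
    ((2 * pi)^-1 * h)%:C * (z ^+ n * kappa ^ j) *
      \sum_(l < s) h%:C ^+ l * G (Xvar n j alpha mu) l.
  move=> hm; rewrite /approx big_add1 /= big_mkord mulr_sumr; apply: eq_bigr => l _.
  rewrite hm /P /= polyop_hermite// -/(G _ _) fmorphV invrK rmorphXn exprS rmorphM /=.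
  by ring.
(* The same factor h raises h^s to the h^(s+1) of the envelope; the phase has modulus 1. *)
have final (h C c y : R) n j (I1 : R[i]) : 0 < h -> 0 <= C ->
    (forall m : nat, n%:R `^ (m%:R / (2 * mu)%:R) = (h ^+ m)^-1) ->
    `|Xvar n j alpha mu| `^ ((2 * mu)%:R / ((2 * mu)%:R - 1)) = y ^+ (2 * mu) ->
    N I1 <= C * h ^+ s * expR (- c * y ^+ (2 * mu)) ->
    N (((2 * pi)^-1 * h)%:C * (z ^+ n * kappa ^ j) * I1) <= envelope C c s alpha mu n j.
  move=> h0 C0 hm yE hI; rewrite normcM normcM phase mulr1 normc_real.
  have ph0 : 0 < (2 * pi)^-1 * h :> R by rewrite mulr_gt0// pi2V.
  rewrite (gtr0_norm ph0) /envelope yE hm invrK.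
  rewrite (@le_trans _ _ (h * (C * h ^+ s * expR (- c * y ^+ (2 * mu)))))//.
    apply: ler_pM; rewrite ?normc_ge0 ?(ltW ph0)//.
    by rewrite ler_piMl ?(ltW h0)// pi2V_le1.
  by rewrite exprS le_eqVlt; apply/orP; left; apply/eqP; ring.
exists P, rho0; split=> //.
  exists cf, Cf; split=> // n j n0 jL.
  have [h [y [[h0 hn hm] [y0 XE yE] Xh _ /(_ jL) hy]]] := scaling j n0 mu0 aL.
  rewrite (approxE _ _ h hm); apply: (final h Cf cf y) => //.
  exact: (far n h y _ n0 h0 hn y0 XE hy).
move=> rho rho_gt0 rho_le.
have B0 : 0 < 1 + `|alpha| + L%:R :> R by rewrite ltr_wpDr// ltr_wpDr.
have [c [C [c0 C0 main]]] := hp rho _ rho_gt0 rho_le B0.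
exists c, C; split=> // n j n0 jL.
have [h [y [[h0 hn hm] [y0 XE yE] Xh /(_ jL) hy _]]] := scaling j n0 mu0 aL.
have cint : contC (fun t => symbol a (circ t) ^+ n * circ t ^ j).
  apply: contCM; last exact: contC_circ_expz.
  by apply: contCX; exact: contC_symbol hF.
have rh : rho = h * (rho / h) by rewrite mulrCA divff ?mulr1// gt_eqF.
have rh0 : 0 < rho / h by rewrite divr_gt0.
have intE : intC `[t0 - rho, t0 + rho] (fun t => symbol a (circ t) ^+ n * circ t ^ j) =
    h%:C * (z ^+ n * kappa ^ j) * intC `[- (rho / h), rho / h]
     (fun u => gkern (Xvar n j alpha mu) mu beta u%:C * g (h%:C * u%:C) ^+ n).
  rewrite {1 2}rh intC_affine// -[RHS]mulrA; congr (_ * _); rewrite -intCZ//.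
    apply: eq_intC => u _.
    by rewrite Xh (arc_integrand j fact kE hn).
  apply: contC_intgC; apply: contCM; first exact: contC_gkern.
  apply: contCX; have [/(_ 0) c1 _ _] := entire_scale h ag.
  exact: c1.
rewrite intE (approxE _ _ h hm).
have -> : ((2 * pi)^-1)%:C * (h%:C * (z ^+ n * kappa ^ j) * intC `[- (rho / h), rho / h]
     (fun u => gkern (Xvar n j alpha mu) mu beta u%:C * g (h%:C * u%:C) ^+ n)) =
   ((2 * pi)^-1 * h)%:C * (z ^+ n * kappa ^ j) * intC `[- (rho / h), rho / h]
     (fun u => gkern (Xvar n j alpha mu) mu beta u%:C * g (h%:C * u%:C) ^+ n).
  by rewrite rmorphM /=; ring.
rewrite -mulrBr; apply: (final h C c y) => //.
exact: (main n h y _ n0 h0 hn y0 XE hy).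
Qed.

Lemma geometric_envelope (q : R) s alpha mu (L : nat) :
  (0 < mu)%N -> 0 < q < 1 -> `|alpha| + 1 <= L%:R ->
  exists c C : R, [/\ 0 < c, 0 <= C & forall n (j : int), (0 < n)%N ->
    (absz j <= L * n)%N -> q ^+ n <= envelope C c s alpha mu n j].
Proof.
move=> mu0 /andP[q0 q1] aL; have d0 : (0 < 2 * mu)%N by rewrite muln_gt0.
have lam0 : 0 < - ln q by rewrite oppr_gt0 ln_lt0// q0.
have B0 : 0 < 1 + `|alpha| + L%:R :> R by rewrite ltr_wpDr// ltr_wpDr.
have [c [K [c0 K0 hK]]] := expRN_nat_absorb s.+1 lam0 d0 B0.
exists c, K; split=> // n j n0 jL.
have [h [y [[h0 hn hm] [y0 XE yE] Xh /(_ jL) hy _]]] := scaling j n0 mu0 aL.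
rewrite /envelope yE hm invrK (le_trans _ (hK n h y n0 h0 hn y0 hy))//.
by rewrite opprK mulrC expRM_natl lnK.
Qed.

Lemma min_pos (K : nat) (f : 'I_K -> R) : (forall k, 0 < f k) ->
  exists2 m : R, 0 < m & forall k, m <= f k.
Proof.
move=> f0; exists (\big[Num.min/1]_(k < K) f k); first exact: lt_bigmin.
by move=> k; exact: bigmin_le_cond.
Qed.

End LocalEstimates.

(** * Gluing the arcs *)

Lemma choice_pair (K : nat) (R : Type) (Q : 'I_K -> R -> R -> Prop) :
  (forall k, exists c C, Q k c C) ->
  exists c C : 'I_K -> R, forall k, Q k (c k) (C k).
Proof.
move=> h; have /choice[t ht] : forall k, exists t : R * R, Q k t.1 t.2.
  by move=> k; have [c [C hQ]] := h k; exists (c, C).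
by exists (fun k => (t k).1), (fun k => (t k).2).
Qed.

Theorem corollary1 (R : realType) (a : int -> R[i]) (K : nat)
    (kappa z : 'I_K -> R[i]) (alpha : 'I_K -> R) (mu : 'I_K -> nat)
    (beta : 'I_K -> R[i])
    (ha : ell1 a) (hA1 : condA1 a)
    (hA2bis : condA2bis a kappa z alpha mu beta)
    (hshift : exists J : int, condA23 (shiftseq a J))
    (s : 'I_K -> nat) :
  exists (P : 'I_K -> nat -> {poly {poly R[i]}}) (C c : R),
    [/\ 0 < C, 0 < c &
    forall (n : nat) (j : int), (0 < n)%N ->
      let X k := Xvar n j (alpha k) (mu k) in
      `| green a n j -
         \sum_(k < K) \sum_(1 <= sigma < (s k).+1)
           z k ^+ n * kappa k ^ j
             / (n%:R `^ (sigma%:R / (2 * mu k)%:R))%:C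
           * polyop (P k sigma) (Hgauss (mu k) (beta k)) (X k) |
      <= (\sum_(k < K)
            C / n%:R `^ ((s k).+1%:R / (2 * mu k)%:R)
            * expR (- c * `|X k| `^ ((2 * mu k)%:R / ((2 * mu k)%:R - 1))))%:C].
Proof.
have [fin_a _] := hA1.
have [S [hF hS [L0 hL0]]] := finite_support_seq fin_a.
have [K1 kinj hk hout hloc] := hA2bis.
have norm1 (v : R[i]) : `|v| = 1 -> N v = 1.
  by rewrite normcE => /(congr1 (@complex.Re R)).
have nk k : N (kappa k) = 1 by case: (hk k) => /norm1.
have nz k : N (z k) = 1 by case: (hk k) => _ _ /norm1.
have /choice[th hth] : forall k, exists t, 0 <= t < 2 * pi /\ kappa k = circ t.
  by move=> k; have [t ht ->] := circ_surj (nk k); exists t.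
(* L exceeds the reach of one application of [convL a] and every |alpha k| + 1, so one cut at L n
   serves all k. *)
pose L := (L0 + \sum_(k < K) Num.bound (`|alpha k| + 1))%N.
have aL k : `|alpha k| + 1 <= L%:R.
  have h0 : 0 <= `|alpha k| + 1 by rewrite addr_ge0.
  rewrite (le_trans (ltW (archi_boundP h0)))// ler_nat /L (bigD1 k)//=.
  by rewrite addnCA leq_addr.
have arc k := @arc_estimate R a S (kappa k) (z k) (alpha k) (beta k) (mu k) (s k) (th
  k).
have /choice[Pr hPr] : forall k, exists Pr : (nat -> {poly {poly R[i]}}) * R,
  [/\ 0 < Pr.2,
    exists c C : R, [/\ 0 < c, 0 <= C & forall n (j : int), (0 < n)%N ->
      (L * n < absz j)%N ->
      N (approx Pr.1 (s k) (kappa k) (z k) (alpha k) (mu k) (beta k) n j) <=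
        envelope C c (s k) (alpha k) (mu k) n j] &
    forall rho : R, 0 < rho -> rho <= Pr.2 ->
    exists c C : R, [/\ 0 < c, 0 <= C & forall n (j : int), (0 < n)%N ->
      (absz j <= L * n)%N ->
      N (((2 * pi)^-1)%:C * intC `[th k - rho, th k + rho]
           (fun t => symbol a (circ t) ^+ n * circ t ^ j) -
         approx Pr.1 (s k) (kappa k) (z k) (alpha k) (mu k) (beta k) n j) <=
        envelope C c (s k) (alpha k) (mu k) n j]].
  move=> k; have [mu0 b0 [M hM]] := hloc k.
  have [P [rho0 [h1 h2 h3]]] := arc k M L hF mu0 b0 (nk k) (nz k) (hth k).2 (aL k) hM.
  by exists (P, rho0).
have mu0 k : (0 < mu k)%N by case: (hloc k).
have Pr_gt0 k : 0 < (Pr k).2 by case: (hPr k).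
have [m1 m1_gt0 hm1] := min_pos Pr_gt0.
have [m2 m2_gt0 hm2] : exists2 m2 : R, 0 < m2 & forall k, m2 <= 2 * pi - th k.
  by apply: min_pos => k; rewrite subr_gt0; case: (hth k) => /andP[].
have [m3 m3_gt0 hm3] : exists2 m3 : R, 0 < m3 & forall k l, k != l -> m3 <= `|th k -
  th l|.
  (* The diagonal value 1 is a dummy that lets the minimum run over all l. *)
  have sep k : exists2 m : R, 0 < m & forall l, m <= if k == l then 1 else `|th k -
    th l|.
    apply: min_pos => l; case: eqP => // kl; rewrite normr_gt0 subr_eq0.
    by apply/eqP => e; apply: kl; apply: kinj; rewrite !(hth _).2 e.
  have /choice[m hm] : forall k, exists m : R, 0 < m /\
      forall l, m <= if k == l then 1 else `|th k - th l|.
    by move=> k; have [m ? ?] := sep k; exists m.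
  have [m3 m30 hm3] := min_pos (fun k => (hm k).1).
  exists m3 => // k l kl; rewrite (le_trans (hm3 k))//.
  by have := (hm k).2 l; rewrite (negbTE kl).
(* m1 makes rho admissible in each local estimate, m2 keeps the arcs within one period, m3 keeps
   them disjoint. *)
pose rho := Num.min m1 (Num.min (m2 / 2) (m3 / 3)).
have rho0 : 0 < rho by rewrite !lt_min m1_gt0 !divr_gt0.
have rho1 k : rho <= (Pr k).2 by rewrite (le_trans _ (hm1 k))// ge_min lexx.
have rho2 : 2 * rho <= m2.
  have : rho <= m2 / 2 by rewrite !ge_min lexx orbT.
  lra.
have rho3 : 3 * rho <= m3.
  have : rho <= m3 / 3 by rewrite !ge_min lexx !orbT.
  lra.
have pi0 := @pi_gt0 R.
have th0 k : 0 <= th k by case: (hth k) => /andP[].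
have thpi k : th k + 2 * rho <= 2 * pi by have := hm2 k; lra.
(* A period starting at -rho leaves an arc around the angle 0 in one piece. *)
pose b := - rho.
pose E : set R := `[b, b + 2 * pi]%classic.
have EP t : E t <-> b <= t <= b + 2 * pi by rewrite /E /= in_itv.
pose A k : set R := `[th k - rho, th k + rho]%classic.
have AP k t : A k t <-> `|t - th k| <= rho.
  by rewrite /A /= in_itv /= ler_distl.
have AE k : A k `<=` E.
  move=> t; rewrite /A /= in_itv /= => /andP[t1 t2]; apply/EP.
  by have := thpi k; have := th0 k; rewrite /b; lra.
have Adis k l t : A k t -> A l t -> k = l.
  move=> /AP hk1 /AP hl1; apply/eqP/negPn/negP => kl; have := hm3 k l kl.
  have -> : th k - th l = (t - th l) - (t - th k) by ring.
  have := ler_normB (t - th l) (t - th k); lra.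
have cS := contC_symbol hF.
pose f n (j : int) (t : R) := symbol a (circ t) ^+ n * circ t ^ j.
have cf n j : contC (f n j).
  by apply: contCM; [exact: contCX|exact: contC_circ_expz].
have [q q01 hq] : exists2 q : R, 0 < q < 1 & forall t, b <= t <= b + 2 * pi ->
    (forall k, rho <= `|t - th k|) -> N (symbol a (circ t)) <= q.
  apply: circle_gap; first exact: contC_normc.
  move=> t /andP[t1 t2] far_t.
  have : `|symbol a (circ t)| < 1.
    apply: hout; first by rewrite normcE normc_circ.
    move=> k; apply/eqP => tk.
    have tE : t = th k.
      apply: circ_inj; last by rewrite tk (hth k).2.
      rewrite ltr_distl; have := thpi k; have := th0 k; move: t1 t2; rewrite /b => *.
      by apply/andP; split; lra.
    by have := far_t k; rewrite tE subrr normr0 leNgt rho0.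
  by rewrite normcE -[1]/(1%:C) ltcR.
pose near_bound k c C := [/\ 0 < c, 0 <= C & forall n (j : int), (0 < n)%N ->
  (absz j <= L * n)%N -> N (((2 * pi)^-1)%:C * intC (A k) (f n j) -
    approx (Pr k).1 (s k) (kappa k) (z k) (alpha k) (mu k) (beta k) n j) <=
  envelope C c (s k) (alpha k) (mu k) n j].
have [cn [Cn hnear]] : exists cn Cn : 'I_K -> R, forall k, near_bound k (cn k) (Cn k).
  by apply: choice_pair => k; have [_ _ h] := hPr k; exact: h.
pose far_bound k c C := [/\ 0 < c, 0 <= C & forall n (j : int), (0 < n)%N ->
  (L * n < absz j)%N ->
  N (approx (Pr k).1 (s k) (kappa k) (z k) (alpha k) (mu k) (beta k) n j) <=
  envelope C c (s k) (alpha k) (mu k) n j].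
have [cr [Cr hfar]] : exists cr Cr : 'I_K -> R, forall k, far_bound k (cr k) (Cr k).
  by apply: choice_pair => k; have [_ h _] := hPr k; exact: h.
have cn_gt0 k : 0 < cn k by case: (hnear k).
have cr_gt0 k : 0 < cr k by case: (hfar k).
(* The contribution O(q^n) of the rest of the circle is charged to the envelope of this one
   point. *)
pose k0 : 'I_K := Ordinal K1.
have [cg [Cg [cg0 Cg0 hgeo]]] := geometric_envelope (s k0) (mu0 k0) q01 (aL k0).
have [c1 c10 hc1] := min_pos cn_gt0.
have [c2 c20 hc2] := min_pos cr_gt0.
pose c := Num.min cg (Num.min c1 c2).
have c0 : 0 < c by rewrite !lt_min cg0 c10.
have ccg : c <= cg by rewrite ge_min lexx.
have ccn k : c <= cn k by rewrite (le_trans _ (hc1 k))// !ge_min lexx orbT.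
have ccr k : c <= cr k by rewrite (le_trans _ (hc2 k))// !ge_min lexx !orbT.
have Cn0 k : 0 <= Cn k by case: (hnear k).
have Cr0 k : 0 <= Cr k by case: (hfar k).
(* The 1 ensures positivity; 2 Cg is the share of the rest of the circle. *)
pose C := 1 + 2 * Cg + \sum_(k < K) (Cn k + Cr k).
have Csum k : Cn k + Cr k <= \sum_(k < K) (Cn k + Cr k).
  by rewrite [leRHS](bigD1 k)//= lerDl sumr_ge0// => l _; rewrite addr_ge0.
have CC k : Cn k + 2 * Cg <= C by have := Csum k; have := Cr0 k; rewrite /C; lra.
have CCr k : Cr k <= C by have := Csum k; have := Cn0 k; rewrite /C; lra.
exists (fun k => (Pr k).1), C, c; split=> //.
  by have := Csum k0; have := Cn0 k0; have := Cr0 k0; rewrite /C; lra.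
move=> n j n0; cbv zeta; rewrite normcE lecR.
pose G k := approx (Pr k).1 (s k) (kappa k) (z k) (alpha k) (mu k) (beta k) n j.
pose V (D d : R) k := envelope D d (s k) (alpha k) (mu k) n j.
suff : N (green a n j - \sum_(k < K) G k) <= \sum_(k < K) V C c k by [].
have [jL|jL] := ltnP (L * n) (absz j).
  rewrite (green_out_of_reach hS hL0); last first.
    by rewrite (leq_ltn_trans _ jL)// leq_mul2r leq_addr orbT.
  rewrite sub0r normcN (le_trans (normc_sum _ _ _))//; apply: ler_sum => k _.
  have [_ _ h] := hfar k; rewrite (le_trans (h n j n0 jL))//.
  exact: envelope_mono.
have mE : measurable E by exact: measurable_itv.
have mA k : measurable (A k) by exact: measurable_itv.
have [D [mD DE eD]] := intC_arcs mE mA AE Adis (contC_intgC b (b + 2 * pi) (cf n j))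
  (index_enum_uniq 'I_K).
(* The length 2 pi of the period cancels the prefactor; the 2 stems from the componentwise bound on
   integrals. *)
have hD : N (((2 * pi)^-1)%:C * intC D (f n j)) <= 2 * q ^+ n.
  rewrite normcM normc_real gtr0_norm ?pi2V// mulrC ler_pdivrMr ?mulr_gt0//.
  have -> : 2 * q ^+ n * (2 * pi) = 2 * q ^+ n * (b + 2 * pi - b) by ring.
  apply: normc_intC_sub => //.
  - by rewrite lerDl mulr_ge0// ltW.
  - by move=> t /DE[].
  - apply: intgC_sub (contC_intgC b (b + 2 * pi) (cf n j)) => //.
    by move=> t /DE[].
  - by rewrite exprn_ge0// ltW//; case/andP: q01.
  - move=> t /DE[Et nA]; rewrite normcM normcX normc_expz ?normc_circ// mulr1.
    rewrite lerXn2r ?nnegrE ?normc_ge0//; first by case/andP: q01 => /ltW.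
    apply: hq; first exact/EP.
    move=> k; rewrite leNgt; apply/negP => /ltW tk.
    by apply: (nA k (mem_index_enum k)); apply/AP.
have -> : green a n j - \sum_(k < K) G k =
    \sum_(k < K) (((2 * pi)^-1)%:C * intC (A k) (f n j) - G k) +
    ((2 * pi)^-1)%:C * intC D (f n j).
  rewrite (green_Fourier b hF hS) -/(f n j) -/E eD sumrB -mulr_sumr mulrDr.
  by rewrite addrAC.
rewrite (le_trans (normcD _ _))//.
apply: (@le_trans _ _ (\sum_(k < K) (V (Cn k) c k + V (2 * Cg) c k))).
  rewrite [leRHS]big_split /=; apply: lerD.
    rewrite (le_trans (normc_sum _ _ _))//; apply: ler_sum => k _.
    have [_ _ h] := hnear k; rewrite (le_trans (h n j n0 jL))//.
    exact: envelope_mono.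
  rewrite (le_trans hD)// (bigD1 k0)//= -[leLHS]addr0 lerD//.
    have -> : V (2 * Cg) c k0 = 2 * V Cg c k0 by rewrite /V /envelope -!mulrA.
    rewrite ler_pM2l// (le_trans (hgeo n j n0 jL))//.
    exact: envelope_mono.
  by apply: sumr_ge0 => k _; apply: envelope_ge0; rewrite mulr_ge0.
apply: ler_sum => k _.
have -> : V (Cn k) c k + V (2 * Cg) c k = V (Cn k + 2 * Cg) c k.
  by rewrite /V /envelope -!mulrDl.
by apply: envelope_mono => //; rewrite addr_ge0// mulr_ge0.
Qed.
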